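(* Let $\mathcal M^\sigma$ be the free $\mathbb Z[x,x^{-1}]$-module with basis $\{M^\sigma_\tau:\tau\in\mathcal K^J\}$. (a) There is a unique $\mathcal H$-module structure on $\mathcal M^\sigma$ with, for all $s\in S$ and $\tau\in\mathcal K^J$: $H_sM^\sigma_\tau=M^\sigma_{s\tau}$ if $s\in\mathrm{Asc}^<(\tau;\sigma)$; $H_sM^\sigma_\tau=M^\sigma_{s\tau}+(x-x^{-1})M^\sigma_\tau$ if $s\in\mathrm{Des}^<(\tau;\sigma)$; $H_sM^\sigma_\tau=-x^{-1}M^\sigma_\tau$ if $s\in\mathrm{Asc}^=(\tau;\sigma)$; $H_sM^\sigma_\tau=xM^\sigma_\tau$ if $s\in\mathrm{Des}^=(\tau;\sigma)$. (b) There is a unique $\mathcal H$-compatible bar operator $M\mapsto\overline M$ on $\mathcal M^\sigma$ fixing $M^\sigma_\tau$ for every $\tau\in\mathcal K^J$ with $\mathrm{Des}^<(\tau;\sigma)=\varnothing$; it is an involution and satisfies $\overline{M^\sigma_\tau}\in M^\sigma_\tau+\sum_{\upsilon\prec\tau}\mathbb Z[x,x^{-1}]M^\sigma_\upsilon$ for all $\tau$. (c) $\mathcal M^\sigma$ has a unique basis $\{\underline M^\sigma_\tau:\tau\in\mathcal K^J\}$ with $\overline{\underline M^\sigma_\tau}=\underline M^\sigma_\tau\in M^\sigma_\tau+\sum_{\upsilon\prec\tau}x^{-1}\mathbb Z[x^{-1}]M^\sigma_\upsilon$ for all $\tau\in\mathcal K^J$.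
   Context: Let $(W,S)$ be a finite Coxeter system with length $\ell$, Bruhat order $\le$, reflections $T=\{wsw^{-1}:w\in W,s\in S\}$. $\mathrm{Aut}(W,S)$: automorphisms $\varphi$ of $W$ with $\varphi(S)=S$; $W^+=W\rtimes\mathrm{Aut}(W,S)$ with $(v,\alpha)(w,\beta)=(v\,\alpha(w),\alpha\beta)$, $\ell(w,\varphi)=\ell(w)$, $w\equiv(w,1)$. $z\in W^+$ is a perfect involution if $z^2=1$ and $(zt)^4=1$ for all $t\in T$. Fix $J\subseteq S$: $W_J=\langle J\rangle$; $\mathscr I_J$ = perfect involutions of $(W_J)^+=W_J\rtimes\mathrm{Aut}(W_J,J)$, with $W_J$ acting by $v:(y,\theta)\mapsto(v\,y\,\theta(v)^{-1},\theta)$; $z$ is $W_J$-minimal if $\ell(szs)\ge\ell(z)$ for all $s\in J$ (unique in each $W_J$-class). $W^J=\{w:\ell(ws)>\ell(w)\ \forall s\in J\}$, $\mathcal K^J=W^J\times\mathscr I_J$, $\mathrm{ht}(w,z)=\ell(w)+\tfrac12(\ell(z)-\ell(z_{\min}))$ with $z_{\min}$ the $W_J$-minimal conjugate of $z$. For $s\in S$, $\tau=(w,z)$: $s\tau=(sw,z)$ if $sw\in W^J$, else $s\tau=(w,tzt)$ with $t=w^{-1}sw\in J$; this is a $W$-action. Quasiparabolic Bruhat order on $\mathscr I_J$: transitive closure of $z<tzt$ for reflections $t$ of $W_J$ with $\ell(z)<\ell(tzt)$. Partial order $\prec$ on $\mathcal K^J$: $(w,z)\prec(w',z')$ iff same $W$-orbit,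 $\mathrm{ht}(w,z)<\mathrm{ht}(w',z')$, and either $w<w'$ (Bruhat) or $w=w'$ and $z<z'$ (quasiparabolic Bruhat). Fix a homomorphism $\sigma:W_J\to\{\pm1\}$; for $\tau=(w,z)$: $\mathrm{Asc}^<(\tau;\sigma)=\{s:\mathrm{ht}(s\tau)>\mathrm{ht}(\tau)\}$, $\mathrm{Des}^<(\tau;\sigma)=\{s:\mathrm{ht}(s\tau)<\mathrm{ht}(\tau)\}$, $\mathrm{Asc}^=(\tau;\sigma)=\{s:\mathrm{ht}(s\tau)=\mathrm{ht}(\tau),\ \sigma(w^{-1}sw)=-1\}$, $\mathrm{Des}^=(\tau;\sigma)=\{s:\mathrm{ht}(s\tau)=\mathrm{ht}(\tau),\ \sigma(w^{-1}sw)=1\}$ (when $\mathrm{ht}(s\tau)=\mathrm{ht}(\tau)$, $w^{-1}sw\in J$). $\mathcal H$: the Iwahori–Hecke algebra of $(W,S)$, free over $\mathbb Z[x,x^{-1}]$ with basis $H_w$, $H_sH_w=H_{sw}$ if $\ell(sw)>\ell(w)$, $H_{sw}+(x-x^{-1})H_w$ otherwise. Antilinear means $\phi(pa)=\bar p\phi(a)$ with $\bar{\ }:x\mapsto x^{-1}$. The bar operator of $\mathcal H$ is the antilinear ring involution with $\overline{H_w}=(H_{w^{-1}})^{-1}$; an $\mathcal H$-compatible bar operator on an $\mathcal H$-module is an antilinear map with $\overline{HA}=\overline H\,\overline A$. *)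

(* Defs.v *)
From HB Require Import structures.
From mathcomp Require Import all_boot all_order all_algebra all_fingroup.
From mathcomp Require Import fraction.
From Stdlib Require Import ClassicalEpsilon.

Set Implicit Arguments.
Unset Strict Implicit.
Unset Printing Implicit Defensive.

Import GRing.Theory.
Local Open Scope ring_scope.

(* The ring Z[x, x^{-1}] of Laurent polynomials, realised as the       *)
(* subring of the fraction field Q(x) = Frac(Z[x]) consisting of the   *)
(* elements p / x^n with p in Z[x].                                    *)

Definition Fx := {fraction {poly int}}.
Notation tofr := (@FracField.tofrac _).
Notation "x %:F" := (tofr x).
Definition xF : Fx := ('X)%:F.

Definition laurent_prop (f : Fx) : Prop :=
  exists (p : {poly int}) (n : nat), f = p%:F / xF ^+ n.
Definition is_laurent (f : Fx) : bool :=
  if excluded_middle_informative (laurent_prop f) then true else false.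

Lemma is_laurentP f : reflect (laurent_prop f) (is_laurent f).
Proof.
by rewrite /is_laurent; case: excluded_middle_informative => h; constructor.
Qed.

Lemma xF_neq0 : xF != 0.
Proof. by rewrite /xF -(rmorph0 tofr) tofrac_eq polyX_eq0. Qed.

Lemma frac_sub (F : fieldType) (A B P Q : F) : A != 0 -> B != 0 ->
  P / A - Q / B = (P * B - Q * A) / (A * B).
Proof.
move=> hA hB.
by rewrite invfM mulrBl -!mulrA [B * _]mulrC !mulrA mulfK // mulrAC mulfK.
Qed.

Lemma frac_mul (F : fieldType) (A B P Q : F) :
  P / A * (Q / B) = (P * Q) / (A * B).
Proof. by rewrite invfM mulrACA. Qed.

Lemma laurent_closed : subring_closed is_laurent.
Proof.
have xn n : xF ^+ n != 0 by rewrite expf_neq0 // xF_neq0.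
split.
- by apply/is_laurentP; exists 1, 0%N; rewrite rmorph1 expr0 divr1.
- move=> a b /is_laurentP [p [n ->]] /is_laurentP [q [m ->]]; apply/is_laurentP.
  exists (p * 'X^m - q * 'X^n), (n + m)%N.
  by rewrite frac_sub // rmorphB !rmorphM !rmorphXn /= -/xF exprD.
- move=> a b /is_laurentP [p [n ->]] /is_laurentP [q [m ->]]; apply/is_laurentP.
  exists (p * q), (n + m)%N.
  by rewrite frac_mul rmorphM exprD.
Qed.

Record laurent := Laurent { lval :> Fx ; lvalP : is_laurent lval }.
HB.instance Definition _ := [isSub for lval].
HB.instance Definition _ := [Choice of laurent by <:].
HB.instance Definition _ :=
  GRing.SubChoice_isSubComNzRing.Build Fx is_laurent laurent laurent_closed.

Lemma xL_proof : is_laurent xF.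
Proof. by apply/is_laurentP; exists 'X, 0%N; rewrite expr0 divr1. Qed.

Lemma xLinv_proof : is_laurent (xF^-1).
Proof. by apply/is_laurentP; exists 1, 1%N; rewrite rmorph1 expr1 div1r. Qed.

Definition xL : laurent := Laurent xL_proof.
Definition xLinv : laurent := Laurent xLinv_proof.

(* the bar involution of Z[x,x^{-1}]:  sum a_i x^i |-> sum a_i x^{-i}
   (written f = p(x) / x^n  |->  p(x^{-1}) x^n) *)
Definition lbar_rel (f g : laurent) : Prop :=
  exists (p : {poly int}) (n : nat),
    lval f = p%:F / xF ^+ n /\
    lval g = (\sum_(i < size p) (p`_i)%:~R / xF ^+ i) * xF ^+ n.
Definition lbar (f : laurent) : laurent := epsilon (inhabits 0) (lbar_rel f).

Definition in_negpart (f : laurent) : Prop :=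
  exists p : {poly int}, lval f = \sum_(i < size p) (p`_i)%:~R / xF ^+ i.+1.

(* Coxeter systems.  W is the whole finite group gT, S a set of        *)
(* generators.                                                         *)

Section Coxeter.
Variable gT : finGroupType.
Local Open Scope group_scope.

Fixpoint wordset (S : {set gT}) (n : nat) : {set gT} :=
  if n is n'.+1 then wordset S n' :|: [set x * s | x in wordset S n', s in S]
  else [set 1].

(* length with respect to the generating set S: the least n such that w
   is a product of n generators (w is always reachable within #|gT|
   steps when S generates a group containing w) *)
Definition len (S : {set gT}) (w : gT) : nat :=
  find (fun n => w \in wordset S n) (iota 0 #|gT|).

Definition reflections (G S : {set gT}) : {set gT} :=
  [set w * s * w^-1 | w in G, s in S].

(* (gT, S) is a (finite) Coxeter system: S is a generating set of
   involutions and gT has the Coxeter presentation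
   < S | (s t)^{m(s,t)} = 1 >, m(s,t) = order of s t, expressed by the
   universal property of that presentation (tested on finite groups). *)
Definition coxeter_system (S : {set gT}) : Prop :=
  [/\ <<S>> = [set: gT],
      {in S, forall s, #[s] = 2%N} &
      forall (hT : finGroupType) (f : gT -> hT),
        {in S &, forall s t, (f s * f t) ^+ #[s * t] = 1} ->
        exists phi : {morphism [set: gT] >-> hT}, {in S, forall s, phi s = f s}].

(* an element (w, phi) is stored as a pair in gT * {perm gT};
   automorphisms of G are the elements of MathComp's  Aut G  *)
Definition ext := (gT * {perm gT})%type.

(* (v,a)(w,b) = (v a(w), a o b);  in MathComp (b * a) x = a (b x) *)
Definition emul (a b : ext) : ext := (a.1 * a.2 b.1, b.2 * a.2).
Definition eone : ext := (1, 1).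
Definition einj (w : gT) : ext := (w, 1).

Definition in_ext (G J : {set gT}) (a : ext) : bool :=
  [&& a.1 \in G, a.2 \in Aut G & a.2 @: J == J].

Definition perfect (T : {set gT}) (z : ext) : bool :=
  (emul z z == eone) &&
  [forall t in T, let u := emul z (einj t) in
                  emul u (emul u (emul u u)) == eone].

End Coxeter.

Unset Implicit Arguments.
Section Setting.
Context {gT : finGroupType}.
Variables (S J : {set gT}).
Variable sigma : gT -> int.
Local Open Scope group_scope.

Definition WJ : {set gT} := <<J>>.
Definition TJ : {set gT} := reflections WJ J.
Definition T : {set gT} := reflections [set: gT] S.

Definition IJ : {set ext gT} := [set z | in_ext WJ J z && perfect TJ z].

Definition elen (z : ext gT) : nat := len J z.1.

Definition vconj (v : gT) (z : ext gT) : ext gT := (v * z.1 * (z.2 v)^-1, z.2).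

Definition Wmin (z : ext gT) : bool :=
  [forall s in J, (elen z <= elen (emul (emul (einj s) z) (einj s)))%N].

Definition zclass (z : ext gT) : {set ext gT} := [set vconj v z | v in WJ].

Definition len_zmin (z : ext gT) : nat :=
  if [pick z' in zclass z | Wmin z'] is Some z' then elen z' else 0%N.

Definition WJup : {set gT} := [set w | [forall s in J, (len S w < len S (w * s))%N]].
Definition KJ : {set gT * ext gT} := [set tau | (tau.1 \in WJup) && (tau.2 \in IJ)].
Definition KJt : finType := {tau : gT * ext gT | tau \in KJ}.

Definition ht (tau : gT * ext gT) : rat :=
  ((len S tau.1)%:R + ((elen tau.2)%:R - (len_zmin tau.2)%:R) / 2%:R)%R.

Definition sact (s : gT) (tau : gT * ext gT) : gT * ext gT :=
  if s * tau.1 \in WJup then (s * tau.1, tau.2)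
  else let t := tau.1^-1 * s * tau.1 in
       (tau.1, emul (emul (einj t) tau.2) (einj t)).

Definition same_orbit (tau ups : gT * ext gT) : bool :=
  connect (fun a b => [exists s in S, b == sact s a]) tau ups.

Definition bruhat_lt (v w : gT) : bool :=
  (v != w) &&
  connect (fun a b => [exists t in T, (b == a * t) && (len S a < len S b)%N]) v w.

Definition qbruhat_lt (z z' : ext gT) : bool :=
  (z != z') &&
  connect (fun a b => [&& a \in IJ, b \in IJ &
             [exists t in TJ, (b == emul (emul (einj t) a) (einj t))
                              && (elen a < elen b)%N]]) z z'.

Definition prec (ups tau : gT * ext gT) : bool :=
  [&& same_orbit ups tau, (ht ups < ht tau)%R &
      bruhat_lt ups.1 tau.1 || ((ups.1 == tau.1) && qbruhat_lt ups.2 tau.2)].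

Definition no_strict_descent (tau : gT * ext gT) : bool :=
  [forall s in S, ~~ (ht (sact s tau) < ht tau)%R].

Definition Mod := {ffun KJt -> laurent}.
Definition msc (c : laurent) (m : Mod) : Mod := [ffun i : KJt => (c * m i)%R].
(* the basis element M_tau (tau is assumed to lie in K^J) *)
Definition Mb (tau : gT * ext gT) : Mod :=
  [ffun i : KJt => if val i == tau then 1%R else 0%R].

Definition Hs_Mb (s : gT) (tau : gT * ext gT) : Mod :=
  let st := sact s tau in
  if (ht tau < ht st)%R then Mb st                                  (* Asc^< *)
  else if (ht st < ht tau)%R then (Mb st + msc (xL - xLinv) (Mb tau))%R (* Des^< *)
  else if sigma (tau.1^-1 * s * tau.1) == (-1)%R
       then msc (- xLinv)%R (Mb tau)                                 (* Asc^= *)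
       else msc xL (Mb tau).                                         (* Des^= *)

Definition Hk := {ffun gT -> laurent}.
Definition hsc (c : laurent) (h : Hk) : Hk := [ffun w : gT => (c * h w)%R].
Definition Hb (w : gT) : Hk := [ffun u : gT => if u == w then 1%R else 0%R].
Definition Hone : Hk := Hb 1.

(* left multiplication by H_s:
   H_s H_w = H_{sw} if l(sw) > l(w), H_{sw} + (x - x^{-1}) H_w otherwise *)
Definition Lgen (s : gT) (b : Hk) : Hk :=
  [ffun u : gT => (b (s * u)%g +
              (if (len S (s * u)%g < len S u)%N then (xL - xLinv) * b u else 0))%R].

(* left multiplication by H_w = H_{s_1} ... H_{s_k} (reduced word) *)
Fixpoint Happ (n : nat) (w : gT) (b : Hk) : Hk :=
  if n is n'.+1 then
    if [pick s in S | (len S (s * w) < len S w)%N] is Some s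
    then Lgen s (Happ n' (s * w) b) else b
  else b.

Definition Hmul (a b : Hk) : Hk := (\sum_(w : gT) hsc (a w) (Happ (len S w) w b))%R.

Definition Hinv (w : gT) : Hk :=
  epsilon (inhabits Hone)
    (fun h => Hmul h (Hb w) = Hone /\ Hmul (Hb w) h = Hone).

Definition barH (h : Hk) : Hk := (\sum_(w : gT) hsc (lbar (h w)) (Hinv w^-1))%R.

Definition hecke_module_structure (act : Hk -> Mod -> Mod) : Prop :=
  [/\ forall c h h' m, act (hsc c h + h')%R m = (msc c (act h m) + act h' m)%R,
      forall c h m m', act h (msc c m + m')%R = (msc c (act h m) + act h m')%R,
      forall m, act Hone m = m,
      forall h h' m, act (Hmul h h') m = act h (act h' m) &
      forall s (i : KJt), s \in S -> act (Hb s) (Mb (val i)) = Hs_Mb s (val i)].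

Definition bar_operator (act : Hk -> Mod -> Mod) (psi : Mod -> Mod) : Prop :=
  [/\ forall c m m', psi (msc c m + m')%R = (msc (lbar c) (psi m) + psi m')%R,
      forall h m, psi (act h m) = act (barH h) (psi m) &
      forall i : KJt, no_strict_descent (val i) -> psi (Mb (val i)) = Mb (val i)].

Definition is_basis (B : KJt -> Mod) : Prop :=
  forall m : Mod, exists! c : {ffun KJt -> laurent},
    m = (\sum_(i : KJt) msc (c i) (B i))%R.

End Setting.

(* Main.v *)
(** The universal property of a Coxeter group, applied to permutations of
    W x {+1,-1}, gives the cocycle of left inversion sets
    N(uv) = N(u) + u N(v) u^-1, whence the exchange condition, parabolic
    decompositions and Matsumoto's theorem. For a perfect involution
    z = (y, theta) every reflection r commutes with z r z; comparing N(y) with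
    N(g y theta(g)^-1) shows that conjugation by r raises the length iff r is
    not in N(y), and that a class has a single minimal element.

    The braid relations on the span of the perfect involutions of W_J^+ are
    checked on the orbit of a minimal z under a dihedral parabolic <s,t>.
    Either z sends no reflection of <s,t> to a different one, and the orbit is
    a quotient of the regular module; or the product of such a reflection and
    its conjugate is the longest element of <s,t> and fixes z, and the orbit
    has at most two points. The module M is then induced from H_J to H.

    The bar operator maps H_w (x) M_(y,theta) to
    c bar(H_w) bar(H_y) M_(y^-1,theta), where c depends only on the class and is
    fixed at the minimal element, for which every letter of y stabilises z. It
    is unique, and an involution, because M is generated by the elements without
    strict descents; unitriangularity follows by lifting in both Bruhat orders,
    and the canonical basis by the Kazhdan-Lusztig argument. *)

Require Import Defs.
From HB Require Import structures.
From mathcomp Require Import all_boot all_order all_algebra all_fingroup.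
From mathcomp Require Import cyclic zify ring.
From Stdlib Require Import ClassicalEpsilon FunctionalExtensionality.

Set Implicit Arguments.
Unset Strict Implicit.
Unset Printing Implicit Defensive.

Import GRing.Theory Num.Theory.

(** * Alternating operators *)

Section AlternatingOperators.
Variable T : Type.
Implicit Types (f g : T -> T) (k : nat) (x : T).

(* [f (g (f ...))] with [k] factors. *)
Fixpoint altop f g k x : T := if k is k'.+1 then f (altop g f k' x) else x.

Lemma altopSr f g k x :
  altop f g k.+1 x = altop f g k ((if odd k then g else f) x).
Proof.
elim: k f g => // k IH f g.
by rewrite -[LHS]/(f (altop g f k.+1 x)) IH /= if_neg.
Qed.

Lemma altopK f g f' g' k : cancel f f' -> cancel g g' ->
  cancel (altop f g k) (if odd k then altop f' g' k else altop g' f' k).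
Proof.
elim: k f g f' g' => [//|k IH] f g f' g' fK gK x.
rewrite (_ : (if _ then _ else _) =
             (if odd k then altop g' f' k.+1 else altop f' g' k.+1)); last first.
  by rewrite /= if_neg.
have := IH g f g' f' gK fK x; rewrite [altop f g k.+1 x]/=.
by case Ek: (odd k); rewrite altopSr Ek fK.
Qed.

Lemma altop_commute (P : T -> Prop) f g k x :
  (forall y, P y -> P (f y)) -> (forall y, P y -> P (g y)) ->
  (forall y, P y -> f (g y) = g (f y)) -> ~~ odd k -> P x ->
  altop f g k x = altop g f k x.
Proof.
move=> Pf Pg fgC /even_halfK <- Px; set j := k./2.
suff : altop f g j.*2 x = altop g f j.*2 x /\ P (altop f g j.*2 x) by case.
elim: j => [//|j [IH Pj]]; rewrite doubleS /= -IH fgC //; split=> //.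
by apply/Pg/Pf.
Qed.

Lemma altop_same (P : T -> Prop) f g k x :
  (forall y, P y -> P (f y)) -> (forall y, P y -> f y = g y) -> P x ->
  altop f g k x = altop g f k x.
Proof.
move=> Pf fg Px; have Pi i : P (iter i f x) by elim: i => //= i; apply: Pf.
suff E j : altop f g j x = iter j f x /\ altop g f j x = iter j f x.
  by case: (E k) => -> ->.
by elim: j => //= j [-> ->]; rewrite fg.
Qed.

End AlternatingOperators.

Lemma altop_intertwine (T U : Type) (pi : T -> U) f g f' g' k x :
  (forall y, pi (f y) = f' (pi y)) -> (forall y, pi (g y) = g' (pi y)) ->
  pi (altop f g k x) = altop f' g' k (pi x).
Proof.
by elim: k f g f' g' => //= k IH f g f' g' pif pig; rewrite pif (IH g f g' f').
Qed.

(** * Free modules *)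

(* Locked: comparing [delta x] with [delta y] would otherwise unfold [x == y] down to
   the membership tests of the finite sets involved. *)
HB.lock Definition delta {R : nzRingType} {X : finType} (x : X) : {ffun X -> R^o} :=
  [ffun y => (y == x)%:R%R].

Section FreeModule.
Local Open Scope ring_scope.
Variables (R : nzRingType) (X : finType).
Local Notation V := {ffun X -> R^o}.
(* In [c *: delta x] the ring would be inferred as [R^o]. *)
Local Notation delta := (@delta R _).
Implicit Types (c : R) (m : V) (x y : X) (A : {set X}).

Lemma deltaE x y : delta x y = (y == x)%:R :> R^o.
Proof. by rewrite delta.unlock ffunE. Qed.

Lemma ffun_scaleE c m x : (c *: m) x = c * m x.
Proof. exact: ffunE. Qed.

Lemma ffun_subE m m' x : (m - m') x = m x - m' x.
Proof. by rewrite !ffunE. Qed.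

Lemma sum_deltaE (P : pred X) (c : X -> R) x :
  (\sum_(y | P y) c y *: delta y : V) x = if P x then c x else 0.
Proof.
rewrite sum_ffunE big_mkcond (bigD1 x) //= big1 ?addr0 => [|y yx].
  by case: (P x); rewrite // ffun_scaleE deltaE eqxx mulr1.
by case: (P y); rewrite // ffun_scaleE deltaE eq_sym (negPf yx) mulr0.
Qed.

Lemma delta_expand m : m = \sum_x m x *: delta x.
Proof. by apply/ffunP => x; rewrite sum_deltaE. Qed.

Definition supported A m : Prop := forall x, x \notin A -> m x = 0.

Lemma supported_delta A x : x \in A -> supported A (delta x).
Proof.
by move=> xA y; rewrite deltaE; case: eqVneq => // ->; rewrite xA.
Qed.

Lemma supportedD A m m' : supported A m -> supported A m' -> supported A (m + m').
Proof. by move=> mA m'A x xA; rewrite ffunE mA // m'A // addr0. Qed.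

Lemma supportedZ A c m : supported A m -> supported A (c *: m).
Proof. by move=> mA x xA; rewrite ffun_scaleE mA // mulr0. Qed.

Lemma supportedT m : supported setT m.
Proof. by move=> x; rewrite inE. Qed.

Section LinearMaps.
Variables (U : zmodType) (s : GRing.Scale.law R U).
Implicit Types f g : {linear V -> U | s}.

Lemma linear_supported_ext f g A m : supported A m ->
  {in A, forall x, f (delta x) = g (delta x)} -> f m = g m.
Proof.
move=> mA fg; rewrite (delta_expand m) !linear_sum; apply: eq_bigr => x _.
have [xA|xA] := boolP (x \in A); first by rewrite !linearZ fg.
by rewrite mA // scale0r !linear0.
Qed.

Lemma linear_delta_ext f g : (forall x, f (delta x) = g (delta x)) -> f =1 g.
Proof. by move=> fg m; apply: (linear_supported_ext (supportedT m)). Qed.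

End LinearMaps.

Lemma linear_supported (f : {linear V -> V}) A m :
  {in A, forall x, supported A (f (delta x))} -> supported A m -> supported A (f m).
Proof.
move=> fA mA y yA; rewrite (delta_expand m) linear_sum sum_ffunE big1 // => x _.
rewrite linearZ ffun_scaleE; have [xA|xA] := boolP (x \in A); last by rewrite mA // mul0r.
by rewrite fA // mulr0.
Qed.

Section Lift.
Variables (U : lmodType R) (bar : {rmorphism R -> R}) (v : X -> U).

Definition linear_lift m : U := \sum_x m x *: v x.

Fact linear_lift_is_linear : linear linear_lift.
Proof.
move=> c m m'; rewrite /linear_lift scaler_sumr -big_split /=.
by apply: eq_bigr => x _; rewrite !ffunE scalerDl scalerA.
Qed.
HB.instance Definition _ :=
  GRing.isLinear.Build R V U *:%R linear_lift linear_lift_is_linear.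

Lemma linear_lift_delta x : linear_lift (delta x) = v x.
Proof.
rewrite /linear_lift (bigD1 x) //= big1 => [|y yx]; rewrite deltaE.
  by rewrite eqxx scale1r addr0.
by rewrite (negPf yx) scale0r.
Qed.

Definition semilinear_lift m : U := \sum_x bar (m x) *: v x.

Fact semilinear_lift_is_semilinear : linear_for (bar \; *:%R) semilinear_lift.
Proof.
move=> c m m'; rewrite /semilinear_lift /= scaler_sumr -big_split /=.
by apply: eq_bigr => x _; rewrite !ffunE rmorphD rmorphM scalerDl scalerA.
Qed.
HB.instance Definition _ :=
  GRing.isLinear.Build R V U (bar \; *:%R) semilinear_lift
    semilinear_lift_is_semilinear.

Lemma semilinear_lift_delta x : semilinear_lift (delta x) = v x.
Proof.
rewrite /semilinear_lift (bigD1 x) //= big1 => [|y yx]; rewrite deltaE.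
  by rewrite eqxx rmorph1 scale1r addr0.
by rewrite (negPf yx) rmorph0 scale0r.
Qed.

End Lift.

Lemma linear_packed (U : zmodType) (s : GRing.Scale.law R U) (f : V -> U) :
  linear_for s f -> exists g : {linear V -> U | s}, f = g :> (V -> U).
Proof.
move=> fL.
by exists (HB.pack_for {linear V -> U | s} f (GRing.isLinear.Build R V U s f fL)).
Qed.

Lemma semilinearZ (U : lmodType R) (bar : {rmorphism R -> R})
    (f : {linear V -> U | bar \; *:%R}) c m : f (c *: m) = bar c *: f m.
Proof. exact: linearZ. Qed.

Lemma semilinear_expand (U : lmodType R) (bar : {rmorphism R -> R})
    (f : {linear V -> U | bar \; *:%R}) m :
  f m = \sum_x bar (m x) *: f (delta x).
Proof.
rewrite {1}(delta_expand m) linear_sum; apply: eq_bigr => x _.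
by rewrite semilinearZ.
Qed.

Lemma semilinear_involutive (bar : {rmorphism R -> R})
    (f : {linear V -> V | bar \; *:%R}) :
  involutive bar -> (forall x, f (f (delta x)) = delta x) -> involutive f.
Proof.
move=> barK fK m; rewrite (semilinear_expand f m) linear_sum [RHS]delta_expand.
by apply: eq_bigr => x _; rewrite semilinearZ barK fK.
Qed.

End FreeModule.

Lemma semilinear_intertwine (R : nzRingType) (bar : {rmorphism R -> R}) (X : finType)
    (V U U' : lmodType R) (f : {linear {ffun X -> R^o} -> U | bar \; *:%R})
    (f' : {linear V -> U' | bar \; *:%R}) (g : {linear {ffun X -> R^o} -> V})
    (h : {linear U -> U'}) :
  (forall x, f' (g (@delta R X x)) = h (f (@delta R X x))) -> forall m, f' (g m) = h (f m).
Proof.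
move=> fgE m; rewrite (delta_expand m) !linear_sum; apply: eq_bigr => x _.
by rewrite (linearZ_LR g) [f' _]linearZ [f _]linearZ /= linearZ_LR fgE.
Qed.

Section AlternatingLinear.
Local Open Scope ring_scope.
Variables (R : nzRingType) (V : lmodType R) (f g : {linear V -> V}).

Fact altop_is_linear k : linear (altop f g k).
Proof.
suff: linear (altop f g k) /\ linear (altop g f k) by case.
elim: k => [|k [fgk gfk]]; first by [].
by split=> c m m' /=; rewrite (fgk, gfk) linearP.
Qed.
HB.instance Definition _ k :=
  GRing.isLinear.Build R V V *:%R (altop f g k) (altop_is_linear k).

End AlternatingLinear.

Section HeckeOperator.
Local Open Scope ring_scope.
Variables (R : comNzRingType) (q : R).
Variables (X : finType) (act : X -> X) (height : X -> nat) (eigen : X -> R).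
Local Notation V := {ffun X -> R^o}.
Local Notation delta := (@delta R _).
Implicit Types (x : X) (m : V).

Definition hecke_step x : V :=
  if (height x < height (act x))%N then delta (act x)
  else if (height (act x) < height x)%N then delta (act x) + q *: delta x
  else eigen x *: delta x.

Definition hecke_op : {linear V -> V} := linear_lift hecke_step.

Lemma hecke_opE x : hecke_op (delta x) = hecke_step x.
Proof. exact: linear_lift_delta. Qed.

Lemma hecke_op_up x : (height x < height (act x))%N -> hecke_op (delta x) = delta (act x).
Proof. by rewrite hecke_opE /hecke_step => ->. Qed.

Lemma hecke_op_down x : (height (act x) < height x)%N ->
  hecke_op (delta x) = delta (act x) + q *: delta x.
Proof. by rewrite hecke_opE /hecke_step => lt_x; rewrite ltnNge ltnW //= lt_x. Qed.

Lemma hecke_op_level x : height (act x) = height x ->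
  hecke_op (delta x) = eigen x *: delta x.
Proof. by rewrite hecke_opE /hecke_step => ->; rewrite ltnn. Qed.

Lemma hecke_op_quadratic m : involutive act ->
  (forall x, height (act x) = height x -> eigen x * eigen x = 1 + q * eigen x) ->
  hecke_op (hecke_op m) = m + q *: hecke_op m.
Proof.
move=> actK eigen_quadratic.
pose f : {linear V -> V} := hecke_op \o hecke_op.
pose g : {linear V -> V} := idfun \+ q \*: hecke_op.
apply: (linear_delta_ext (f := f) (g := g)) => x; rewrite /f /g /=.
have [lt_x|lt_x|eq_x] := ltngtP (height x) (height (act x)).
- by rewrite hecke_op_up // hecke_op_down actK.
- by rewrite hecke_op_down // linearD linearZ /= hecke_op_up actK // hecke_op_down.
rewrite hecke_op_level // linearZ /= hecke_op_level // !scalerA eigen_quadratic //.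
by rewrite scalerDl scale1r.
Qed.

Lemma hecke_op_supported (A : {set X}) m : {in A, forall x, act x \in A} ->
  supported A m -> supported A (hecke_op m).
Proof.
move=> actA; apply: linear_supported => x xA; rewrite hecke_opE /hecke_step.
case: ifP => _; first exact/supported_delta/actA.
case: ifP => _; last exact/supportedZ/supported_delta.
by apply: supportedD; [|apply: supportedZ]; apply: supported_delta; rewrite ?actA.
Qed.

End HeckeOperator.
Arguments hecke_op : simpl never.

(** * Canonical bases *)

Section CanonicalBasis.
Local Open Scope ring_scope.
Variables (R : nzRingType) (bar : {rmorphism R -> R}) (neg : R -> Prop).
Hypothesis neg0 : neg 0.
Hypothesis negD : forall f g, neg f -> neg g -> neg (f + g).
Hypothesis negN : forall f, neg f -> neg (- f).
Hypothesis neg_bar_fixed : forall f, neg f -> bar f = f -> f = 0.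
Hypothesis neg_bar_split : forall f, bar f = - f -> exists2 g, neg g & f = g - bar g.

Variables (X : finType) (lt : rel X).
Hypothesis lt_irr : irreflexive lt.
Hypothesis lt_trans : transitive lt.

Local Notation V := {ffun X -> R^o}.
Local Notation delta := (@delta R _).
Implicit Types (x y z : X) (A : {set X}) (m : V) (B : X -> V).

Definition down_closed A : Prop := forall x y, lt x y -> y \in A -> x \in A.

Definition maximal_in A x : Prop := {in A, forall y, lt x y = false}.

Lemma exists_maximal A : A != set0 -> exists2 x, x \in A & maximal_in A x.
Proof.
case/set0Pn=> x0 x0A.
case: (arg_maxnP (P := mem A) (fun x => #|[set y | lt y x]|) x0A) => x xA xmax.
exists x => // y yA; apply/negP => lt_xy.
have := xmax y yA; apply/negP; rewrite -ltnNge; apply: proper_card.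
apply/properP; split; last by exists x; rewrite inE ?lt_irr.
by apply/subsetP => z; rewrite !inE => /lt_trans; apply.
Qed.

Lemma down_closed_ind (P : {set X} -> Prop) :
  P set0 ->
  (forall A x, down_closed A -> x \in A -> maximal_in A x -> P (A :\ x) -> P A) ->
  forall A, down_closed A -> P A.
Proof.
move=> P0 PS A; have [k] := ubnP #|A|; elim: k A => // k IH A cA dA.
have [->//|/exists_maximal [x xA xmax]] := eqVneq A set0.
apply: (PS _ _ dA xA xmax); apply: IH => [|y z yz].
  by move: cA; rewrite (cardsD1 x) xA.
rewrite !inE => /andP [_ zA]; rewrite (dA y z) // andbT.
by apply: contraTneq yz => ->; rewrite xmax.
Qed.

Lemma down_closed_lt x : down_closed [set y | lt y x].
Proof. by move=> y z yz; rewrite !inE; apply: lt_trans. Qed.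

Lemma supportedD1 A x m : supported A m -> m x = 0 -> supported (A :\ x) m.
Proof. by move=> mA mx y; rewrite !inE negb_and negbK => /predU1P [->|/mA]. Qed.

Definition unitriangular B : Prop := forall x,
  exists c : X -> R, B x = delta x + \sum_(y | lt y x) c y *: delta y.

Section Unitriangular.
Variable B : X -> V.
Hypothesis triB : unitriangular B.

Lemma unitriangularE x y :
  B x y = if y == x then 1 else if lt y x then B x y else 0.
Proof.
case: (triB x) => c ->; rewrite ffunE deltaE sum_deltaE.
by case: eqVneq => [->|_]; rewrite ?lt_irr ?addr0 //; case: (lt y x); rewrite ?add0r.
Qed.

Lemma unitriangular_diag x : B x x = 1.
Proof. by rewrite unitriangularE eqxx. Qed.

Lemma unitriangular_maximal A x y : maximal_in A x -> y \in A -> y != x -> B y x = 0.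
Proof. by move=> xmax yA yx; rewrite unitriangularE eq_sym (negPf yx) xmax. Qed.

Lemma unitriangular_supported A x : down_closed A -> x \in A -> supported A (B x).
Proof.
move=> dA xA y yA; rewrite unitriangularE.
have /negPf-> : y != x by apply: contraNneq yA => ->.
by case: ifP => // yx; rewrite (dA _ _ yx) in yA.
Qed.

Lemma unitriangular_span A : down_closed A ->
  forall m, supported A m -> exists c : {ffun X -> R}, m = \sum_x c x *: B x.
Proof.
move: A; apply: down_closed_ind => [m mA|A x dA xA xmax IH m mA].
  exists [ffun=> 0]; rewrite big1 => [|y _]; last by rewrite ffunE scale0r.
  by apply/ffunP => y; rewrite mA ?inE // ffunE.
case: (IH (m - m x *: B x)) => [|c mc].
  apply: supportedD1 => [y yA|]; rewrite ffun_subE ffun_scaleE.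
    by rewrite mA // (unitriangular_supported dA xA) // mulr0 subr0.
  by rewrite unitriangular_diag mulr1 subrr.
exists [ffun y => c y + (y == x)%:R * m x].
under eq_bigr => y _ do rewrite ffunE scalerDl.
rewrite big_split -mc (bigD1 x) //= eqxx mul1r big1 ?addr0 ?subrK // => y yx.
by rewrite (negPf yx) mul0r scale0r.
Qed.

Lemma unitriangular_free (c : {ffun X -> R}) : \sum_x c x *: B x = 0 -> c = [ffun=> 0].
Proof.
move=> cB; suff c0 A : down_closed A -> (forall x, x \notin A -> c x = 0) ->
    forall x, c x = 0.
  by apply/ffunP => x; rewrite ffunE; apply: (c0 setT) => // y; rewrite inE.
move: A; apply: down_closed_ind => [cA x|A x dA xA xmax IH cA].
  by rewrite cA ?inE.
apply: IH => y; rewrite !inE negb_and negbK => /predU1P [->|/cA //].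
have := congr1 (fun m : V => m x) cB; rewrite sum_ffunE ffunE (bigD1 x) //=.
rewrite ffun_scaleE unitriangular_diag mulr1 big1 ?addr0 // => z zx.
rewrite ffun_scaleE; have [zA|/cA ->] := boolP (z \in A); last by rewrite mul0r.
by rewrite (unitriangular_maximal xmax) ?mulr0.
Qed.

Lemma unitriangular_basis m : exists! c : {ffun X -> R}, m = \sum_x c x *: B x.
Proof.
case: (@unitriangular_span setT _ m) => [//|x|c mc]; first by rewrite inE.
exists c; split=> // c' mc'; apply/ffunP => x; apply/eqP.
have := @unitriangular_free [ffun x => c x - c' x]; rewrite -subr_eq0.
move/(_ _)/ffunP/(_ x); rewrite !ffunE => -> //.
under eq_bigr => y _ do rewrite ffunE scalerBl.
by rewrite sumrB -mc -mc' subrr.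
Qed.

End Unitriangular.

Variable psi : {linear V -> V | bar \; *:%R}.
Hypothesis psiK : involutive psi.
Hypothesis psi_tri : unitriangular (fun x => psi (delta x)).

Lemma psi_supported A m : down_closed A -> supported A m -> supported A (psi m).
Proof.
move=> dA mA y yA; rewrite semilinear_expand sum_ffunE big1 // => x _.
rewrite ffun_scaleE; have [xA|/mA->] := boolP (x \in A).
  by rewrite (unitriangular_supported psi_tri dA xA) ?mulr0.
by rewrite rmorph0 mul0r.
Qed.

Lemma psi_maximal A x m : maximal_in A x -> supported A m -> psi m x = bar (m x).
Proof.
move=> xmax mA; rewrite semilinear_expand sum_ffunE (bigD1 x) //=.
rewrite ffun_scaleE (unitriangular_diag psi_tri) mulr1 big1 ?addr0 // => y yx.
rewrite ffun_scaleE; have [yA|/mA->] := boolP (y \in A).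
  by rewrite (unitriangular_maximal psi_tri xmax) ?mulr0.
by rewrite rmorph0 mul0r.
Qed.

Lemma antisymmetric_split A : down_closed A -> forall m, supported A m ->
  psi m = - m ->
  exists g, [/\ supported A g, forall x, neg (g x) & m = g - psi g].
Proof.
move: A; apply: down_closed_ind => [m mA _|A x dA xA xmax IH m mA psi_m].
  exists 0; rewrite linear0 subr0; split=> [y|y|]; rewrite ?ffunE //.
  by apply/ffunP => y; rewrite mA ?inE // ffunE.
have /neg_bar_split [a neg_a mx] : bar (m x) = - m x.
  by rewrite -(psi_maximal xmax mA) psi_m ffunE.
pose e : V := a *: delta x; have eA : supported A e by apply/supportedZ/supported_delta.
have ex : e x = a by rewrite ffun_scaleE deltaE eqxx mulr1.
case: (IH (m - (e - psi e))) => [||g [gA neg_g me]].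
- apply: supportedD1 => [y yA|]; rewrite !ffun_subE.
    by rewrite mA // eA // (psi_supported dA eA) // !subr0.
  by rewrite (psi_maximal xmax eA) ex mx subrr.
- by rewrite !(linearB psi) psi_m psiK !opprB addrC.
exists (g + e); split=> [y yA|y|].
- by rewrite ffunE eA // gA ?addr0 // !inE (negPf yA) andbF.
- rewrite ffunE; apply: negD => //; rewrite ffun_scaleE deltaE.
  by case: (y == x); rewrite ?mulr1 ?mulr0.
by rewrite linearD opprD addrACA -me subrK.
Qed.

Definition canonical B : Prop := forall x,
  psi (B x) = B x /\ exists c : X -> R, (forall y, neg (c y)) /\
    B x = delta x + \sum_(y | lt y x) c y *: delta y.

Lemma canonical_unitriangular B : canonical B -> unitriangular B.
Proof. by move=> cB x; case: (cB x) => _ [c [_ e]]; exists c. Qed.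

Lemma canonical_element x : exists b : V,
  psi b = b /\ exists c : X -> R, (forall y, neg (c y)) /\
    b = delta x + \sum_(y | lt y x) c y *: delta y.
Proof.
pose m := psi (delta x) - delta x; have psi_m : psi m = - m by rewrite linearB psiK opprB.
have mA : supported [set y | lt y x] m.
  move=> y; rewrite inE => /negPf yx; rewrite !ffunE (unitriangularE psi_tri) yx.
  by rewrite deltaE; case: eqP; rewrite /= ?subrr ?subr0.
have [g [gA neg_g mg]] := antisymmetric_split (@down_closed_lt x) mA psi_m.
exists (delta x + g); split.
  by rewrite linearD -{1}[psi _](subrK (delta x)) -/m mg addrC addrA subrKC addrC.
exists g; split=> //; congr (_ + _); apply/ffunP => y; rewrite sum_deltaE.
by case: ifP => // yx; rewrite gA // inE yx.
Qed.

Lemma canonical_exists : exists B, canonical B.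
Proof.
pose b x := constructive_indefinite_description _ (canonical_element x).
by exists (fun x => proj1_sig (b x)) => x; apply: (proj2_sig (b x)).
Qed.

Lemma canonical_unique B B' : canonical B -> canonical B' -> B =1 B'.
Proof.
move=> cB cB' x; have [pB [c [neg_c Bx]]] := cB x; have [pB' [c' [neg_c' B'x]]] := cB' x.
pose d := B x - B' x; have psi_d : psi d = d by rewrite linearB pB pB'.
have neg_d y : neg (d y).
  rewrite /d Bx B'x opprD addrACA subrr add0r !ffunE !sum_deltaE.
  by case: ifP => _; [apply: negD; last apply: negN | rewrite subr0].
suff d0 A : down_closed A -> supported A d -> d = 0.
  by apply/eqP; rewrite -subr_eq0 -/d (d0 setT) //; apply: supportedT.
move: A; apply: down_closed_ind => [dA|A y dA yA ymax IH d_supp].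
  by apply/ffunP => y; rewrite dA ?inE // ffunE.
apply: IH; apply: supportedD1 => //; apply: neg_bar_fixed => //.
by rewrite -(psi_maximal ymax d_supp) psi_d.
Qed.

End CanonicalBasis.

(** * Laurent polynomials *)

Section Laurent.
Local Open Scope ring_scope.
Implicit Types (f g : laurent) (p q : {poly int}) (y : laurent).

HB.instance Definition _ := GRing.RMorphism.copy lval (\val : laurent -> Fx).

Lemma lval_inj : injective lval. Proof. exact: val_inj. Qed.

Lemma xL_mulV : xL * xLinv = 1.
Proof. by apply: lval_inj; rewrite rmorphM rmorph1 /= divff // xF_neq0. Qed.

Lemma xL_exprV k : xL ^+ k * xLinv ^+ k = 1.
Proof. by rewrite -exprMn xL_mulV expr1n. Qed.

Lemma xL_expB i k : (i <= k)%N -> xL ^+ k * xLinv ^+ i = xL ^+ (k - i).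
Proof. by move=> ik; rewrite -{1}(subnK ik) exprD -mulrA xL_exprV mulr1. Qed.

Lemma xLinv_expB i k : (i <= k)%N -> xL ^+ i * xLinv ^+ k = xLinv ^+ (k - i).
Proof. by move=> ik; rewrite -{1}(subnKC ik) exprD mulrA xL_exprV mul1r. Qed.

Lemma mul_xL_inj k : injective (fun f => f * xL ^+ k).
Proof.
by apply: (can_inj (g := fun f => f * xLinv ^+ k)) => f; rewrite -mulrA xL_exprV mulr1.
Qed.

Lemma mul_xLinv_inj k : injective (fun f => f * xLinv ^+ k).
Proof.
apply: (can_inj (g := fun f => f * xL ^+ k)) => f.
by rewrite -mulrA [xLinv ^+ k * _]mulrC xL_exprV mulr1.
Qed.

Definition int_horner y : {poly int} -> laurent := horner_eval y \o map_poly intr.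
HB.instance Definition _ y := GRing.RMorphism.copy (int_horner y)
  (horner_eval y \o map_poly (intr : int -> laurent)).

Lemma int_hornerX y : int_horner y 'X = y.
Proof. by rewrite /int_horner /= map_polyX /horner_eval hornerX. Qed.

Lemma int_hornerC y c : int_horner y c%:P = c%:~R.
Proof. by rewrite /int_horner /= map_polyC /horner_eval hornerC. Qed.

Lemma int_hornerXn y k : int_horner y 'X^k = y ^+ k.
Proof. by rewrite rmorphXn /= int_hornerX. Qed.

Lemma int_horner_monomial y c k : int_horner y (c *: 'X^k) = c%:~R * y ^+ k.
Proof. by rewrite -mul_polyC rmorphM /= int_hornerC int_hornerXn. Qed.

Lemma int_hornerE y p : int_horner y p = \sum_(i < size p) (p`_i)%:~R * y ^+ i.
Proof.
rewrite -{1}[p]coefK poly_def rmorph_sum; apply: eq_bigr => i _.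
exact: int_horner_monomial.
Qed.

Lemma lval_int_horner_xL p : lval (int_horner xL p) = tofr p.
Proof.
rewrite int_hornerE rmorph_sum -[in RHS](coefK p) poly_def rmorph_sum.
apply: eq_bigr => i _; rewrite rmorphM rmorph_int rmorphXn /=.
by rewrite -mul_polyC -[p`_i in RHS]intz !rmorph_int rmorphM rmorph_int rmorphXn.
Qed.

Lemma lval_int_horner_xLinv p :
  lval (int_horner xLinv p) = \sum_(i < size p) (p`_i)%:~R / xF ^+ i.
Proof.
rewrite int_hornerE rmorph_sum; apply: eq_bigr => i _.
by rewrite rmorphM rmorph_int rmorphXn exprVn.
Qed.

Lemma int_horner_xL_inj : injective (int_horner xL).
Proof.
move=> p q /(congr1 lval); rewrite !lval_int_horner_xL => /eqP.
by rewrite tofrac_eq => /eqP.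
Qed.

Lemma laurentP f : exists p k, f * xL ^+ k = int_horner xL p.
Proof.
case/is_laurentP: (lvalP f) => p [k fE]; exists p, k; apply: lval_inj.
by rewrite rmorphM rmorphXn lval_int_horner_xL /= fE divfK ?expf_neq0 ?xF_neq0.
Qed.

Lemma lbarP f k p : f * xL ^+ k = int_horner xL p ->
  lbar f * xLinv ^+ k = int_horner xLinv p.
Proof.
move=> fE; have kE : xLinv ^+ k * xL ^+ k = 1 by rewrite mulrC xL_exprV.
have [|q [l [vf vbar]]] := epsilon_spec (inhabits 0) (lbar_rel f).
  exists (int_horner xLinv p * xL ^+ k), p, k; split; last first.
    by rewrite rmorphM rmorphXn /= lval_int_horner_xLinv.
  apply: (canRL (mulfK _)); first by rewrite expf_neq0 ?xF_neq0.
  by rewrite -lval_int_horner_xL -fE rmorphM rmorphXn.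
have fqE : f * xL ^+ l = int_horner xL q.
  apply: lval_inj; rewrite rmorphM rmorphXn lval_int_horner_xL /= vf.
  by rewrite divfK ?expf_neq0 ?xF_neq0.
have barE : lbar f = int_horner xLinv q * xL ^+ l.
  by apply: lval_inj; rewrite rmorphM rmorphXn /= lval_int_horner_xLinv -vbar.
have pq : p * 'X^l = q * 'X^k.
  by apply: int_horner_xL_inj; rewrite !rmorphM /= !int_hornerXn -fE -fqE mulrAC.
apply: (@mul_xLinv_inj l); rewrite barE -[LHS]mulrA [xLinv ^+ k * _]mulrC.
rewrite mulrA -(mulrA _ (xL ^+ l)) xL_exprV mulr1.
by have := congr1 (int_horner xLinv) pq; rewrite !rmorphM /= !int_hornerXn.
Qed.

Lemma lbar_int_horner p : lbar (int_horner xL p) = int_horner xLinv p.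
Proof. by have := @lbarP (int_horner xL p) 0 p; rewrite !expr0 !mulr1; apply. Qed.

Fact lbar_is_zmod_morphism : zmod_morphism lbar.
Proof.
move=> f g; have [p [k fE]] := laurentP f; have [q [l gE]] := laurentP g.
have /lbarP : (f - g) * xL ^+ (k + l) = int_horner xL (p * 'X^l - q * 'X^k).
  by rewrite rmorphB !rmorphM /= !int_hornerXn -fE -gE exprD; ring.
rewrite rmorphB !rmorphM /= !int_hornerXn -(lbarP fE) -(lbarP gE) => bar_fg.
by apply: (@mul_xLinv_inj (k + l)); rewrite bar_fg exprD; ring.
Qed.

Fact lbar_is_monoid_morphism : monoid_morphism lbar.
Proof.
split=> [|f g].
  by rewrite -[1 in LHS](rmorph1 (int_horner xL)) lbar_int_horner rmorph1.
have [p [k fE]] := laurentP f; have [q [l gE]] := laurentP g.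
have /lbarP : (f * g) * xL ^+ (k + l) = int_horner xL (p * q).
  by rewrite rmorphM /= -fE -gE exprD; ring.
rewrite rmorphM /= -(lbarP fE) -(lbarP gE) => bar_fg.
by apply: (@mul_xLinv_inj (k + l)); rewrite bar_fg exprD; ring.
Qed.

HB.instance Definition _ :=
  GRing.isZmodMorphism.Build laurent laurent lbar lbar_is_zmod_morphism.
HB.instance Definition _ :=
  GRing.isMonoidMorphism.Build laurent laurent lbar lbar_is_monoid_morphism.

Lemma lbar_x : lbar xL = xLinv.
Proof. by rewrite -(int_hornerX xL) lbar_int_horner int_hornerX. Qed.

Lemma lbar_xinv : lbar xLinv = xL.
Proof.
have := @lbarP xLinv 1 1; rewrite !expr1 !rmorph1 => /(_ _) barV.
by rewrite -[LHS]mulr1 -xL_mulV mulrCA barV ?mulr1 // mulrC xL_mulV.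
Qed.

Lemma lbar_int_hornerV p : lbar (int_horner xLinv p) = int_horner xL p.
Proof.
rewrite !int_hornerE rmorph_sum; apply: eq_bigr => i _.
by rewrite rmorphM rmorph_int rmorphXn /= lbar_xinv.
Qed.

Lemma lbarK : involutive lbar.
Proof.
move=> f; have [p [k fE]] := laurentP f; apply: (@mul_xL_inj k).
rewrite fE -lbar_int_hornerV -(lbarP fE) rmorphM rmorphXn /=.
by rewrite lbar_xinv.
Qed.

Lemma in_negpartP f : in_negpart f <-> exists p, f = xLinv * int_horner xLinv p.
Proof.
have lvalE p : lval (xLinv * int_horner xLinv p) =
    \sum_(i < size p) (p`_i)%:~R / xF ^+ i.+1.
  rewrite rmorphM /= lval_int_horner_xLinv mulr_sumr; apply: eq_bigr => i _ /=.
  by rewrite mulrCA exprS invfM.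
by split=> [[p e]|[p ->]]; exists p; rewrite ?lvalE //; apply: lval_inj; rewrite lvalE.
Qed.

Lemma in_negpart0 : in_negpart 0.
Proof. by apply/in_negpartP; exists 0; rewrite rmorph0 mulr0. Qed.

Lemma in_negpartD f g : in_negpart f -> in_negpart g -> in_negpart (f + g).
Proof.
move=> /in_negpartP [p ->] /in_negpartP [q ->]; apply/in_negpartP.
by exists (p + q); rewrite rmorphD mulrDr.
Qed.

Lemma in_negpartN f : in_negpart f -> in_negpart (- f).
Proof.
move=> /in_negpartP [p ->]; apply/in_negpartP; exists (- p).
by rewrite rmorphN mulrN.
Qed.

Lemma in_negpart_int_horner p : in_negpart (int_horner xL p) -> p = 0.
Proof.
move=> /in_negpartP [q pE]; set d := size q.
pose r := \poly_(i < d) q`_(d - i.+1).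
have rE : p * 'X^d = r.
  apply: int_horner_xL_inj; rewrite rmorphM /= int_hornerXn pE int_hornerE.
  rewrite /r poly_def rmorph_sum mulr_sumr mulr_suml (reindex_inj rev_ord_inj) /=.
  apply: eq_bigr => i _; rewrite int_horner_monomial.
  have lt_id := ltn_ord i; rewrite -/d mulrCA -mulrA -exprS subnSK //.
  by congr (_ * _); rewrite mulrC xL_expB ?leq_subr // subKn // ltnW.
have r0 : r = 0.
  apply/polyP => i; rewrite coef0; have [lt_id|le_di] := ltnP i d.
    by rewrite -rE coefMXn lt_id.
  by rewrite nth_default // (leq_trans (size_poly _ _)).
by apply/eqP; rewrite -(mulIr_eq0 _ (monic_rreg (monicXn _ d))) rE r0.
Qed.

Lemma laurent_decomp f :
  exists a c b, [/\ in_negpart a, in_negpart b & f = a + c%:~R + lbar b].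
Proof.
have [p [k fE]] := laurentP f.
pose q := drop_poly k p; pose b := xLinv * int_horner xLinv (drop_poly 1 q).
exists (int_horner xL (take_poly k p) * xLinv ^+ k), q`_0, b; split.
- rewrite int_hornerE mulr_suml.
  apply: (big_ind in_negpart in_negpart0 in_negpartD) => i _.
  have lt_ik : (i < k)%N by apply: leq_trans (ltn_ord i) _; apply: size_take_poly.
  apply/in_negpartP; exists ((take_poly k p)`_i *: 'X^(k - i.+1)).
  rewrite int_horner_monomial mulrCA -exprS subnSK // -mulrA.
  by rewrite xLinv_expB // ltnW.
- by apply/in_negpartP; exists (drop_poly 1 q).
have qE : q = (q`_0)%:P + 'X * drop_poly 1 q.
  rewrite -{1}(poly_take_drop 1 q) mulrC expr1; congr (_ + _).
  by apply/polyP => i; rewrite coef_take_poly coefC; case: i.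
have -> : f = int_horner xL (take_poly k p) * xLinv ^+ k + int_horner xL q.
  apply: (@mul_xL_inj k); rewrite fE -{1}(poly_take_drop k p) rmorphD rmorphM /=.
  by rewrite int_hornerXn mulrDl -mulrA [xLinv ^+ k * _]mulrC xL_exprV mulr1.
rewrite -addrA {1}qE rmorphD rmorphM /= int_hornerC int_hornerX.
by rewrite /b rmorphM /= lbar_int_hornerV lbar_xinv.
Qed.

Lemma laurent_decomp0 a c b : in_negpart a -> in_negpart b ->
  a + c%:~R + lbar b = 0 -> [/\ a = 0, c = 0 & b = 0].
Proof.
move=> neg_a /in_negpartP [p bE] e.
have aE : a = int_horner xL (- (c%:P + 'X * p)).
  rewrite rmorphN rmorphD rmorphM /= int_hornerC int_hornerX.
  apply/eqP; rewrite -addr_eq0 addrA -[X in _ == X]e bE rmorphM /=.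
  by rewrite lbar_xinv lbar_int_hornerV.
have /eqP := in_negpart_int_horner (eq_ind _ in_negpart neg_a _ aE).
rewrite oppr_eq0 => /eqP cp0; have c0 : c = 0.
  by have := congr1 (fun q : {poly int} => q`_0) cp0;
    rewrite coefD coefC coefXM coef0 /= addr0.
rewrite c0 polyC0 add0r in cp0; have p0 : p = 0.
  by apply/eqP; move/eqP: cp0; rewrite mulf_eq0 polyX_eq0.
by split=> //; rewrite ?aE ?bE p0 ?c0 ?polyC0 ?mulr0 ?addr0 ?oppr0 ?rmorph0 ?mulr0.
Qed.

Lemma in_negpart_bar_fixed f : in_negpart f -> lbar f = f -> f = 0.
Proof.
move=> neg_f bar_f; have := @laurent_decomp0 f 0 (- f) neg_f (in_negpartN neg_f).
by rewrite rmorphN /= bar_f addr0 subrr => /(_ erefl) [].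
Qed.

Lemma in_negpart_bar_split f : lbar f = - f ->
  exists2 g, in_negpart g & f = g - lbar g.
Proof.
have [a [c [b [neg_a neg_b ->]]]] := laurent_decomp f.
rewrite !rmorphD /= lbarK rmorph_int => bar_f; exists a => //.
have [|||/eqP ab c0 _] := @laurent_decomp0 (a + b) (c + c) (a + b).
- exact: in_negpartD.
- exact: in_negpartD.
- transitivity (lbar a + c%:~R + b + (a + c%:~R + lbar b)).
    by rewrite intrD rmorphD /=; ring.
  by rewrite bar_f addNr.
have -> : c = 0 by lia.
by move: ab; rewrite addr_eq0 => /eqP ->; rewrite addr0 rmorphN opprK.
Qed.

End Laurent.

(** * Words and length *)

Section Words.
Variable gT : finGroupType.
Implicit Types (J : {set gT}) (w s : gT) (ws : seq gT).
Local Open Scope group_scope.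

Lemma gen_indl J (P : gT -> Prop) :
  P 1 -> (forall s w, s \in J -> w \in <<J>> -> P w -> P (s * w)) ->
  forall w, w \in <<J>> -> P w.
Proof.
move=> P1 PM w /gen_prodgP [k [c cJ ->]].
suff: \prod_i c i \in <<J>> /\ P (\prod_i c i) by case.
elim: k c cJ => [|k IH] c cJ; first by rewrite big_ord0; split.
rewrite big_ord_recl; case: (IH (fun i => c (lift ord0 i))) => // wJ Pw.
by split; [rewrite groupM // mem_gen | apply: PM].
Qed.

Lemma gen_indr J (P : gT -> Prop) :
  P 1 -> (forall s w, s \in J -> w \in <<J>> -> P w -> P (w * s)) ->
  forall w, w \in <<J>> -> P w.
Proof.
move=> P1 PM w /gen_prodgP [k [c cJ ->]].
suff: \prod_i c i \in <<J>> /\ P (\prod_i c i) by case.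
elim: k c cJ => [|k IH] c cJ; first by rewrite big_ord0; split.
rewrite big_ord_recr; case: (IH (fun i => c (widen_ord (leqnSn k) i))) => // wJ Pw.
by split; [rewrite groupM // mem_gen | apply: PM].
Qed.

Definition wprod ws : gT := \prod_(s <- ws) s.

Lemma wprod_cons s ws : wprod (s :: ws) = s * wprod ws.
Proof. exact: big_cons. Qed.

Lemma wprod_rcons s ws : wprod (rcons ws s) = wprod ws * s.
Proof. by rewrite /wprod -cats1 big_cat big_seq1. Qed.

Lemma wordsetP J k w :
  reflect (exists ws, [/\ all (mem J) ws, size ws <= k & wprod ws = w])
          (w \in wordset J k).
Proof.
apply: (iffP idP) => [|[ws [wsJ szk <-]]].
  elim: k w => [|k IH] w /=.
    by rewrite inE => /eqP->; exists [::]; rewrite /wprod big_nil.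
  rewrite inE => /orP [/IH [ws [wsJ szk <-]]|].
    by exists ws; split=> //; apply: leqW.
  case/imset2P=> u s /IH [ws [wsJ szk <-]] sJ ->.
  by exists (rcons ws s); rewrite all_rcons size_rcons wprod_rcons /= sJ.
elim: k ws wsJ szk => [|k IH] ws wsJ.
  by rewrite leqn0 => /nilP->; rewrite /wprod big_nil /= inE.
case/lastP: ws wsJ => [|ws s]; first by rewrite /= inE (IH [::]).
rewrite all_rcons size_rcons ltnS wprod_rcons /= inE => /andP [sJ wsJ] szk.
by apply/orP; right; apply: imset2_f => //; apply: IH.
Qed.

Lemma wordset_grows_or_gen J k :
  k < #|wordset J k| \/ {subset <<J>> <= wordset J k}.
Proof.
elim: k => [|k [kJ|kJ]]; first by left; rewrite cards1.
  have [stable|grows] := eqVneq (wordset J k.+1) (wordset J k).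
    right=> w; move: w; apply: gen_indr => [|s w sJ _].
      by apply/wordsetP; exists [::]; rewrite /wprod big_nil.
    rewrite {1}stable => wk.
    by rewrite inE; apply/orP; right; apply: imset2_f.
  left; apply: leq_ltn_trans kJ _; apply: proper_card.
  by rewrite properEneq eq_sym grows subsetUl.
by right=> w /kJ wk; rewrite /= inE wk.
Qed.

Lemma mem_wordset_len J w : w \in <<J>> -> w \in wordset J (len J w).
Proof.
move=> wJ; have g0 : 0 < #|gT| by apply/card_gt0P; exists 1.
have: has (fun k => w \in wordset J k) (iota 0 #|gT|).
  apply/hasP; exists #|gT|.-1; first by rewrite mem_iota add0n prednK // leqnn.
  case: (wordset_grows_or_gen J #|gT|.-1) => [|/(_ _ wJ) //].
  rewrite prednK // => full.
  by have/eqP->: wordset J #|gT|.-1 == setT by rewrite eqEcard subsetT cardsT.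
by move=> hw; have := nth_find 0 hw; rewrite nth_iota // -[ltnRHS](size_iota 0) -has_find.
Qed.

Lemma len_leq J k w : w \in wordset J k -> len J w <= k.
Proof.
move=> wk; rewrite leqNgt; apply/negP => lt_k.
have k_small : k < #|gT|.
  apply: leq_trans lt_k _; rewrite -[leqRHS](size_iota 0).
  exact: find_size.
by have := before_find 0 lt_k; rewrite nth_iota // add0n wk.
Qed.

Lemma reduced_word J w : w \in <<J>> ->
  exists ws, [/\ all (mem J) ws, size ws = len J w & wprod ws = w].
Proof.
move=> wJ; case/wordsetP: (mem_wordset_len wJ) => ws [wsJ szw ws_w].
exists ws; split=> //; apply/eqP; rewrite eqn_leq szw /=.
by apply: len_leq; apply/wordsetP; exists ws.
Qed.

Lemma len_wprod J ws : all (mem J) ws -> len J (wprod ws) <= size ws.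
Proof. by move=> wsJ; apply: len_leq; apply/wordsetP; exists ws. Qed.

Lemma len1 J : len J 1 = 0.
Proof. by apply/eqP; rewrite -leqn0; apply: len_leq; rewrite /= inE. Qed.

Lemma len_eq0 J w : w \in <<J>> -> len J w = 0 -> w = 1.
Proof. by move=> /mem_wordset_len + w0; rewrite w0 /= inE => /eqP. Qed.

Lemma len_mull J s w : s \in J -> w \in <<J>> -> len J (s * w) <= (len J w).+1.
Proof.
move=> sJ /reduced_word [ws [wsJ <- <-]].
by rewrite -wprod_cons; apply: (@len_wprod J (s :: ws)); rewrite /= sJ.
Qed.

Lemma TJP J r :
  reflect (exists w s, [/\ w \in <<J>>, s \in J & r = s ^ w]) (r \in TJ J).
Proof.
apply: (iffP imset2P) => [[w s wJ sJ ->]|[w [s [wJ sJ ->]]]].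
  by exists w^-1, s; rewrite groupV conjgE invgK mulgA.
by exists w^-1 s; rewrite ?groupV // conjgE invgK mulgA.
Qed.

Lemma TJ_gen J s : s \in J -> s \in TJ J.
Proof. by move=> sJ; apply/TJP; exists 1, s; rewrite group1 conjg1. Qed.

Lemma TJ_conj J r w : w \in <<J>> -> (r ^ w \in TJ J) = (r \in TJ J).
Proof.
move=> wJ; apply/TJP/TJP => [[u [s [uJ sJ e]]]|[u [s [uJ sJ ->]]]].
  by exists (u * w^-1), s; rewrite groupM ?groupV // conjgM -e conjgK.
by exists (u * w), s; rewrite groupM // conjgM.
Qed.

Lemma TJ_sub J : {subset TJ J <= <<J>>}.
Proof. by move=> r /TJP [w [s [wJ sJ ->]]]; rewrite groupJ // mem_gen. Qed.

Lemma TJ_mono (I J : {set gT}) : I \subset J -> {subset TJ I <= TJ J}.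
Proof.
move=> IJ r /TJP [w [s [wI sI ->]]]; apply/TJP; exists w, s.
by rewrite (subsetP (genS IJ)) ?(subsetP IJ).
Qed.

End Words.

Section AlternatingWords.
Variable gT : finGroupType.
Implicit Types (s t : gT).
Local Open Scope group_scope.

Definition altw s t k : gT := altop (mulg s) (mulg t) k 1.

Lemma altw0 s t : altw s t 0 = 1. Proof. by []. Qed.

Lemma altwS s t k : altw s t k.+1 = s * altw t s k. Proof. by []. Qed.

Lemma altwD s t i j :
  altw s t (i + j) = altw s t i * (if odd i then altw t s j else altw s t j).
Proof.
elim: i s t => [|i IH] s t; first by rewrite mul1g.
by rewrite addSn !altwS IH mulgA /= if_neg.
Qed.

Lemma altwSr s t k : altw s t k.+1 = altw s t k * (if odd k then t else s).
Proof. by rewrite -addn1 altwD !altwS !altw0 !mulg1. Qed.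

Lemma altw_double s t k : altw s t k.*2 = (s * t) ^+ k.
Proof. by elim: k => [//|k IH]; rewrite doubleS !altwS IH mulgA -expgS. Qed.

Lemma altw_inv s t k : s^-1 = s -> t^-1 = t ->
  (altw s t k)^-1 = if odd k then altw s t k else altw t s k.
Proof.
move=> sV tV; elim: k s t sV tV => [|k IH] s t sV tV; first by rewrite invg1.
rewrite altwS invMg IH // sV /= !if_neg.
by case Ek: (odd k); rewrite -?altwS altwSr Ek.
Qed.

Lemma altw_swap s t k : s^-1 = s -> t^-1 = t ->
  altw s t k = altw t s k <-> (s * t) ^+ k = 1.
Proof.
move=> sV tV; rewrite -altw_double -addnn altwD; have stV := altw_inv k sV tV.
split=> [e|/eqP]; last by rewrite -eq_invg_mul stV; case: (odd k) => /eqP.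
move: stV; case: (odd k) => stV; first by rewrite -e -{1}stV mulVg.
by rewrite {2}e -stV mulgV.
Qed.

Lemma altw_conj s t k : odd k -> s^-1 = s -> t^-1 = t ->
  altw s t k = altw t s k -> s ^ altw s t k = t.
Proof.
case: k => // k /= Ek sV tV e; rewrite conjgE altw_inv // /= Ek.
have ss : s * s = 1 by rewrite -{1}sV mulVg.
have := altw_inv k tV sV; rewrite (negPf Ek) => tsV.
by rewrite {1}e !altwS (mulgA s) ss mul1g -tsV mulgKV.
Qed.

Lemma mem_altw (I : {set gT}) s t k : s \in I -> t \in I -> altw s t k \in <<I>>.
Proof.
elim: k s t => [|k IH] s t sI tI; first exact: group1.
by rewrite altwS groupM ?IH // mem_gen.
Qed.

End AlternatingWords.

(** * The inversion cocycle *)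

Section CoxeterSystem.
Variables (gT : finGroupType) (S : {set gT}).
Hypothesis cox : coxeter_system S.
Implicit Types (I J : {set gT}) (b g r s t u v w : gT).
Local Notation ell := (len S).

Section Cocycle.
Local Open Scope group_scope.

Definition inversion_cocycle (n : gT -> gT -> bool) : Prop :=
  (forall u v r, n (u * v) r = n u r (+) n v (r ^ u)) /\
  {in S, forall s r, n s r = (r == s)}.

Lemma mem_genS w : w \in <<S>>.
Proof. by case: cox => -> _ _; rewrite inE. Qed.

Lemma simple_mulgg s : s \in S -> s * s = 1.
Proof. by case: cox => _ o2 _ /o2 os; rewrite -(expg_order s) os expgS. Qed.

Lemma simple_invg s : s \in S -> s^-1 = s.
Proof. by move=> sS; apply/eqP; rewrite eq_invg_mul simple_mulgg. Qed.

Lemma simple_mulKg s w : s \in S -> s * (s * w) = w.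
Proof. by move=> sS; rewrite mulgA simple_mulgg // mul1g. Qed.

Lemma simple_mulgK s w : s \in S -> w * s * s = w.
Proof. by move=> sS; rewrite -mulgA simple_mulgg // mulg1. Qed.

Lemma T_TJ : T S = TJ S.
Proof. by rewrite /T /TJ /WJ; case: cox => ->. Qed.

Lemma T_gen s : s \in S -> s \in T S.
Proof. by rewrite T_TJ; apply: TJ_gen. Qed.

Lemma T_mulgg r : r \in T S -> r * r = 1.
Proof.
by rewrite T_TJ => /TJP [w [s [_ sS ->]]]; rewrite -conjMg simple_mulgg // conj1g.
Qed.

Lemma T_invg r : r \in T S -> r^-1 = r.
Proof. by move=> /T_mulgg rr; apply/eqP; rewrite eq_invg_mul rr. Qed.

Lemma T_conj r w : (r ^ w \in T S) = (r \in T S).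
Proof. by rewrite T_TJ TJ_conj ?mem_genS. Qed.

Definition flip (s : gT) (x : gT * bool) : gT * bool :=
  (x.1 ^ s, x.2 (+) (x.1 == s)).

Lemma flip_inj s : injective (flip s).
Proof. by move=> [r e] [r' e'] [/conjg_inj <- /addIb ->]. Qed.

Lemma simple_mul_expV s t j : s \in S -> t \in S ->
  s * (s * t) ^- j = (s * t) ^+ j * s.
Proof.
move=> sS tS; elim: j => [|j IH]; first by rewrite expg0 invg1 mulg1 mul1g.
rewrite {1}expgSr expgS !invMg (simple_invg sS) (simple_invg tS) !mulgA.
by rewrite -(mulgA (s * t) s) IH !mulgA.
Qed.

Lemma flip_powers s t k r e : s \in S -> t \in S ->
  ((perm (@flip_inj s) * perm (@flip_inj t)) ^+ k) (r, e) =
  (r ^ ((s * t) ^+ k),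
   e (+) \big[addb/false]_(0 <= j < k.*2) (r == (s * t) ^+ j * s)).
Proof.
move=> sS tS; set p := s * t.
elim: k => [|k IH]; first by rewrite !expg0 perm1 conjg1 big_geq // addbF.
rewrite expgSr permM IH permM !permE /flip /=; congr (_, _).
  by rewrite -!conjgM -expgSr.
rewrite doubleS big_nat_recr // big_nat_recr //= -!addbA.
congr (_ (+) (_ (+) (_ (+) _))).
  rewrite -(inj_eq (conjg_inj (p ^- k))) -conjgM mulgV conjg1 conjgE invgK.
  by rewrite simple_mul_expV // mulgA -expgD addnn.
rewrite -(inj_eq (conjg_inj (s * p ^- k))) -!conjgM.
rewrite !mulgA (simple_mulgK _ sS) mulgV conjg1 conjgE invMg invgK (simple_invg sS).
have -> : p ^+ k * s * (t * (s * p ^- k)) = p ^+ k.+1 * (s * p ^- k).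
  by rewrite expgSr /p !mulgA.
by rewrite simple_mul_expV // mulgA -expgD addSn addnn.
Qed.

Lemma coxeter_cocycle : exists n, inversion_cocycle n.
Proof.
case: cox => _ _ /(_ _ (fun s => perm (@flip_inj s))) [].
  move=> s t sS tS; apply/permP => [[r e]].
  rewrite perm1 flip_powers // expg_order conjg1 -addnn.
  rewrite (big_cat_nat (leq0n #[s * t]%g) (leq_addr _ _)) /=.
  rewrite -{2}[#[s * t]%g]add0n big_addn addnK.
  under [X in _ (+) (_ (+) X)]eq_bigr => j _ do rewrite expgD expg_order mulg1.
  by rewrite addbb addbF.
move=> phi phiS; exists (fun w r => (phi w (r, false)).2).
have phiM u v : phi (u * v) = phi u * phi v by rewrite morphM ?inE.
have phi_gen s r e : s \in S -> phi s (r, e) = (r ^ s, e (+) (r == s)).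
  by move=> sS; rewrite phiS // permE.
have phiE w : forall r e, phi w (r, e) = (r ^ w, e (+) (phi w (r, false)).2).
  move: w (mem_genS w); apply: gen_indl => [r e|s w sS _ IH r e].
    by rewrite morph1 !perm1 conjg1 addbF.
  rewrite phiM !permM !(phi_gen s _ _ sS) (IH _ (e (+) _)) /=.
  by rewrite conjgM (IH _ (r == s)) /= addbA.
split=> [u v r|s sS r]; last by rewrite phi_gen.
by rewrite phiM permM [X in phi v X]phiE phiE.
Qed.

Section CocycleFacts.
Variable n : gT -> gT -> bool.
Hypothesis nP : inversion_cocycle n.

Lemma cocycle1 r : n 1 r = false.
Proof. by case: nP => nM _; rewrite -(mulg1 1) nM conjg1 addbb. Qed.

Lemma cocycleV w r : n w^-1 r = n w (r ^ w^-1).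
Proof.
case: nP => nM _; have := nM w^-1 w r.
by rewrite mulVg cocycle1; case: (n _ _); case: (n _ _).
Qed.

Lemma cocycle_exchange ws r : all (mem S) ws -> n (wprod ws) r ->
  exists ws', [/\ {subset ws' <= ws}, size ws' < size ws
                & wprod ws' = r * wprod ws].
Proof.
have [nM n_gen] := nP.
elim: ws r => [|s ws IH] r /=; first by rewrite /wprod big_nil cocycle1.
case/andP=> sS wsS; rewrite wprod_cons nM n_gen //.
have [-> _|rs /=] := eqVneq r s.
  by exists ws; rewrite simple_mulKg //; split=> // x; rewrite inE orbC => ->.
case/(IH _ wsS) => ws' [sub_ws lt_ws e]; exists (s :: ws'); split=> // [x|].
  by rewrite !inE => /predU1P [->|/sub_ws ->]; rewrite ?eqxx ?orbT.
by rewrite wprod_cons e conjgE !mulgA mulgV mul1g.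
Qed.

Lemma cocycle_ltn w r : n w r -> ell (r * w) < ell w.
Proof.
case: (reduced_word (mem_genS w)) => ws [wsS <- <-].
case/(cocycle_exchange wsS) => ws' [sub_ws lt_ws <-].
apply: leq_ltn_trans lt_ws; apply: len_wprod.
by apply/allP => x /sub_ws; apply/allP.
Qed.

Lemma cocycle_refl r : r \in T S -> n r r.
Proof.
have [nM n_gen] := nP; rewrite T_TJ => /TJP [w [s [_ sS e]]].
rewrite {1}e conjgE !nM cocycleV e conjgK (n_gen _ sS) eqxx.
by rewrite conjgE mulKg addbCA addbb.
Qed.

Lemma cocycle_T w r : n w r -> r \in T S.
Proof.
have [nM n_gen] := nP; move: w (mem_genS w) r.
apply: gen_indl => [r|s w sS _ IH r]; first by rewrite cocycle1.
rewrite nM n_gen //; case: eqP => [-> _|_ /IH]; last by rewrite T_conj.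
by rewrite T_TJ TJ_gen.
Qed.

End CocycleFacts.
Definition inversion w r : bool := (r \in T S) && (ell (r * w) < ell w).

Lemma inversion_cocycleP : inversion_cocycle inversion.
Proof.
have [n nP] := coxeter_cocycle.
suff nE w r : inversion w r = n w r.
  by case: nP => nM n_gen; split=> [u v r|s sS r]; rewrite !nE; auto.
apply/andP/idP => [[rT lt_w]|nw]; last by rewrite (cocycle_T nP nw) (cocycle_ltn nP nw).
apply/negPn/negP => nw; have: n (r * w) r.
  by rewrite nP.1 (cocycle_refl nP) // conjgE mulKg (negPf nw).
move/(cocycle_ltn nP); rewrite mulgA T_mulgg // mul1g => /ltnW.
by rewrite leqNgt lt_w.
Qed.

End Cocycle.
Local Notation N := inversion.

(** * Inversions and length *)

Section Length.
Local Open Scope group_scope.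

Lemma inversionM u v r : N (u * v) r = N u r (+) N v (r ^ u).
Proof. by case: inversion_cocycleP. Qed.

Lemma inversion_gen s r : s \in S -> N s r = (r == s).
Proof. by case: inversion_cocycleP => _ gen /gen. Qed.

Lemma inversion1 r : N 1 r = false.
Proof. exact: cocycle1 inversion_cocycleP r. Qed.

Lemma inversionV w r : N w^-1 r = N w (r ^ w^-1).
Proof. exact: cocycleV inversion_cocycleP w r. Qed.

Lemma inversion_refl r : r \in T S -> N r r.
Proof. exact: cocycle_refl inversion_cocycleP r. Qed.

Lemma inversion_ltn w r : N w r -> ell (r * w) < ell w.
Proof. by case/andP. Qed.

Lemma inversionE w r : r \in T S -> N w r = (ell (r * w) < ell w).
Proof. by rewrite /inversion => ->. Qed.

Lemma inversion_desc w s : s \in S -> N w s = (ell (s * w) < ell w).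
Proof. by move=> sS; rewrite inversionE ?T_gen. Qed.

Lemma inversion_mull r w : r \in T S -> N (r * w) r = ~~ N w r.
Proof. by move=> rT; rewrite inversionM inversion_refl // conjgE mulKg. Qed.

Lemma inversion_mulsl s w : s \in S -> N (s * w) s = ~~ N w s.
Proof. by move=> sS; rewrite inversion_mull ?T_gen. Qed.

Lemma inversion_mulsr s w : s \in S -> N (w * s)^-1 s = ~~ N w^-1 s.
Proof. by move=> sS; rewrite invMg (simple_invg sS) inversion_mulsl. Qed.

Lemma inversion_up w r : r \in T S -> N w r = false -> ell w < ell (r * w).
Proof.
move=> rT nw; have /inversion_ltn : N (r * w) r by rewrite inversion_mull // nw.
by rewrite mulgA T_mulgg // mul1g.
Qed.

(* Distinct commuting reflections have orthogonal roots. *)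
Lemma inversion_commute r r' :
  r \in T S -> r' != r -> r' ^ r = r' -> N r r' = false.
Proof.
rewrite T_TJ // => /TJP [w [s [_ sS ->]]] r'_neq r'_fix.
set q := r' ^ w^-1; have q_fix : q ^ s = q.
  by apply: (@conjg_inj _ w); rewrite conjgKV -[RHS]r'_fix -!conjgM conjgE mulgA.
rewrite conjgE !inversionM inversionV -/q q_fix (inversion_gen _ sS).
have -> : (q == s) = false; last by rewrite addFb addbb.
by apply: contraNF r'_neq => /eqP <-; rewrite conjgKV.
Qed.

Lemma ell_mull s w : s \in S ->
  ell (s * w) = if N w s then (ell w).-1 else (ell w).+1.
Proof.
move=> sS; have lesw := len_mull sS (mem_genS w).
have := len_mull sS (mem_genS (s * w)); rewrite simple_mulKg // => lew.
case: ifP => [/inversion_ltn|/(inversion_up (T_gen sS))]; lia.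
Qed.

Lemma ell_gt0 w r : N w r -> 0 < ell w.
Proof. by move/inversion_ltn; lia. Qed.

Lemma ell_gen s : s \in S -> ell s = 1%N.
Proof. by move=> sS; rewrite -(mulg1 s) ell_mull // inversion1 len1. Qed.

Lemma ell_mull_neq s w : s \in S -> ell (s * w) != ell w.
Proof. by move=> sS; rewrite ell_mull //; case: ifP => [/ell_gt0|_]; lia. Qed.

Lemma ell_mul_le u v : ell (u * v) <= ell u + ell v.
Proof.
case: (reduced_word (mem_genS u)) => us [usS <- <-].
case: (reduced_word (mem_genS v)) => vs [vsS <- <-].
rewrite /wprod -big_cat -size_cat; apply: (@len_wprod _ S (us ++ vs)).
by rewrite all_cat usS.
Qed.

Lemma ell_inv w : ell w^-1 = ell w.
Proof.
suff le_inv u : ell u^-1 <= ell u.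
  by apply/eqP; rewrite eqn_leq le_inv -{1}(invgK w) le_inv.
case: (reduced_word (mem_genS u)) => ws [wsS <- <-].
suff -> : (wprod ws)^-1 = wprod (rev ws).
  by rewrite -(size_rev ws); apply: len_wprod; rewrite all_rev.
elim: ws wsS => [|s ws IH] /=; first by rewrite /wprod !big_nil invg1.
case/andP=> sS wsS; rewrite wprod_cons invMg IH // rev_cons wprod_rcons.
by rewrite simple_invg.
Qed.

Lemma ell_mulr w s : s \in S ->
  ell (w * s) = if N w^-1 s then (ell w).-1 else (ell w).+1.
Proof.
by move=> sS; rewrite -[LHS]ell_inv invMg (simple_invg sS) ell_mull // ell_inv.
Qed.

Lemma inversionV_desc w s : s \in S -> N w^-1 s = (ell (w * s) < ell w).
Proof.
move=> sS; rewrite inversion_desc // -(ell_inv w) -(ell_inv (w * s)).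
by rewrite invMg (simple_invg sS).
Qed.

End Length.

(** * Parabolic subgroups *)

Section Parabolic.
Variable J : {set gT}.
Hypothesis JS : J \subset S.
Local Open Scope group_scope.

Lemma parabolic_simple s : s \in J -> s \in S.
Proof. exact: (subsetP JS). Qed.

Lemma TJ_T r : r \in TJ J -> r \in T S.
Proof. by rewrite T_TJ //; apply: TJ_mono. Qed.

Lemma reduced_word_parabolic w : w \in <<J>> ->
  exists ws, [/\ all (mem J) ws, size ws = ell w & wprod ws = w].
Proof.
have sub_words ws : all (mem J) ws -> all (mem S) ws.
  by apply: sub_all => s; apply: parabolic_simple.
move: w; apply: gen_indl => [|s w sJ _ [ws [wsJ szw ws_w]]].
  by exists [::]; rewrite len1 /wprod big_nil.
have sS := parabolic_simple sJ; rewrite ell_mull //; case: ifP => nw; last first.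
  by exists (s :: ws); rewrite wprod_cons ws_w /= sJ szw.
have nws : N (wprod ws) s by rewrite ws_w.
have [vs [sub_ws lt_ws vs_w]] :=
  cocycle_exchange inversion_cocycleP (sub_words _ wsJ) nws.
have vsJ : all (mem J) vs by apply/allP => x /sub_ws; apply/allP.
exists vs; split; rewrite ?vs_w ?ws_w //.
have := len_wprod (sub_words _ vsJ); rewrite vs_w ws_w ell_mull // nw.
by move: (size vs) lt_ws (ell_gt0 nw) => k; lia.
Qed.

Lemma len_parabolic w : w \in <<J>> -> len J w = ell w.
Proof.
move=> wJ; apply/eqP; rewrite eqn_leq; apply/andP; split.
  by case: (reduced_word_parabolic wJ) => ws [wsJ <- <-]; apply: len_wprod.
case: (reduced_word wJ) => ws [wsJ <- <-]; apply: len_wprod.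
by apply: sub_all wsJ => s; apply: parabolic_simple.
Qed.

Lemma inversion_TJ w r : w \in <<J>> -> N w r -> r \in TJ J.
Proof.
move=> wJ; move: w wJ r; apply: gen_indl => [r|s w sJ wJ IH r].
  by rewrite inversion1.
rewrite inversionM inversion_gen ?parabolic_simple //.
case: eqP => [-> _|_ /=]; first exact: TJ_gen.
by move/IH; rewrite TJ_conj // mem_gen.
Qed.

Lemma desc_exists w : w \in <<J>> -> w != 1 -> exists2 s, s \in J & N w s.
Proof.
case/reduced_word_parabolic=> [[|s ws] [/=]].
  by move=> _ _ <-; rewrite /wprod big_nil eqxx.
case/andP=> sJ wsJ szw ws_w _; have sS := parabolic_simple sJ; exists s => //.
rewrite inversion_desc // -szw -ws_w wprod_cons simple_mulKg // ltnS.
by apply: len_wprod; apply: sub_all wsJ => x; apply: parabolic_simple.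
Qed.

Lemma WJupP w : reflect {in J, forall s, N w^-1 s = false} (w \in WJup S J).
Proof.
rewrite inE; apply: (iffP forall_inP) => wJ s sJ.
  by have := wJ s sJ; rewrite ell_mulr ?parabolic_simple //; case: (N _ _); lia.
by rewrite ell_mulr ?parabolic_simple // wJ.
Qed.

Lemma WJup1 : 1 \in WJup S J.
Proof. by apply/WJupP => s _; rewrite invg1 inversion1. Qed.

Lemma ell_mul_no_inversion w v :
  {in TJ J, forall r, N w^-1 r = false} -> v \in <<J>> ->
  ell (w * v) = (ell w + ell v)%N.
Proof.
move=> wJ; move: v; apply: gen_indr => [|s v sJ vJ IH]; first by rewrite mulg1 len1 addn0.
have sS := parabolic_simple sJ; rewrite mulgA !(ell_mulr _ sS) IH invMg inversionM.
rewrite wJ; last by rewrite TJ_conj ?groupV // TJ_gen.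
rewrite addbF; case: ifP => [nv|_]; last by rewrite addnS.
by have := ell_gt0 nv; rewrite ell_inv; lia.
Qed.

Lemma exists_no_inversion w : exists w0 v,
  [/\ {in TJ J, forall r, N w0^-1 r = false}, v \in <<J>> & w = w0 * v].
Proof.
case: (@arg_minnP _ 1 (mem <<J>>) (fun v => ell (w * v))) => /= [|v0 vJ vmin].
  exact: group1.
exists (w * v0), v0^-1; split; rewrite ?groupV ?mulgK // => r rJ.
apply/negP => /inversion_ltn; rewrite -ell_inv invMg invgK ell_inv -mulgA.
by rewrite ltnNge vmin // groupM // groupV TJ_sub.
Qed.

Lemma WJup_no_inversion w r : w \in WJup S J -> r \in TJ J -> N w^-1 r = false.
Proof.
move=> /WJupP wJ rJ; case: (exists_no_inversion w) => w0 [v [w0J vJ ->]] in wJ *.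
have [->|v1] := eqVneq v 1; first by rewrite mulg1 w0J.
have vVJ : v^-1 \in <<J>> by rewrite groupV.
have [|s sJ ns] := desc_exists vVJ; first by rewrite eq_invg1.
have := wJ s sJ; rewrite invMg inversionM ns w0J //.
by rewrite TJ_conj // TJ_gen.
Qed.

Lemma ell_WJup_mul w v : w \in WJup S J -> v \in <<J>> ->
  ell (w * v) = (ell w + ell v)%N.
Proof.
by move=> wJ; apply: ell_mul_no_inversion => // r; apply: WJup_no_inversion.
Qed.

Lemma coset_decomp w : exists w0 v,
  [/\ w0 \in WJup S J, v \in <<J>> & w = w0 * v].
Proof.
case: (exists_no_inversion w) => w0 [v [w0J vJ e]]; exists w0, v; split=> //.
by apply/WJupP => s sJ; apply: w0J; apply: TJ_gen.
Qed.

Lemma coset_decomp_inj w w' v v' :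
  w \in WJup S J -> w' \in WJup S J -> v \in <<J>> -> v' \in <<J>> ->
  w * v = w' * v' -> w = w' /\ v = v'.
Proof.
move=> wJ w'J vJ v'J e; have uJ : v * v'^-1 \in <<J>> by rewrite groupM ?groupV.
have w'E : w' = w * (v * v'^-1) by rewrite mulgA e mulgK.
have : v * v'^-1 = 1.
  apply: (len_eq0 (mem_genS _)); have := ell_WJup_mul wJ uJ; rewrite -w'E.
  by have := ell_WJup_mul w'J (groupVr uJ); rewrite {1}w'E mulgK; lia.
move/eqP; rewrite -eq_mulgV1 => /eqP vv'.
by split=> //; move: e; rewrite vv' => /mulIg.
Qed.

Lemma deodhar w s : w \in WJup S J -> s \in S -> s * w \notin WJup S J ->
  w^-1 * s * w \in J /\ N w s = false.
Proof.
move=> wJ sS swJ; have [t tJ nt] : exists2 t, t \in J & N (s * w)^-1 t.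
  apply/exists_inP; apply: contraNT swJ => /exists_inPn no_desc.
  by apply/WJupP => t /no_desc /negPf.
have wt := WJup_no_inversion wJ (TJ_gen tJ).
move: nt; rewrite invMg (simple_invg sS) inversionM wt inversion_gen //= => /eqP e.
have tE : w^-1 * s * w = t by rewrite -e conjgE invgK !mulgA mulVg mul1g mulgKV.
by rewrite tE; split=> //; rewrite -[w]invgK inversionV invgK conjgE mulgA tE.
Qed.

Lemma WJup_desc w s :
  w \in WJup S J -> s \in S -> N w s -> s * w \in WJup S J.
Proof.
move=> wJ sS nw; apply/negPn/negP => swJ.
by case: (deodhar wJ sS swJ) => _; rewrite nw.
Qed.

Lemma simple_notin_WJup s : s \in J -> s \notin WJup S J.
Proof.
move=> sJ; have sS := parabolic_simple sJ; apply/negP => /WJupP /(_ s sJ).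
by rewrite simple_invg // inversion_gen // eqxx.
Qed.

Lemma inversion_mul_WJupV u v r : u^-1 \in WJup S J -> v \in <<J>> ->
  r \in TJ J -> N (v * u) r = N v r.
Proof.
move=> uJ vJ rJ; have := WJup_no_inversion uJ (r := r ^ v).
by rewrite inversionM invgK TJ_conj // => ->; rewrite ?addbF.
Qed.

Lemma ell_mul_WJupV u v : u^-1 \in WJup S J -> v \in <<J>> ->
  ell (v * u) = (ell v + ell u)%N.
Proof.
move=> uJ vJ; rewrite -ell_inv invMg ell_WJup_mul ?groupV //.
by rewrite !ell_inv addnC.
Qed.

Lemma cosetV_decomp w : exists v u,
  [/\ v \in <<J>>, u^-1 \in WJup S J & w = v * u].
Proof.
case: (coset_decomp w^-1) => u [v [uJ vJ e]]; exists v^-1, u^-1.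
by rewrite groupV invgK -invMg -e invgK.
Qed.

Lemma inversion_WJup_mul w v s : w \in WJup S J -> s * w \in WJup S J ->
  v \in <<J>> -> N (w * v) s = N w s.
Proof.
move=> wJ swJ vJ; rewrite inversionM.
have [nv|] := boolP (N v (s ^ w)); last by rewrite addbF.
have rJ := inversion_TJ vJ nv; have rT := TJ_T rJ.
have [|_ r1] := coset_decomp_inj swJ wJ (group1 _) (TJ_sub rJ).
  by rewrite mulg1 conjgE mulKVg.
by have := inversion_refl rT; rewrite -r1 inversion1.
Qed.

Definition coset_rep g : gT :=
  if [pick w in WJup S J | w^-1 * g \in <<J>>] is Some w then w else 1.

Definition coset_rem g : gT := (coset_rep g)^-1 * g.

Lemma coset_repE w v : w \in WJup S J -> v \in <<J>> -> coset_rep (w * v) = w.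
Proof.
move=> wJ vJ; rewrite /coset_rep; case: pickP => [w' /andP [w'J remJ]|/(_ w)].
  by have [|->] := coset_decomp_inj w'J wJ remJ vJ; rewrite ?mulKVg.
by rewrite wJ mulKg vJ.
Qed.

Lemma coset_remE w v : w \in WJup S J -> v \in <<J>> -> coset_rem (w * v) = v.
Proof. by move=> wJ vJ; rewrite /coset_rem coset_repE // mulKg. Qed.

End Parabolic.

Lemma ascent_ind (P : gT -> Prop) :
  P 1%g -> (forall s w, s \in S -> N w s = false -> P w -> P (s * w)%g) ->
  forall w, P w.
Proof.
move=> P1 PS w; have [k] := ubnP (ell w); elim: k w => // k IH w wk.
have [->//|w1] := eqVneq w 1%g.
have [s sS ns] := desc_exists (subxx S) (mem_genS w) w1.
rewrite -[w](simple_mulKg w sS); apply: PS; rewrite ?inversion_mulsl ?ns //.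
by apply: IH; apply: leq_trans (inversion_ltn ns) _; rewrite -ltnS.
Qed.

(** * Matsumoto's theorem *)

Section Dihedral.
Local Open Scope group_scope.

Lemma pair_sub (J : {set gT}) s t : s \in J -> t \in J -> [set s; t] \subset J.
Proof. by move=> sJ tJ; rewrite subUset !sub1set sJ. Qed.

Lemma ell_altw_le s t k : s \in S -> t \in S -> ell (altw s t k) <= k.
Proof.
elim: k s t => [|k IH] s t sS tS; first by rewrite len1.
by apply: leq_trans (len_mull sS (mem_genS _)) _; rewrite ltnS IH.
Qed.

Lemma desc_altw s t k v : s \in S -> t \in S -> v \in <<[set s; t]>> ->
  ell v = k -> (0 < k -> N v s) -> v = altw s t k.
Proof.
elim: k s t v => [|k IH] s t v sS tS vI vk nv.
  by apply: len_eq0 vk; apply: mem_genS.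
have svI : s * v \in <<[set s; t]>> by rewrite groupM // mem_gen // set21.
have svk : ell (s * v) = k by rewrite ell_mull // nv // vk.
rewrite altwS -(IH t s (s * v)) ?simple_mulKg // ?[[set t; s]]setUC // => k0.
have sv1 : s * v != 1.
  by apply/eqP => e; move: svk k0; rewrite e len1 => <-.
case: (desc_exists (pair_sub sS tS) svI sv1) => b /set2P [] -> //.
by rewrite inversion_mulsl // nv.
Qed.

Lemma dihedral_longest s t v : s \in S -> t \in S -> v \in <<[set s; t]>> ->
  N v s -> N v t -> v = altw s t #[s * t] /\ ell v = #[s * t].
Proof.
move=> sS tS vI ns nt; have v_st := desc_altw sS tS vI erefl (fun=> ns).
have v_ts : v = altw t s (ell v) by apply: desc_altw; rewrite // setUC.
have /altw_swap st1 : altw s t (ell v) = altw t s (ell v) by rewrite -v_st.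
have /dvdnP [j vj] : #[s * t] %| ell v by rewrite order_dvdn st1 ?simple_invg.
have v0 := ell_gt0 ns; case: j vj => [|[|j]] vj; first by rewrite vj in v0.
  by rewrite mul1n in vj; rewrite -vj.
have v_short : v = altw s t (j * #[s * t]).
  rewrite {1}v_st vj -addn2 mulnDl addnC mul2n altwD odd_double altw_double.
  by rewrite expg_order mul1g.
have := ell_altw_le (j * #[s * t]) sS tS; rewrite -v_short vj.
by have := order_gt0 (s * t); nia.
Qed.

Lemma ell_altw s t j : s \in S -> t \in S -> j <= #[s * t] -> ell (altw s t j) = j.
Proof.
move=> sS tS jm; have IS := pair_sub sS tS.
case: (@arg_maxnP _ 1 (mem <<[set s; t]>>) ell) => /= [|v vI vmax].
  exact: group1.
have nv b : b \in [set s; t] -> N v b.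
  move=> bI; have bS := subsetP IS b bI; apply/negPn/negP => nb.
  have := vmax (b * v); rewrite groupM ?(mem_gen bI) // => /(_ isT).
  by rewrite ell_mull // (negPf nb) /= ltnn.
have [ev lv] := dihedral_longest sS tS vI (nv s (set21 s t)) (nv t (set22 s t)).
apply/eqP; rewrite eqn_leq ell_altw_le //= -(leq_add2r (#[s * t] - j)).
rewrite subnKC // -[leqLHS]lv ev -{1}(subnKC jm) altwD.
apply: leq_trans (ell_mul_le _ _) _; rewrite leq_add2l.
by case: (odd j); apply: ell_altw_le.
Qed.

Lemma order_mulgC s t : s \in S -> t \in S -> #[t * s] = #[s * t].
Proof. by move=> sS tS; rewrite -orderV invMg !simple_invg. Qed.

Lemma braid_altw s t : s \in S -> t \in S ->
  altw s t #[s * t] = altw t s #[s * t].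
Proof.
by move=> sS tS; apply/altw_swap; rewrite ?simple_invg // expg_order.
Qed.

Lemma no_inversion_pair s t w r : s \in S -> t \in S ->
  N w s = false -> N w t = false -> r \in TJ [set s; t] -> N w r = false.
Proof.
move=> sS tS ns nt rI; rewrite -[w]invgK.
apply: (WJup_no_inversion (pair_sub sS tS)) => //.
by apply/(WJupP (pair_sub sS tS)) => b /set2P [] ->; rewrite invgK.
Qed.

Lemma two_descents s t w : s \in S -> t \in S -> N w s -> N w t ->
  exists u, [/\ u^-1 \in WJup S [set s; t], ell w = (#[s * t] + ell u)%N,
                s * w = altw t s #[s * t].-1 * u & t * w = altw s t #[s * t].-1 * u].
Proof.
move=> sS tS ns nt; have IS := pair_sub sS tS.
move: ns nt; have [v [u [vI uI ->]]] := cosetV_decomp IS w => ns nt.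
have nv b : b \in [set s; t] -> N (v * u) b -> N v b.
  by move=> bI; rewrite (inversion_mul_WJupV IS) // TJ_gen.
have [vst vm] := dihedral_longest sS tS vI
  (nv s (set21 s t) ns) (nv t (set22 s t) nt).
have vts : v = altw t s #[s * t] by rewrite vst braid_altw.
exists u; split=> //; first by rewrite (ell_mul_WJupV IS) // vm.
  by rewrite mulgA {1}vst -{1}(prednK (order_gt0 (s * t))) altwS simple_mulKg.
by rewrite mulgA {1}vts -{1}(prednK (order_gt0 (s * t))) altwS simple_mulKg.
Qed.

End Dihedral.

Section CommutingReflections.
Variables s t : gT.
Hypotheses (sS : s \in S) (tS : t \in S).
Local Open Scope group_scope.
Local Notation I := [set s; t].
Implicit Types (c q : gT).

Let IS : I \subset S := pair_sub sS tS.

Lemma pair_rotation q : q \in TJ I -> q * s \in <[s * t]>.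
Proof.
have ts_rot : t * s \in <[s * t]> by rewrite -groupV invMg !simple_invg // cycle_id.
case/TJP=> g [b [gI bI ->]]; move: g gI; apply: gen_indr => [|c g cI gI IH].
  by rewrite conjg1; case/set2P: bI => ->; rewrite ?simple_mulgg ?group1.
rewrite conjgM; set p := b ^ g in IH *.
have pV : p^-1 = p by rewrite T_invg // (TJ_T IS) // TJ_conj // TJ_gen.
have sp_rot : s * p \in <[s * t]> by rewrite -groupV invMg (simple_invg sS) pV.
rewrite conjgE; case/set2P: cI => ->; first by rewrite simple_invg // mulgA simple_mulgK.
rewrite (simple_invg tS) (_ : _ * s = t * s * (s * p) * (t * s)).
  by rewrite (groupM (groupM ts_rot sp_rot) ts_rot).
by rewrite !mulgA simple_mulgK.
Qed.

Lemma rotation_involution_central c : c \in <[s * t]> -> c * c = 1 ->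
  {in <<I>>, forall g, g * c = c * g}.
Proof.
case/cycleP=> k ck cc; have cV : c^-1 = c by apply/eqP; rewrite eq_invg_mul cc.
have sc : s * c = c * s.
  have inv_st : (s * t) ^ s = (s * t)^-1.
    by rewrite conjgE !invMg !simple_invg // -mulgA simple_mulKg.
  have : c ^ s = c by rewrite -[RHS]cV ck conjXg inv_st expgVn.
  by rewrite conjgE => e; rewrite -[c in LHS]e mulKVg.
have tc : t * c = c * t.
  have stc : s * t * c = c * (s * t) by rewrite ck -expgS -expgSr.
  by rewrite -(simple_mulKg t sS) -mulgA stc mulgA sc -mulgA.
move=> g; move: g; apply: gen_indl => [|b g bI gI IH]; first by rewrite mul1g mulg1.
rewrite -mulgA IH mulgA [in RHS]mulgA; congr (_ * _).
by case/set2P: bI => ->.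
Qed.

Lemma central_inversionJ c g q :
  g * c = c * g -> q ^ c = q -> N c (q ^ g) = N c q.
Proof.
move=> gc qc; have := inversionM g c q; rewrite gc inversionM qc.
by case: (N c q); case: (N g q); case: (N c _).
Qed.

Lemma central_longest c : c \in <<I>> -> {in <<I>>, forall g, g * c = c * g} ->
  c != 1 -> c \notin I -> {in TJ I, forall q, N c q}.
Proof.
move=> cI cent c1 c_notin.
have conj_c g q : g \in <<I>> -> q \in <<I>> -> N c (q ^ g) = N c q.
  move=> gI qI; apply: central_inversionJ; first exact: cent.
  by rewrite conjgE cent // mulKg.
have next b : b \in I -> N c b -> exists b', [/\ b' \in I, b' != b & N c b'].
  move=> bI nb; have bS := subsetP IS b bI.
  have bc1 : b * c != 1.
    apply: contraNneq c_notin => bc.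
    by rewrite -(simple_mulKg c bS) bc mulg1.
  have bcI : b * c \in <<I>> by rewrite groupM // mem_gen.
  have [b' b'I nb'] := desc_exists IS bcI bc1.
  have b'b : b' != b by apply: contraTneq nb' => ->; rewrite inversion_mulsl // nb.
  exists b'; split=> //; rewrite -(conj_c b b') ?mem_gen // -[c in N c](simple_mulKg c bS).
  rewrite inversionM inversion_gen // -conjgM simple_mulgg // conjg1 nb'.
  rewrite (_ : (b' ^ b == b) = false) //; apply: contraNF b'b => /eqP e.
  by rewrite -(inj_eq (@conjg_inj _ b)) e conjgE mulKg.
have [b bI nb] := desc_exists IS cI c1; have [b' [b'I b'b nb']] := next b bI nb.
have nI a : a \in I -> N c a.
  by case/set2P: bI b'I nb nb' b'b => -> /set2P [] -> nb nb' b'b /set2P [] ->;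
    rewrite ?eqxx in b'b *.
by move=> q /TJP [g [d [gI dI ->]]]; rewrite (conj_c _ _ gI (mem_gen dI)) nI.
Qed.

Lemma commuting_reflections r r' : r \in TJ I -> r' \in TJ I -> r != r' ->
  r * r' = r' * r ->
  [/\ r * r' = altw s t #[s * t], {in <<I>>, forall g, g * (r * r') = r * r' * g},
      {in TJ I, forall q, N (r * r') q} & ~~ odd #[s * t]].
Proof.
move=> rI r'I rr' comm; set c := r * r'.
have rT := TJ_T IS rI; have r'T := TJ_T IS r'I.
have cc : c * c = 1.
  by rewrite {2}/c comm /c mulgA -(mulgA r) T_mulgg // mulg1 T_mulgg.
have c_rot : c \in <[s * t]>.
  have -> : c = r * s * (r' * s)^-1.
    by rewrite invMg (simple_invg sS) (T_invg r'T) mulgA simple_mulgK.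
  by rewrite groupM ?groupV ?pair_rotation.
have cI : c \in <<I>> by rewrite groupM // TJ_sub.
have cent := rotation_involution_central c_rot cc.
have ncr : N c r.
  rewrite inversion_mull // inversion_commute //.
  by rewrite conjgE comm mulKg.
have c1 : c != 1 by apply: contraTneq ncr => ->; rewrite inversion1.
have c_notin : c \notin I.
  apply/negP => cI'; have cS := subsetP IS c cI'.
  move: ncr; rewrite inversion_gen // => /eqP rc.
  have r'1 : r' = 1 by apply: (@mulgI _ r); rewrite -/c mulg1.
  by have := inversion_refl r'T; rewrite r'1 inversion1.
have nc := central_longest cI cent c1 c_notin; split=> //.
  by case: (dihedral_longest sS tS cI (nc s _) (nc t _)); rewrite // TJ_gen ?set21 ?set22.
have c2 : #[c] = 2%N by apply: nt_prime_order.
by have := order_dvdG c_rot; rewrite c2 -orderE dvdn2.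
Qed.

End CommutingReflections.

Section Matsumoto.
Variables (J : {set gT}) (V : Type) (rho : gT -> V -> V).
Hypothesis JS : J \subset S.
Hypothesis braid : forall s t, s \in J -> t \in J ->
  altop (rho s) (rho t) #[s * t]%g =1 altop (rho t) (rho s) #[s * t]%g.
Local Open Scope group_scope.

Fixpoint opw k w x : V :=
  if k is k'.+1 then
    if [pick s in J | (len S (s * w) < len S w)%N] is Some s
    then rho s (opw k' (s * w) x) else x
  else x.

Definition opW w x := opw (ell w) w x.

Lemma opW1 x : opW 1 x = x.
Proof. by rewrite /opW len1. Qed.

Lemma opW_altw s t u x k j : s \in J -> t \in J ->
  u^-1 \in WJup S [set s; t] -> u \in <<J>> -> j <= #[s * t] -> j + ell u <= k ->
  (forall b w, b \in J -> w \in <<J>> -> ell w <= k -> N w b ->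
     opW w x = rho b (opW (b * w) x)) ->
  opW (altw s t j * u) x = altop (rho s) (rho t) j (opW u x).
Proof.
move=> + + + uJ + + IH; elim: j s t => [|j IHj] s t sJ tJ uI jm jk.
  by rewrite mul1g.
have [sS tS] := (subsetP JS s sJ, subsetP JS t tJ); have IS := pair_sub sS tS.
have aI : altw s t j.+1 \in <<[set s; t]>> by rewrite mem_altw ?set21 ?set22.
have aJ : altw s t j.+1 \in <<J>> by apply: subsetP (genS (pair_sub sJ tJ)) _ aI.
have sTI : s \in TJ [set s; t] by rewrite TJ_gen ?set21.
rewrite (IH s _ sJ (groupM aJ uJ)).
- rewrite altwS -!mulgA simple_mulKg //= IHj // 1?[[set t; s]]setUC //.
    by rewrite order_mulgC // ltnW.
  by rewrite ltnW.
- by rewrite (ell_mul_WJupV IS) // ell_altw.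
rewrite (inversion_mul_WJupV IS) // inversion_desc // altwS simple_mulKg //.
by rewrite -altwS !ell_altw // order_mulgC // ltnW.
Qed.

(* Two left descents s and t of w force w = D u with D the longest element of
   the dihedral group, so that a single braid relation is needed. *)
Lemma opW_desc s w x : s \in J -> w \in <<J>> -> N w s ->
  opW w x = rho s (opW (s * w) x).
Proof.
have [k] := ubnP (ell w); elim: k s w => // k IH s w wk sJ wJ ns.
have sS := subsetP JS s sJ.
have ew : (ell w = (ell w).-1.+1)%N by rewrite prednK // (ell_gt0 ns).
rewrite {1}/opW ew /=; case: pickP => [t|]; last first.
  by move/(_ s); rewrite sJ -inversion_desc ?ns.
case/andP=> tJ; have tS := subsetP JS t tJ; rewrite -inversion_desc // => nt.
have -> : opw (ell w).-1 (t * w) x = opW (t * w) x by rewrite /opW ell_mull // nt.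
have [u [uI lw sw tw]] := two_descents sS tS ns nt.
have m0 := order_gt0 (s * t); set m := #[s * t] in lw sw tw m0.
have uJ : u \in <<J>>.
  rewrite -(mulKg (altw s t m.-1) u) -tw.
  by rewrite !groupM ?groupV ?mem_altw // mem_gen.
have IHw b v : b \in J -> v \in <<J>> -> ell v <= (ell w).-1 -> N v b ->
    opW v x = rho b (opW (b * v) x).
  by move=> bJ vJ vw; apply: IH => //; rewrite ew in wk; apply: leq_ltn_trans vw wk.
have lu : (m.-1 + ell u <= (ell w).-1)%N by rewrite lw -{2}(prednK m0).
rewrite sw tw (opW_altw sJ tJ uI uJ _ lu IHw) ?leq_pred //.
rewrite (opW_altw tJ sJ _ uJ _ lu IHw) 1?[[set t; s]]setUC //; last first.
  by rewrite order_mulgC // leq_pred.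
by have := braid sJ tJ (opW u x); rewrite -/m -(prednK m0) /= => ->.
Qed.

Lemma opW_mull s w x : s \in J -> w \in <<J>> -> N w s = false ->
  opW (s * w) x = rho s (opW w x).
Proof.
move=> sJ wJ nw; have sS := subsetP JS s sJ.
rewrite (@opW_desc s) ?simple_mulKg ?inversion_mulsl ?nw //.
by rewrite groupM // mem_gen.
Qed.

Lemma opW_gen s x : s \in J -> opW s x = rho s x.
Proof. by move=> sJ; rewrite -{1}(mulg1 s) opW_mull ?group1 ?inversion1 // opW1. Qed.

Lemma opW_mul u v x : u \in <<J>> -> v \in <<J>> ->
  ell (u * v) = (ell u + ell v)%N -> opW (u * v) x = opW u (opW v x).
Proof.
have [k] := ubnP (ell u); elim: k u => // k IH u uk uJ vJ uv.
have [->|u1] := eqVneq u 1; first by rewrite mul1g opW1.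
case: (desc_exists JS uJ u1) => s sJ ns; have sS := subsetP JS s sJ.
have su : ell u = (ell (s * u)).+1.
  by rewrite ell_mull // ns prednK // (ell_gt0 ns).
have suJ : s * u \in <<J>> by rewrite groupM // mem_gen.
have suv : ell (s * u * v) = (ell (s * u) + ell v)%N.
  apply/eqP; rewrite eqn_leq ell_mul_le /=.
  have := len_mull sS (mem_genS (s * u * v)).
  by rewrite -mulgA simple_mulKg // uv su addSn ltnS.
rewrite (opW_desc _ sJ uJ ns) -IH //; last by rewrite su ltnS in uk.
rewrite -mulgA -(@opW_desc s) ?groupM // inversion_desc //.
by rewrite mulgA suv uv su addSn ltnS.
Qed.

Lemma opW_mulr s w x : s \in J -> w \in <<J>> -> N w^-1 s = false ->
  opW (w * s) x = opW w (rho s x).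
Proof.
move=> sJ wJ nw; have sS := subsetP JS s sJ.
rewrite (opW_mul _ wJ (mem_gen sJ)) ?(opW_gen _ sJ) //.
by rewrite (ell_mulr _ sS) nw (ell_gen sS) addn1.
Qed.

End Matsumoto.

Lemma opW_intertwine J (V U : Type) (rho : gT -> V -> V) (rho' : gT -> U -> U)
    (pi : V -> U) w x :
  (forall s y, s \in J -> pi (rho s y) = rho' s (pi y)) ->
  pi (opW J rho w x) = opW J rho' w (pi x).
Proof.
move=> pi_rho; suff E k : pi (opw J rho k w x) = opw J rho' k w (pi x) by apply: E.
elim: k w => //= k IH w.
by case: pickP => [s /andP [sJ _]|_ //]; rewrite pi_rho ?IH.
Qed.

(** * The Hecke algebra *)

Section HeckeAlgebra.
Local Open Scope ring_scope.
Variables (R : comNzRingType) (q : R).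
Local Notation H := {ffun gT -> R^o}.
Local Notation delta := (@delta R _).
Implicit Types h : H.

Section RegularModule.

Definition lreg s : {linear H -> H} := hecke_op q (mulg s) ell (fun=> 0).
Definition rreg t : {linear H -> H} := hecke_op q (mulg^~ t) ell (fun=> 0).
#[global] Arguments lreg : simpl never.
#[global] Arguments rreg : simpl never.

Lemma lregE s w : s \in S ->
  lreg s (delta w) = delta (s * w)%g + (if N w s then q else 0) *: delta w.
Proof.
move=> sS; rewrite inversion_desc //; case: ltnP => [lt_w|le_w].
  by rewrite /lreg hecke_op_down.
by rewrite /lreg hecke_op_up ?scale0r ?addr0 // ltn_neqAle eq_sym ell_mull_neq.
Qed.

Lemma lreg_up s w : s \in S -> N w s = false -> lreg s (delta w) = delta (s * w)%g.
Proof. by move=> sS nw; rewrite lregE // nw scale0r addr0. Qed.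

Lemma ell_mulr_neq s w : s \in S -> ell (w * s)%g != ell w.
Proof.
move=> sS; rewrite -[ell (w * s)%g]ell_inv -[ell w]ell_inv invMg (simple_invg sS).
exact: ell_mull_neq.
Qed.

Lemma rregE t w : t \in S ->
  rreg t (delta w) = delta (w * t)%g + (if N w^-1%g t then q else 0) *: delta w.
Proof.
move=> tS; rewrite inversionV_desc //; case: ltnP => [lt_w|le_w].
  by rewrite /rreg hecke_op_down.
by rewrite /rreg hecke_op_up ?scale0r ?addr0 // ltn_neqAle eq_sym ell_mulr_neq.
Qed.

Lemma rreg_up t w : t \in S -> N w^-1%g t = false ->
  rreg t (delta w) = delta (w * t)%g.
Proof. by move=> tS nw; rewrite rregE // nw scale0r addr0. Qed.

Lemma lreg_quadratic s h : s \in S -> lreg s (lreg s h) = h + q *: lreg s h.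
Proof.
move=> sS; apply: hecke_op_quadratic => [w|w /eqP]; first exact: simple_mulKg.
by rewrite (negPf (ell_mull_neq w sS)).
Qed.

Lemma lreg_rregC s t h : s \in S -> t \in S -> lreg s (rreg t h) = rreg t (lreg s h).
Proof.
move=> sS tS; pose f : {linear H -> H} := lreg s \o rreg t.
pose g : {linear H -> H} := rreg t \o lreg s.
apply: (linear_delta_ext (f := f) (g := g)) => w; rewrite /f /g /=.
rewrite (rregE _ tS) (lregE _ sS) !linearD !linearZ /=.
rewrite !(lregE _ sS) !(rregE _ tS) mulgA invMg !inversionM (simple_invg sS).
rewrite (inversion_gen _ sS) (inversion_gen _ tS).
have -> : (s ^ w == t)%g = (s * w == w * t)%g.
  by rewrite -(inj_eq (mulgI w)) conjgE mulKVg.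
have -> : (t ^ w^-1 == s)%g = (s * w == w * t)%g.
  by rewrite -(inj_eq (mulIg w)) conjgE invgK mulgA mulgKV eq_sym.
case: eqP => [sw|_]; last first.
  by rewrite !addbF !scalerDr !scalerA -!addrA mulrC; congr (_ + _); rewrite addrCA.
have -> : N w^-1%g t = N w s.
  by rewrite inversionV_desc // inversion_desc // sw.
by rewrite sw; case: (N w s); rewrite /= !scale0r ?addr0 // addrC.
Qed.

(* Left multiplications commute with right ones, hence are determined by their
   value at 1. *)
Lemma regular_ext (f g : {linear H -> H}) :
  (forall t h, t \in S -> f (rreg t h) = rreg t (f h)) ->
  (forall t h, t \in S -> g (rreg t h) = rreg t (g h)) ->
  f (delta 1%g) = g (delta 1%g) -> f =1 g.
Proof.
move=> fr gr fg1; apply: linear_delta_ext => w; rewrite -[w]invgK.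
elim/ascent_ind: {w}(w^-1%g) => [|t w tS nw IH]; first by rewrite invg1.
by rewrite invMg (simple_invg tS) -rreg_up ?invgK // fr // gr // IH.
Qed.

Lemma altop_lreg1 s t k : s \in S -> t \in S -> (k <= #[s * t]%g)%N ->
  altop (lreg s) (lreg t) k (delta 1%g) = delta (altw s t k).
Proof.
move=> + + km; elim: k s t km => // k IH s t km sS tS.
have km' : (k <= #[t * s]%g)%N by rewrite order_mulgC // ltnW.
rewrite altwS /= IH // lreg_up // inversion_desc // -altwS !ell_altw //.
by rewrite ltnNge leqnSn.
Qed.

Lemma lreg_braid s t : s \in S -> t \in S ->
  altop (lreg s) (lreg t) #[s * t]%g =1 altop (lreg t) (lreg s) #[s * t]%g.
Proof.
move=> sS tS; apply: regular_ext => [r h rS|r h rS|] /=.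
- by apply/esym/altop_intertwine => c; rewrite lreg_rregC.
- by apply/esym/altop_intertwine => c; rewrite lreg_rregC.
by rewrite !altop_lreg1 ?braid_altw // order_mulgC.
Qed.

Lemma altop_regular_image (M : lmodType R) (f g : M -> M) (pi : H -> M) s t h :
  s \in S -> t \in S ->
  (forall h, pi (lreg s h) = f (pi h)) -> (forall h, pi (lreg t h) = g (pi h)) ->
  altop f g #[s * t]%g (pi h) = altop g f #[s * t]%g (pi h).
Proof.
move=> sS tS pif pig; rewrite -(altop_intertwine _ _ pif pig).
by rewrite -(altop_intertwine _ _ pig pif) lreg_braid.
Qed.

End RegularModule.

Section HeckeAction.
Variables (M : lmodType R) (rho : gT -> {linear M -> M}).
Hypothesis rho_quadratic : forall s, s \in S ->
  forall m, rho s (rho s m) = m + q *: rho s m.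
Hypothesis rho_braid : forall s t, s \in S -> t \in S ->
  altop (rho s) (rho t) #[s * t]%g =1 altop (rho t) (rho s) #[s * t]%g.
Implicit Types m : M.

Fact opw_is_linear (J : {set gT}) k w : linear (opw J (fun s => rho s) k w).
Proof.
elim: k w => [//|k IH] w c m m' /=.
by case: pickP => [s _|_ //]; rewrite IH linearP.
Qed.
HB.instance Definition _ (J : {set gT}) w :=
  GRing.isLinear.Build R M M *:%R (opW J (fun s => rho s) w)
    (opw_is_linear J (ell w) w).

Definition hecke_orbit m : {linear H -> M} :=
  linear_lift (fun w => opW S (fun s => rho s) w m).
#[global] Arguments hecke_orbit : simpl never.

Definition hact h m : M := hecke_orbit m h.

Fact hact_is_linear h : linear (hact h).
Proof.
move=> c m m'; rewrite /hact /hecke_orbit /= /linear_lift scaler_sumr -big_split /=.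
by apply: eq_bigr => w _; rewrite linearP scalerDr !scalerA mulrC.
Qed.
HB.instance Definition _ h :=
  GRing.isLinear.Build R M M *:%R (hact h) (hact_is_linear h).

Lemma hact_delta w m : hact (delta w) m = opW S (fun s => rho s) w m.
Proof. exact: (linear_lift_delta (fun w => opW S (fun s => rho s) w m)). Qed.

Lemma hact1 m : hact (delta 1%g) m = m.
Proof. by rewrite hact_delta opW1. Qed.

Lemma hact_gen s m : s \in S -> hact (delta s) m = rho s m.
Proof. by move=> sS; rewrite hact_delta opW_gen. Qed.

Lemma hact_lreg s h m : s \in S -> hact (lreg s h) m = rho s (hact h m).
Proof.
move=> sS; pose f : {linear H -> M} := hecke_orbit m \o lreg s.
pose g : {linear H -> M} := rho s \o hecke_orbit m.
apply: (linear_delta_ext (f := f) (g := g)) => w; rewrite /f /g /=.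
rewrite lregE // linearD linearZ /= -!/(hact _ m) !hact_delta.
have wS := mem_genS w; case: ifP => nw; last first.
  by rewrite scale0r addr0 (opW_mull (subxx S)).
by rewrite (opW_desc (subxx S) rho_braid m sS wS nw) rho_quadratic.
Qed.

Lemma hact_opW_lreg w h m :
  hact (opW S (fun s => lreg s) w h) m = opW S (fun s => rho s) w (hact h m).
Proof.
by apply: (opW_intertwine (pi := fun h => hact h m)) => s c sS; rewrite hact_lreg.
Qed.

End HeckeAction.

Definition hmul h h' : H := hact lreg h h'.

Section HeckeInverse.
Variables (M : lmodType R) (rho : gT -> {linear M -> M}).
Hypothesis rho_quadratic : forall s, s \in S ->
  forall m, rho s (rho s m) = m + q *: rho s m.
Hypothesis rho_braid : forall s t, s \in S -> t \in S ->
  altop (rho s) (rho t) #[s * t]%g =1 altop (rho t) (rho s) #[s * t]%g.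
Implicit Types m : M.
Local Notation opR := (opW S (fun s => rho s)).

Lemma hact_hmul h h' m : hact rho (hmul h h') m = hact rho h (hact rho h' m).
Proof.
rewrite /hmul {1}/hact [hact lreg h h']/hact linear_sum.
apply: eq_bigr => w _; rewrite linearZ; congr (_ *: _).
exact: hact_opW_lreg.
Qed.

Definition inv_op s : {linear M -> M} := rho s \- q \*: idfun.

Lemma inv_opE s m : inv_op s m = rho s m - q *: m.
Proof. by []. Qed.

Lemma op_invK s : s \in S -> cancel (rho s) (inv_op s).
Proof. by move=> sS m; rewrite inv_opE rho_quadratic // addrK. Qed.

Lemma inv_opK s : s \in S -> cancel (inv_op s) (rho s).
Proof.
by move=> sS m; rewrite inv_opE linearB linearZ /= rho_quadratic // addrK.
Qed.

Lemma inv_op_quadratic s m : s \in S -> inv_op s (inv_op s m) = m - q *: inv_op s m.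
Proof. by move=> sS; rewrite {1}inv_opE inv_opK. Qed.

Lemma inv_op_braid s t : s \in S -> t \in S ->
  altop (inv_op s) (inv_op t) #[s * t]%g =1 altop (inv_op t) (inv_op s) #[s * t]%g.
Proof.
move=> sS tS m; set k := #[s * t]%g.
have [m' ->] : exists m', m = altop (rho s) (rho t) k m'.
  exists ((if odd k then altop (inv_op s) (inv_op t) k
           else altop (inv_op t) (inv_op s) k) m).
  have := altopK k (inv_opK sS) (inv_opK tS) m.
  have := altopK k (inv_opK tS) (inv_opK sS) m.
  by case: (odd k) => // -> _.
have stK := altopK k (op_invK sS) (op_invK tS) m'; have := altopK k (op_invK tS) (op_invK sS) m'.
by rewrite -rho_braid //; case: (odd k) stK => -> ->.
Qed.

Local Notation opV := (opW S (fun s => inv_op s)).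

Lemma opW_inv_opK w : cancel (opV w) (opR w^-1%g).
Proof.
move: w; apply: ascent_ind => [|s w sS nw IH] m; first by rewrite invg1 !opW1.
rewrite invMg (simple_invg sS) (opW_mulr (subxx S) rho_braid) ?invgK ?mem_genS //.
by rewrite (opW_mull (subxx S) inv_op_braid) ?mem_genS // inv_opK.
Qed.

Lemma opW_opK w : cancel (opR w^-1%g) (opV w).
Proof.
move: w; apply: ascent_ind => [|s w sS nw IH] m; first by rewrite invg1 !opW1.
rewrite (opW_mull (subxx S) inv_op_braid) ?mem_genS // invMg (simple_invg sS).
by rewrite (opW_mulr (subxx S) rho_braid) ?invgK ?mem_genS // IH op_invK.
Qed.

Lemma hact_right_inverse w h m :
  hmul (delta w^-1%g) h = delta 1%g -> hact rho h m = opV w m.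
Proof.
move=> wh; rewrite -{1}[hact rho h m](opW_opK w).
by rewrite -(hact_delta rho) -hact_hmul wh hact1.
Qed.

End HeckeInverse.

Lemma opW_lreg1 w : opW S (fun s => lreg s) w (delta 1%g) = delta w.
Proof.
move: w; apply: ascent_ind => [|s w sS nw IH]; first exact: opW1.
by rewrite (opW_mull (subxx S) lreg_braid) ?mem_genS // IH lreg_up.
Qed.

Lemma hmulA h1 h2 h3 : hmul (hmul h1 h2) h3 = hmul h1 (hmul h2 h3).
Proof. by apply: hact_hmul => // *; [apply: lreg_quadratic | apply: lreg_braid]. Qed.

Lemma hmul1 h : hmul (delta 1%g) h = h.
Proof. exact: hact1. Qed.

Lemma hmulr1 h : hmul h (delta 1%g) = h.
Proof.
apply: (linear_delta_ext (f := hecke_orbit lreg (delta 1%g)) (g := idfun)) => w.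
by rewrite -[LHS]/(hact lreg (delta w) (delta 1%g)) hact_delta opW_lreg1.
Qed.

Lemma hmul_gen s w : s \in S -> N w s = false ->
  hmul (delta s) (delta w) = delta (s * w)%g.
Proof. by move=> sS nw; rewrite /hmul (hact_gen lreg_braid) // lreg_up. Qed.

Definition hinv w : H := opW S (fun s => inv_op lreg s) w^-1%g (delta 1%g).

Lemma hmul_hinv w : hmul (delta w) (hinv w) = delta 1%g.
Proof.
rewrite /hmul hact_delta /hinv -{1}[w]invgK opW_inv_opK // => [s sS h|].
  exact: lreg_quadratic.
exact: lreg_braid.
Qed.

Lemma hmul_hinvl w : hmul (hinv w) (delta w) = delta 1%g.
Proof.
have hmul_inj : injective (hmul (delta w)).
  move=> h h'; rewrite /hmul !hact_delta -[w]invgK.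
  apply: (can_inj (opW_opK (rho := fun s => lreg s) _ _ w^-1%g)) => [s sS h1|].
    exact: lreg_quadratic.
  exact: lreg_braid.
by apply: hmul_inj; rewrite -hmulA hmul_hinv hmul1 hmulr1.
Qed.

End HeckeAlgebra.

(** * Perfect involutions *)

Section ParabolicInvolutions.
Variable J : {set gT}.
Hypothesis JS : J \subset S.

Section PerfectInvolutions.
Local Open Scope group_scope.
Implicit Types (a : gT) (z : ext gT).

(* The conjugation action [z r z^-1] of [z] in [W_J^+]. *)
Definition zact z r : gT := z.1 * z.2 r * z.1^-1.

Lemma zactE z r : zact z r = (z.2 r) ^ z.1^-1.
Proof. by rewrite conjgE invgK mulgA. Qed.

Lemma zact_mul z r : zact z r * z.1 = z.1 * z.2 r.
Proof. exact: mulgKV. Qed.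

Lemma TJ_mulgg r : r \in TJ J -> r * r = 1.
Proof. by move/(TJ_T JS)/T_mulgg. Qed.

Lemma TJ_invg r : r \in TJ J -> r^-1 = r.
Proof. by move/(TJ_T JS)/T_invg. Qed.

Lemma TJ_conjgK r a : r \in TJ J -> (a ^ r) ^ r = a.
Proof. by move=> rJ; rewrite -conjgM TJ_mulgg // conjg1. Qed.

Lemma emul_einj z r : emul (emul (einj r) z) (einj r) = (r * z.1 * z.2 r, z.2).
Proof. by rewrite /emul /= perm1 mulg1 mul1g. Qed.

Lemma emul_einj_four z r :
  {in <<J>> &, {morph z.2 : a b / a * b}} -> {in <<J>>, forall a, z.2 a \in <<J>>} ->
  z.2 * z.2 = 1 -> z.1 \in <<J>> -> z.2 z.1 = z.1^-1 -> r \in <<J>> ->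
  let u := emul z (einj r) in
  emul u (emul u (emul u u)) = (zact z r * r * (zact z r * r), 1).
Proof.
move=> autM aut_in aut2 zJ zV rJ u.
have autK a : z.2 (z.2 a) = a by rewrite -permM aut2 perm1.
have uE : u = (z.1 * z.2 r, z.2) by rewrite /u /emul /= mul1g.
have u2 : emul u u = (zact z r * r, 1).
  by rewrite uE /emul /= aut2 autM ?aut_in // zV autK mulgA.
have rJ2 := aut_in r rJ.
have zrJ : zact z r * r \in <<J>> by rewrite /zact !groupM ?groupV.
rewrite u2 {2}uE {2}/emul /= mul1g uE /emul /= aut2.
by rewrite (autM _ _ (groupM zJ rJ2) (aut_in _ zrJ)) (autM _ _ zJ rJ2) zV !autK !mulgA.
Qed.

Section OneInvolution.
Variable z : ext gT.
Hypothesis zI : z \in IJ J.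

Let z_ext_perfect : in_ext (WJ J) J z /\ perfect (TJ J) z.
Proof. by move: zI; rewrite inE => /andP. Qed.

Let z_involution : emul z z = eone gT.
Proof. by case: z_ext_perfect => _ /andP [/eqP]. Qed.

Lemma IJ_mem : z.1 \in <<J>>. Proof. by case: z_ext_perfect => /and3P []. Qed.

Lemma IJ_Aut : z.2 \in Aut <<J>>. Proof. by case: z_ext_perfect => /and3P []. Qed.

Lemma IJ_aut_sqr : z.2 * z.2 = 1. Proof. by case: z_involution. Qed.

Lemma IJ_autK : involutive z.2.
Proof. by move=> a; rewrite -permM IJ_aut_sqr perm1. Qed.

Lemma IJ_aut_mem : z.2 z.1 = z.1^-1.
Proof.
by apply/eqP; rewrite eq_sym eq_invg_mul; case: z_involution => ->.
Qed.

Lemma IJ_autM : {in <<J>> &, {morph z.2 : a b / a * b}}.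
Proof. by move=> a b aJ bJ; apply: (morphicP (Aut_morphic IJ_Aut)). Qed.

Lemma IJ_autV a : a \in <<J>> -> z.2 a^-1 = (z.2 a)^-1.
Proof. by move=> aJ; rewrite -!(autmE IJ_Aut) morphV. Qed.

Lemma IJ_autJ a b : a \in <<J>> -> b \in <<J>> -> z.2 (a ^ b) = z.2 a ^ z.2 b.
Proof. by move=> aJ bJ; rewrite -!(autmE IJ_Aut) morphJ. Qed.

Lemma IJ_aut1 : z.2 1 = 1.
Proof. by rewrite -(autmE IJ_Aut) morph1. Qed.

Lemma IJ_aut_in a : a \in <<J>> -> z.2 a \in <<J>>.
Proof. by move=> aJ; apply: (@Aut_closed _ <<J>>%G _ IJ_Aut). Qed.

Lemma IJ_aut_J s : s \in J -> z.2 s \in J.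
Proof. by case: z_ext_perfect => /and3P [_ _ /eqP zJ] _ sJ; rewrite -zJ imset_f. Qed.

Lemma IJ_aut_TJ r : r \in TJ J -> z.2 r \in TJ J.
Proof.
case/TJP=> w [s [wJ sJ ->]]; rewrite (IJ_autJ (mem_gen sJ) wJ).
by rewrite TJ_conj ?IJ_aut_in // TJ_gen // IJ_aut_J.
Qed.

Lemma zact_in a : a \in <<J>> -> zact z a \in <<J>>.
Proof. by move=> aJ; rewrite zactE groupJ ?groupV ?IJ_mem // IJ_aut_in. Qed.

Lemma zactM a b : a \in <<J>> -> b \in <<J>> -> zact z (a * b) = zact z a * zact z b.
Proof. by move=> aJ bJ; rewrite !zactE IJ_autM // conjMg. Qed.

Lemma zactK a : a \in <<J>> -> zact z (zact z a) = a.
Proof.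
move=> aJ; rewrite !zactE IJ_autJ ?groupV ?IJ_mem ?IJ_aut_in //.
by rewrite IJ_autV ?IJ_mem // IJ_aut_mem invgK IJ_autK conjgK.
Qed.

Lemma zactJ a b : a \in <<J>> -> b \in <<J>> -> zact z (a ^ b) = zact z a ^ zact z b.
Proof.
move=> aJ bJ; rewrite !zactE IJ_autJ // -!conjgM; congr (_ ^ _).
by rewrite conjgE invgK !mulgA mulVg mul1g.
Qed.

Lemma zact_TJ r : r \in TJ J -> zact z r \in TJ J.
Proof. by move=> rJ; rewrite zactE TJ_conj ?groupV ?IJ_mem // IJ_aut_TJ. Qed.

Lemma zact_commute r : r \in TJ J -> r * zact z r = zact z r * r.
Proof.
move=> rJ; case: z_ext_perfect => _ /andP [_ /forall_inP /(_ r rJ) /eqP].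
rewrite emul_einj_four ?IJ_mem ?IJ_aut_mem ?IJ_aut_sqr ?TJ_sub //; last first.
- exact: IJ_aut_in.
- exact: IJ_autM.
case=> /eqP; rewrite -eq_invg_mul invMg !TJ_invg ?zact_TJ //.
by move/eqP.
Qed.

Lemma zact_conj r : r \in TJ J -> zact z r ^ r = zact z r.
Proof. by move=> rJ; rewrite conjgE -(zact_commute rJ) mulKg. Qed.

Lemma conj_zact r : r \in TJ J -> r ^ zact z r = r.
Proof. by move=> rJ; rewrite conjgE (zact_commute rJ) mulKg. Qed.

Lemma inversion_aut w r : w \in <<J>> -> r \in <<J>> -> N (z.2 w) (z.2 r) = N w r.
Proof.
move=> wJ; move: w wJ r; apply: gen_indl => [r _|s w sJ wJ IH r rJ].
  by rewrite IJ_aut1 !inversion1.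
have sW : s \in <<J>> := mem_gen sJ.
rewrite IJ_autM // !inversionM -IJ_autJ // IH ?groupJ //.
rewrite (inversion_gen _ (subsetP JS _ sJ)).
by rewrite (inversion_gen _ (subsetP JS _ (IJ_aut_J sJ))) (inj_eq perm_inj).
Qed.

Lemma inversion_zact r : r \in <<J>> -> N z.1 (zact z r) = N z.1 r.
Proof. by move=> rJ; rewrite zactE -inversionV -IJ_aut_mem inversion_aut ?IJ_mem. Qed.

Lemma vconj_TJ r : r \in TJ J -> vconj r z = (r * zact z r * z.1, z.2).
Proof.
move=> rJ; rewrite /vconj -IJ_autV ?TJ_sub // TJ_invg //.
by rewrite -[r * zact z r * _]mulgA zact_mul mulgA.
Qed.

Lemma vconj_emul r : r \in TJ J -> emul (emul (einj r) z) (einj r) = vconj r z.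
Proof. by move=> rJ; rewrite emul_einj vconj_TJ // -mulgA -zact_mul mulgA. Qed.

Lemma vconj_fix r : r \in TJ J -> (vconj r z == z) = (zact z r == r).
Proof.
move=> rJ; rewrite vconj_TJ // [X in _ == X]surjective_pairing xpair_eqE.
rewrite eqxx andbT -[X in _ == X]mul1g (inj_eq (mulIg _)).
by rewrite -eq_invg_mul TJ_invg // eq_sym.
Qed.

Lemma vconj_zact r : r \in TJ J -> vconj (zact z r) z = vconj r z.
Proof.
by move=> rJ; rewrite !vconj_TJ ?zact_TJ // zactK ?TJ_sub // zact_commute.
Qed.

(* [r] and its conjugate are commuting reflections, and multiplying by one does
   not affect whether the other is an inversion. *)
Lemma inversion_zact_mul r : r \in TJ J -> zact z r != r ->
  N (zact z r * z.1) r = N z.1 r.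
Proof.
move=> rJ moved; rewrite inversionM conj_zact // inversion_commute //.
- by rewrite (TJ_T JS) ?zact_TJ.
- by rewrite eq_sym.
exact: conj_zact.
Qed.

Lemma vconj_up r : r \in TJ J -> zact z r != r -> N z.1 r = false ->
  ((ell z.1).+1 < ell (vconj r z).1)%N.
Proof.
move=> rJ moved nr; rewrite vconj_TJ //= -mulgA.
have up_zr : (ell z.1 < ell (zact z r * z.1))%N.
  by apply: inversion_up; rewrite ?(TJ_T JS) ?zact_TJ // inversion_zact ?TJ_sub.
apply: leq_ltn_trans up_zr _; apply: inversion_up; rewrite ?(TJ_T JS) //.
by rewrite inversion_zact_mul.
Qed.

Lemma vconj_down r : r \in TJ J -> zact z r != r -> N z.1 r ->
  ((ell (vconj r z).1).+1 < ell z.1)%N.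
Proof.
move=> rJ moved nr; rewrite vconj_TJ //= -mulgA.
have down_zr : (ell (zact z r * z.1) < ell z.1)%N.
  by apply: inversion_ltn; rewrite inversion_zact ?TJ_sub.
apply: leq_trans down_zr; rewrite ltnS; apply: inversion_ltn.
by rewrite inversion_zact_mul.
Qed.

Lemma ell_vconj_up s : s \in J -> zact z s != s -> N z.1 s = false ->
  ell (z.1 * z.2 s) = (ell z.1).+1 /\ ell (vconj s z).1 = (ell z.1).+2.
Proof.
move=> sJ moved ns; have sS := subsetP JS s sJ; have tS := subsetP JS _ (IJ_aut_J sJ).
have := vconj_up (TJ_gen sJ) moved ns.
rewrite /vconj /= (simple_invg tS) -mulgA (ell_mull _ sS) (ell_mulr _ tS).
by move: (ell z.1) (N _ _) (N _ _) => k [] [] /= lt_k; split; move: lt_k; clear; lia.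
Qed.

Lemma inversion_vconj g r : g \in <<J>> -> r \in <<J>> ->
  N (vconj g z).1 r = N g r (+) (N z.1 (r ^ g) (+) N g^-1 (zact z (r ^ g))).
Proof.
move=> gJ rJ; rewrite /vconj /= -mulgA !inversionM -IJ_autV //.
congr (_ (+) (_ (+) _)); have rgJ : r ^ g \in <<J>> by rewrite groupJ.
rewrite -[RHS]inversion_aut ?groupV ?zact_in // zactE IJ_autJ ?groupV ?IJ_mem ?IJ_aut_in //.
by rewrite (IJ_autV IJ_mem) IJ_aut_mem invgK IJ_autK.
Qed.

Lemma vconj_mem g : g \in <<J>> -> (vconj g z).1 \in <<J>>.
Proof. by move=> gJ; rewrite /= !groupM ?groupV ?IJ_aut_in ?IJ_mem. Qed.

Lemma zact_vconj g r : g \in <<J>> -> r \in <<J>> ->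
  zact (vconj g z) r = zact z (r ^ g) ^ g^-1.
Proof.
move=> gJ rJ; rewrite !zactE /= IJ_autJ // -!conjgM; congr (_ ^ _).
by rewrite !invMg invgK mulgA.
Qed.

Lemma vconj_aut_mem g : g \in <<J>> -> z.2 (vconj g z).1 = (vconj g z).1^-1.
Proof.
move=> gJ; rewrite /= !IJ_autM ?groupM ?groupV ?IJ_aut_in ?IJ_mem //.
by rewrite (IJ_autV (IJ_aut_in gJ)) IJ_autK IJ_aut_mem !invMg invgK mulgA.
Qed.

Lemma vconj_IJ g : g \in <<J>> -> vconj g z \in IJ J.
Proof.
move=> gJ; rewrite inE; apply/andP; split.
  case: z_ext_perfect => /and3P [_ zA zJ] _; apply/and3P; split=> //.
  exact: vconj_mem.
apply/andP; split.
  by rewrite /emul -[(vconj g z).2]/(z.2) vconj_aut_mem // mulgV IJ_aut_sqr.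
apply/forall_inP => r rJ /=; have rgJ : r ^ g \in TJ J by rewrite TJ_conj.
have rW := TJ_sub rJ.
rewrite (@emul_einj_four (vconj g z)) ?vconj_mem ?vconj_aut_mem ?IJ_aut_sqr //.
- rewrite (zact_vconj gJ rW) /eone xpair_eqE eqxx andbT -{2 4}(conjgK g r).
  rewrite -!conjMg -{1}zact_commute // mulgA -(mulgA (r ^ g)) TJ_mulgg ?zact_TJ //.
  by rewrite mulg1 TJ_mulgg // conj1g.
- exact: IJ_autM.
exact: IJ_aut_in.
Qed.

End OneInvolution.

Lemma vconj1 z : z \in IJ J -> vconj 1 z = z.
Proof. by move=> zI; rewrite /vconj IJ_aut1 // invg1 mul1g mulg1 -surjective_pairing. Qed.

Lemma vconjM u v z : z \in IJ J -> u \in <<J>> -> v \in <<J>> ->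
  vconj (u * v) z = vconj u (vconj v z).
Proof. by move=> zI uJ vJ; rewrite /vconj /= IJ_autM // invMg !mulgA. Qed.

Lemma vconjK r z : z \in IJ J -> r \in TJ J -> vconj r (vconj r z) = z.
Proof. by move=> zI rJ; rewrite -vconjM ?TJ_sub // TJ_mulgg // vconj1. Qed.

Definition fixers z : {set gT} := [set s in J | zact z s == s].

Lemma fixers_sub z : fixers z \subset J.
Proof. by apply/subsetP => s; rewrite inE => /andP []. Qed.

Lemma fixers_mem z : {subset <<fixers z>> <= <<J>>}.
Proof. exact/subsetP/genS/fixers_sub. Qed.

Lemma fixers_zact z r : z \in IJ J -> r \in <<fixers z>> -> zact z r = r.
Proof.
move=> zI; move: r; apply: gen_indl => [|s r sF rF IH].
  by rewrite /zact IJ_aut1 // mulg1 mulgV.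
rewrite (zactM zI (fixers_mem (mem_gen sF)) (fixers_mem rF)) IH.
by move: sF; rewrite inE => /andP [_ /eqP ->].
Qed.

Lemma fixers_vconj z u : z \in IJ J -> u \in <<fixers z>> -> vconj u z = z.
Proof.
move=> zI; move: u; apply: gen_indl => [|s u sF uF IH]; first exact: vconj1.
rewrite (vconjM zI (fixers_mem (mem_gen sF)) (fixers_mem uF)) IH; apply/eqP.
by move: sF; rewrite inE => /andP [sJ fix_s]; rewrite vconj_fix // TJ_gen.
Qed.

Lemma fixers_inversionJ z u r : z \in IJ J -> u \in <<fixers z>> -> r \in <<J>> ->
  N z.1 (r ^ u) = N z.1 r.
Proof.
move=> zI uF rJ; have uJ := fixers_mem uF.
have := inversion_vconj zI uJ rJ; rewrite fixers_vconj //.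
suff -> : N u^-1 (zact z (r ^ u)) = N u r.
  by case: (N u r); case: (N _ (r ^ u)); case: (N _ r).
have uVF : u^-1 \in <<fixers z>> by rewrite groupV.
have fix_inv p : N u^-1 p -> zact z p = p.
  have FS := subset_trans (fixers_sub z) JS.
  by move/(inversion_TJ FS uVF)/TJ_sub/fixers_zact; apply.
have ruJ : r ^ u \in <<J>> by rewrite groupJ.
rewrite -{2}(conjgK u r) -inversionV; apply/idP/idP => n_ru.
  by have := fix_inv _ n_ru; rewrite zactK // => ->.
by rewrite fix_inv.
Qed.

Lemma elenE z : z \in IJ J -> elen J z = ell z.1.
Proof. by move=> zI; rewrite /elen len_parabolic ?IJ_mem. Qed.

Lemma mem_zclass z : z \in IJ J -> z \in zclass J z.
Proof. by move=> zI; apply/imsetP; exists 1; rewrite ?group1 ?vconj1. Qed.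

Lemma zclass_vconj v z : z \in IJ J -> v \in <<J>> -> zclass J (vconj v z) = zclass J z.
Proof.
move=> zI vJ; apply/setP => y; apply/imsetP/imsetP => [[u uJ ->]|[u uJ ->]].
  by exists (u * v); [apply: groupM | rewrite vconjM].
have uvJ : u * v^-1 \in <<J>> by rewrite groupM ?groupV.
by exists (u * v^-1); rewrite // -vconjM // mulgKV.
Qed.

Definition minimal z : bool := [forall s in J, N z.1 s ==> (zact z s == s)].

Section MinimalInvolution.
Variable z : ext gT.
Hypotheses (zI : z \in IJ J) (zmin : minimal z).

Let FS : fixers z \subset S := subset_trans (fixers_sub z) JS.

Lemma minimal_desc s : s \in J -> N z.1 s -> s \in fixers z.
Proof. by move=> sJ ns; rewrite inE sJ (implyP (forall_inP zmin s sJ)). Qed.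

Lemma minimal_fixers : z.1 \in <<fixers z>>.
Proof.
case: (cosetV_decomp FS z.1) => u [v [uF vVF z1E]].
have [v1|v1] := eqVneq v 1; first by rewrite z1E v1 mulg1.
have vJ : v \in <<J>>.
  by rewrite -(groupMl _ (fixers_mem uF)) -z1E; apply: IJ_mem.
have [s sJ ns] := desc_exists JS vJ v1.
suff sF : s \in fixers z.
  by move/(WJupP FS): vVF => /(_ s sF); rewrite invgK ns.
have sW := mem_gen sJ; have uVF : u^-1 \in <<fixers z>> by rewrite groupV.
have := fixers_inversionJ zI uVF sW; rewrite {1}z1E inversionM conjgKV ns addbT.
case nu: (N u _); last by move/esym; apply: minimal_desc.
move=> _; have sFW : s \in <<fixers z>>.
  by rewrite -(conjgKV u s) groupJ // (TJ_sub (inversion_TJ FS uF nu)).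
by rewrite inE sJ (fixers_zact zI sFW) eqxx.
Qed.

Lemma minimal_inversion_fixed r : N z.1 r -> zact z r = r.
Proof.
by move/(inversion_TJ FS minimal_fixers)/TJ_sub; apply: fixers_zact.
Qed.

End MinimalInvolution.

Lemma minimal_conj_inversion z g s : z \in IJ J -> g \in <<J>> ->
  minimal z -> minimal (vconj g z) -> s \in J -> zact z s != s ->
  N g^-1 (zact z s) = N g^-1 s.
Proof.
move=> zI gJ zmin gz_min sJ moved; have gzI := vconj_IJ zI gJ.
have gVJ : g^-1 \in <<J>> by rewrite groupV.
have sgW := groupJ (mem_gen sJ) gVJ.
have := inversion_vconj zI gJ sgW; rewrite conjgKV -inversionV.
have -> : N z.1 s = false.
  by apply: contraNF moved => /(minimal_inversion_fixed zI zmin) ->.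
have -> : N (vconj g z).1 (s ^ g^-1) = false.
  apply: contraNF moved => /(minimal_inversion_fixed gzI gz_min).
  by rewrite zact_vconj // conjgKV => /conjg_inj ->.
by case: (N _ s); case: (N _ _).
Qed.

Lemma minimal_unique z g : z \in IJ J -> g \in <<J>> ->
  minimal z -> minimal (vconj g z) -> vconj g z = z.
Proof.
move=> zI gJ zmin gz_min.
case: (@arg_minnP _ g [pred h | (h \in <<J>>) && (vconj h z == vconj g z)] ell).
  by rewrite /= gJ eqxx.
move=> h /andP [hJ /eqP hg] h_short; rewrite -hg in gz_min *.
have [->|h1] := eqVneq h 1; first exact: vconj1.
have shortest u : u \in <<J>> -> vconj u z = z -> (ell h <= ell (h * u))%N.
  by move=> uJ uz; apply: h_short; rewrite inE groupM //= vconjM // uz hg.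
have [s sJ ns] : exists2 s, s \in J & N h^-1 s.
  by apply: (desc_exists JS); rewrite ?groupV ?eq_invg1.
have sS := subsetP JS s sJ; have sW := mem_gen sJ; have sT := TJ_gen sJ.
have lt_hs : (ell (h * s) < ell h)%N by rewrite -inversionV_desc.
have moved : zact z s != s.
  apply: contraL lt_hs => fixed; rewrite -leqNgt shortest //.
  by apply/eqP; rewrite vconj_fix.
have rJ := zact_TJ zI sT; have rW := TJ_sub rJ.
have := shortest _ (groupM sW rW); rewrite vconjM // vconj_zact // vconjK //.
move=> /(_ erefl); rewrite leqNgt => /negP []; apply: ltn_trans lt_hs.
rewrite mulgA -(ell_inv (h * s * _)) -(ell_inv (h * s)) (invMg (h * s)) (TJ_invg rJ).
apply: inversion_ltn; rewrite invMg (simple_invg sS) inversionM (inversion_gen _ sS).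
by rewrite (negPf moved) zact_conj // minimal_conj_inversion.
Qed.

End PerfectInvolutions.

(** * Bruhat orders *)

Lemma connect_indl (X : finType) (e : rel X) (P : X -> Prop) z :
  P z -> (forall x y, e x y -> connect e y z -> P y -> P x) ->
  forall x, connect e x z -> P x.
Proof.
move=> Pz PS x /connectP [p]; elim: p x => [|y p IH] x /=; first by move=> _ <-.
case/andP=> xy yp zE; apply: (PS x y) => //; last exact: IH.
by apply/connectP; exists p.
Qed.

Section BruhatOrders.
Local Open Scope group_scope.
Implicit Types (x y z : ext gT).

Definition bruhat_edge v w : bool :=
  [exists t in T S, (w == v * t) && (ell v < ell w)%N].

Definition qbruhat_edge y z : bool := [&& y \in IJ J, z \in IJ J &
  [exists t in TJ J, (z == emul (emul (einj t) y) (einj t)) && (elen J y < elen J z)%N]].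

Local Notation bruhat_le := (connect bruhat_edge).
Local Notation qbruhat_le := (connect qbruhat_edge).

Lemma bruhat_edgeP v w : bruhat_edge v w ->
  exists r, [/\ r \in T S, w = r * v & N v r = false].
Proof.
case/exists_inP=> t tT /andP [/eqP -> lt_v]; exists (t ^ v^-1).
have rT : t ^ v^-1 \in T S by rewrite T_conj.
have rv : t ^ v^-1 * v = v * t by rewrite conjgE invgK !mulgA mulgKV.
split=> //; rewrite inversionE // rv.
by apply/negbTE; rewrite -leqNgt ltnW.
Qed.

Lemma bruhat_edge_refl r v : r \in T S -> N v r = false -> bruhat_edge v (r * v).
Proof.
move=> rT nr; apply/exists_inP; exists (r ^ v); first by rewrite T_conj.
by rewrite conjgE mulKVg eqxx inversion_up.
Qed.

Lemma bruhat_edge_mull s w : s \in S -> N w s = false -> bruhat_edge w (s * w).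
Proof. by move=> sS; apply: bruhat_edge_refl; apply: T_gen. Qed.

Lemma bruhat_edge_mulr t w : t \in S -> N w^-1 t = false -> bruhat_edge w (w * t).
Proof.
move=> tS nw; have -> : w * t = t ^ w^-1 * w by rewrite conjgE invgK !mulgA mulgKV.
by apply: bruhat_edge_refl; rewrite ?T_conj ?T_gen // -inversionV.
Qed.

Lemma bruhat_edge_desc t w : t \in S -> N w^-1 t -> bruhat_edge (w * t) w.
Proof.
move=> tS nw; have := @bruhat_edge_mulr t (w * t) tS; rewrite simple_mulgK //; apply.
by rewrite inversion_mulsr // nw.
Qed.

Lemma bruhat_edge_liftl s v w : s \in S -> bruhat_edge v w ->
  bruhat_edge (s * v) (s * w) \/ w = s * v.
Proof.
move=> sS /bruhat_edgeP [r [rT -> nr]]; have [->|rs] := eqVneq r s; first by right.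
left; have -> : s * (r * v) = r ^ s * (s * v).
  by rewrite conjgE (simple_invg sS) -!mulgA simple_mulKg.
apply: bruhat_edge_refl; first by rewrite T_conj.
rewrite inversionM (inversion_gen _ sS) -conjgM simple_mulgg // conjg1 nr addbF.
have ss : s ^ s = s by rewrite conjgE mulKg.
by rewrite -{2}ss (inj_eq (@conjg_inj _ s)) (negPf rs).
Qed.

Lemma bruhat_edge_liftr t v w : t \in S -> bruhat_edge v w ->
  bruhat_edge (v * t) (w * t) \/ w = v * t.
Proof.
move=> tS /bruhat_edgeP [r [rT -> nr]]; have [rt|rt] := eqVneq (r ^ v) t.
  by right; rewrite -rt conjgE mulKVg.
left; rewrite -mulgA; apply: bruhat_edge_refl => //.
by rewrite inversionM nr (inversion_gen _ tS) (negPf rt).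
Qed.

Lemma bruhat_lift s v w : s \in S -> N w s = false ->
  bruhat_le v w -> bruhat_le (s * v) (s * w).
Proof.
move=> sS nw; move: v; apply: connect_indl => [|v v' vv' v'w IH]; first exact: connect0.
case: (bruhat_edge_liftl sS vv') => [svv'|v'E].
  exact: connect_trans (connect1 svv') IH.
rewrite -v'E; apply: connect_trans v'w (connect1 _).
exact: bruhat_edge_mull.
Qed.

(* The lifting property: if [t] is a right descent of [w] but not of [v], then
   [v <= w] implies [v <= w t]. *)
Lemma bruhat_lift_desc t v w : t \in S -> N w^-1 t -> N v^-1 t = false ->
  bruhat_le v w -> bruhat_le v (w * t).
Proof.
move=> tS nw nv vw.
suff : if N v^-1 t then bruhat_le (v * t) (w * t) else bruhat_le v (w * t) by rewrite nv.
move: v vw {nv}; apply: connect_indl; first by rewrite nw connect0.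
move=> v v' vv' _; case nv': (N v'^-1 t) => IH; case nv: (N v^-1 t).
- case: (bruhat_edge_liftr tS vv') => [vv't|v'E].
    exact: connect_trans (connect1 vv't) IH.
  by move: nv'; rewrite v'E inversion_mulsr // nv.
- case: (bruhat_edge_liftr tS vv') => [vv't|v'E].
    apply: connect_trans (connect1 (bruhat_edge_mulr tS nv)) _.
    exact: connect_trans (connect1 vv't) IH.
  by move: IH; rewrite {1}v'E simple_mulgK.
- apply: connect_trans (connect1 (bruhat_edge_desc tS nv)) _.
  exact: connect_trans (connect1 vv') IH.
exact: connect_trans (connect1 vv') IH.
Qed.

Lemma bruhat_le_ell v w : bruhat_le v w -> v != w -> ell v < ell w.
Proof.
move: v; apply: connect_indl => [|v v' vv' _ IH _]; first by rewrite eqxx.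
have lt_v : ell v < ell v' by case/exists_inP: vv' => t _ /andP [].
by have [<-//|/IH] := eqVneq v' w; apply: ltn_trans.
Qed.

Lemma bruhat_lt_trans u v w : bruhat_le u v -> bruhat_le v w ->
  (u != v) || (v != w) -> bruhat_lt S u w.
Proof.
move=> uv vw ne; apply/andP; split; last exact: connect_trans uv vw.
apply: contraTneq ne => uw; rewrite -{}uw in vw *; rewrite [v == u]eq_sym orbb negbK.
apply: contraT => uv_ne; have := bruhat_le_ell vw; rewrite eq_sym => /(_ uv_ne).
by rewrite ltnNge ltnW // bruhat_le_ell.
Qed.

Lemma qbruhat_edgeP y z : qbruhat_edge y z -> [/\ y \in IJ J, z \in IJ J &
  exists r, [/\ r \in TJ J, z = vconj r y, zact y r != r & N y.1 r = false]].
Proof.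
case/and3P=> yI zI /exists_inP [r rJ /andP [/eqP zE lt_y]].
rewrite vconj_emul // in zE; rewrite !elenE // in lt_y.
have moved : zact y r != r.
  by rewrite -vconj_fix // -zE; apply: contraTneq lt_y => ->; rewrite ltnn.
split=> //; exists r; split=> //; apply: contraTF lt_y => nr.
by rewrite -leqNgt zE; apply/ltnW/ltnW/vconj_down.
Qed.

Lemma qbruhat_edge_vconj y r : y \in IJ J -> r \in TJ J -> zact y r != r ->
  N y.1 r = false -> qbruhat_edge y (vconj r y).
Proof.
move=> yI rJ moved nr; have zI := vconj_IJ yI (TJ_sub rJ).
apply/and3P; split=> //; apply/exists_inP; exists r => //.
by rewrite vconj_emul // eqxx !elenE //; apply/ltnW/vconj_up.
Qed.

Lemma qbruhat_edge_lift s y z : s \in J -> qbruhat_edge y z ->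
  qbruhat_edge (vconj s y) (vconj s z) \/ z = vconj s y.
Proof.
move=> sJ /qbruhat_edgeP [yI zI [r [rJ zE moved nr]]].
have sS := subsetP JS s sJ; have sW := mem_gen sJ; have sT := TJ_gen sJ.
have ss : s ^ s = s by rewrite conjgE mulKg.
have [rs|rs] := eqVneq r s; first by right; rewrite zE rs.
have [r's|r's] := eqVneq (zact y r) s; first by right; rewrite zE -vconj_zact // r's.
left; have rsJ : r ^ s \in TJ J by rewrite TJ_conj.
have -> : vconj s z = vconj (r ^ s) (vconj s y).
  rewrite zE -(vconjM yI sW (TJ_sub rJ)) -(vconjM yI (TJ_sub rsJ) sW); congr vconj.
  by rewrite conjgE (simple_invg sS) -!mulgA simple_mulgg // mulg1.
apply: qbruhat_edge_vconj => //; first exact: vconj_IJ.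
  rewrite (zact_vconj yI sW (TJ_sub rsJ)) TJ_conjgK // (simple_invg sS).
  by rewrite (inj_eq (@conjg_inj _ s)).
rewrite (inversion_vconj yI sW (TJ_sub rsJ)) TJ_conjgK // nr (simple_invg sS).
rewrite !(inversion_gen _ sS) (negPf r's) addbF -[X in _ == X]ss.
by rewrite (inj_eq (@conjg_inj _ s)) (negPf rs).
Qed.

Lemma qbruhat_lift s y z : s \in J -> z \in IJ J -> zact z s != s ->
  N z.1 s = false -> qbruhat_le y z -> qbruhat_le (vconj s y) (vconj s z).
Proof.
move=> sJ zI moved nz; move: y; apply: connect_indl => [|y y' yy' y'z IH].
  exact: connect0.
case: (qbruhat_edge_lift sJ yy') => [syy'|y'E].
  exact: connect_trans (connect1 syy') IH.
rewrite -y'E; apply: connect_trans y'z (connect1 _).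
by apply: qbruhat_edge_vconj => //; apply: TJ_gen.
Qed.

Lemma qbruhat_le_elen y z : qbruhat_le y z -> y != z -> (elen J y < elen J z)%N.
Proof.
move: y; apply: connect_indl => [|y y' yy' _ IH _]; first by rewrite eqxx.
have lt_y : (elen J y < elen J y')%N.
  by case/and3P: yy' => _ _ /exists_inP [t _ /andP []].
by have [<-//|/IH] := eqVneq y' z; apply: ltn_trans.
Qed.

Lemma qbruhat_lt_trans x y z :
  qbruhat_lt J x y -> qbruhat_lt J y z -> qbruhat_lt J x z.
Proof.
move=> /andP [xy_ne xy] /andP [yz_ne yz]; apply/andP; split; last first.
  exact: connect_trans xy yz.
have := ltn_trans (qbruhat_le_elen xy xy_ne) (qbruhat_le_elen yz yz_ne).
by apply: contraTneq => ->; rewrite ltnn.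
Qed.

Implicit Types (rho tau ups : gT * ext gT).

Definition pair_lt ups tau : bool :=
  bruhat_lt S ups.1 tau.1 || ((ups.1 == tau.1) && qbruhat_lt J ups.2 tau.2).

Lemma pair_lt_trans ups rho tau : pair_lt ups rho -> pair_lt rho tau -> pair_lt ups tau.
Proof.
case/orP=> [ur|/andP [/eqP ur q_ur]]; case/orP=> [rt|/andP [/eqP rt q_rt]]; apply/orP.
- left; case/andP: ur => ur_ne ur; case/andP: rt => _ rt.
  by apply: (bruhat_lt_trans ur rt); rewrite ur_ne.
- by left; rewrite -rt.
- by left; rewrite ur.
by right; rewrite ur rt eqxx (qbruhat_lt_trans q_ur q_rt).
Qed.

Lemma pair_lt_mull s v w y z : s \in S -> N w s = false ->
  pair_lt (v, y) (w, z) -> pair_lt (s * v, y) (s * w, z).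
Proof.
move=> sS nw; case/orP=> [/andP [/= vw_ne vw]|/andP [/eqP /= -> yz]]; apply/orP.
  by left; rewrite /bruhat_lt (inj_eq (mulgI s)) vw_ne; apply: bruhat_lift.
by right; rewrite eqxx.
Qed.

Lemma pair_lt_up s v w y y' z : s \in S -> N w s = false -> v != w ->
  pair_lt (v, y) (w, z) -> pair_lt (v, y') (s * w, z).
Proof.
move=> sS nw vw_ne; case/orP=> [/andP [_ vw]|/andP [/eqP /= vw]]; last first.
  by rewrite vw eqxx in vw_ne.
apply/orP; left; apply: (bruhat_lt_trans vw); last by rewrite vw_ne.
exact/connect1/bruhat_edge_mull.
Qed.

Lemma pair_lt_fiber s v w y z z' : s \in S -> v \in WJup S J -> w \in WJup S J ->
  N w s = false -> s * v \in WJup S J -> s * w \notin WJup S J ->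
  pair_lt (v, y) (w, z) -> pair_lt (s * v, y) (w, z').
Proof.
move=> sS vK wK nw svK swK; case/orP=> [/andP [_ vw]|/andP [/eqP /= vw]]; last first.
  by rewrite -vw svK in swK.
have [tJ _] := deodhar JS wK sS swK; set t := _ * s * _ in tJ.
have tS := subsetP JS _ tJ; have tT := TJ_gen tJ.
have swt : s * w = w * t by rewrite /t !mulgA mulgV mul1g.
have := bruhat_lift sS nw vw; rewrite /= swt => svw.
have nwt : N (w * t)^-1 t by rewrite inversion_mulsr // (WJup_no_inversion JS wK).
have nsv : N (s * v)^-1 t = false by rewrite (WJup_no_inversion JS svK).
have := bruhat_lift_desc tS nwt nsv svw; rewrite simple_mulgK // => sv_w.
apply/orP; left; apply/andP; split=> //; apply: contraNneq swK => /= <-.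
by rewrite simple_mulKg.
Qed.

Lemma pair_lt_vconj v w y z r t : r \in TJ J -> t \in J -> y \in IJ J -> z \in IJ J ->
  (v == w -> r = t) -> zact z t != t -> N z.1 t = false ->
  pair_lt (v, y) (w, z) -> pair_lt (v, vconj r y) (w, vconj t z).
Proof.
move=> rJ tJ yI zI rt moved nt; case/orP=> [vw|/andP [vw /andP [/= yz_ne yz]]]; apply/orP.
  by left.
right; rewrite vw (rt vw) /=; apply/andP; split; last exact: qbruhat_lift.
by apply: contraNneq yz_ne => e; rewrite -(vconjK yI (TJ_gen tJ)) e vconjK ?TJ_gen.
Qed.

End BruhatOrders.

(** * The module of perfect involutions *)

Section InvolutionModules.
Local Open Scope group_scope.
Variables (R : comNzRingType) (q : R) (a : gT -> R).
Hypothesis a_quadratic : forall r, (a r * a r = 1 + q * a r)%R.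
Hypothesis a_conj : {in <<J>>%g &, forall r g, a (r ^ g)%g = a r}.

Definition IJt : finType := {z : ext gT | z \in IJ J}.
Local Notation M := {ffun IJt -> R^o}.
Local Notation delta := (@delta R _).
Implicit Types (x y : IJt) (f : M).

Definition iconj v x : IJt := insubd x (vconj v (val x)).
Definition ilen x : nat := ell (val x).1.
Definition iop s : {linear M -> M} := hecke_op q (iconj s) ilen (fun=> a s).
#[global] Arguments iop : simpl never.

Section GeneratorAction.

Lemma mem_IJt x : val x \in IJ J. Proof. exact: valP. Qed.

Lemma val_iconj v x : v \in <<J>> -> val (iconj v x) = vconj v (val x).
Proof. by move=> vJ; rewrite val_insubd vconj_IJ ?mem_IJt. Qed.

Lemma iconj1 x : iconj 1 x = x.
Proof. by apply: val_inj; rewrite val_iconj ?group1 // vconj1 ?mem_IJt. Qed.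

Lemma iconjM u v x : u \in <<J>> -> v \in <<J>> -> iconj (u * v) x = iconj u (iconj v x).
Proof.
by move=> uJ vJ; apply: val_inj; rewrite !val_iconj ?groupM // vconjM ?mem_IJt.
Qed.

Lemma iconjK s : s \in J -> involutive (iconj s).
Proof.
move=> sJ x; rewrite -iconjM ?mem_gen // simple_mulgg ?iconj1 //.
exact: (subsetP JS).
Qed.

Lemma iconj_fix s x : s \in J -> (iconj s x == x) = (zact (val x) s == s).
Proof.
move=> sJ; rewrite -(inj_eq val_inj) val_iconj ?mem_gen //.
by rewrite vconj_fix ?mem_IJt // TJ_gen.
Qed.

Lemma ilen_up s x : s \in J -> zact (val x) s != s -> N (val x).1 s = false ->
  (ilen x < ilen (iconj s x))%N.
Proof.
move=> sJ moved ns; rewrite /ilen val_iconj ?mem_gen //.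
exact/ltnW/vconj_up/ns/moved/TJ_gen/sJ/mem_IJt.
Qed.

Lemma ilen_down s x : s \in J -> zact (val x) s != s -> N (val x).1 s ->
  (ilen (iconj s x) < ilen x)%N.
Proof.
move=> sJ moved ns; rewrite /ilen val_iconj ?mem_gen //.
exact/ltnW/vconj_down/ns/moved/TJ_gen/sJ/mem_IJt.
Qed.

Lemma iconj_desc s x : s \in J -> zact (val x) s != s ->
  (ilen (iconj s x) < ilen x)%N = N (val x).1 s.
Proof.
move=> sJ moved; apply/idP/idP => [lt_x|]; last exact: ilen_down.
by apply/negPn/negP => /negPf /(ilen_up sJ moved); rewrite ltnNge ltnW.
Qed.

Lemma zact_iconj u x s : u \in <<J>> -> s \in <<J>> ->
  zact (val (iconj u x)) s = zact (val x) (s ^ u) ^ u^-1.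
Proof. by move=> uJ sJ; rewrite val_iconj // zact_vconj ?mem_IJt. Qed.

Lemma zact_iconj_simple s x : s \in J ->
  (zact (val (iconj s x)) s == s) = (zact (val x) s == s).
Proof.
by move=> sJ; rewrite -(iconj_fix (iconj s x) sJ) -(iconj_fix x sJ) (iconjK sJ) eq_sym.
Qed.

End GeneratorAction.

Local Open Scope ring_scope.

Lemma iop_quadratic s f : s \in J -> iop s (iop s f) = f + q *: iop s f.
Proof. by move=> sJ; apply: hecke_op_quadratic => [|x _]; first exact: iconjK. Qed.

Lemma iop_fixed s x : s \in J -> zact (val x) s = s ->
  iop s (delta x) = a s *: delta x.
Proof.
move=> sJ fixed; rewrite /iop hecke_op_level //; congr ilen.
by apply/eqP; rewrite iconj_fix // fixed.
Qed.

Lemma iop_moved s x : s \in J -> zact (val x) s != s ->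
  iop s (delta x) =
  delta (iconj s x) + (if N (val x).1 s then q else 0) *: delta x.
Proof.
move=> sJ moved; rewrite /iop; case: ifP => ns.
  by rewrite hecke_op_down // ilen_down.
by rewrite hecke_op_up ?ilen_up // scale0r addr0.
Qed.

Lemma iop_up s x : s \in J -> zact (val x) s != s -> N (val x).1 s = false ->
  iop s (delta x) = delta (iconj s x).
Proof. by move=> sJ moved ns; rewrite iop_moved // ns scale0r addr0. Qed.

(** * Dihedral orbits of perfect involutions *)

Section DihedralOrbit.
Variables (s t : gT) (x0 : IJt).
Hypotheses (sJ : s \in J) (tJ : t \in J).
Local Notation I := [set s; t].
Local Notation z0 := (val x0).
Local Notation k := #[s * t]%g.
Hypothesis x0_min : {in I, forall b, (ilen x0 <= ilen (iconj b x0))%N}.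

Let sS : s \in S := subsetP JS s sJ.
Let tS : t \in S := subsetP JS t tJ.
Let IS : I \subset S := pair_sub sS tS.
Let IJ_sub : I \subset J := pair_sub sJ tJ.
Let x0I : z0 \in IJ J := mem_IJt x0.
Let sI : s \in I := set21 s t.
Let tI : t \in I := set22 s t.

Let simpleJ b : b \in I -> b \in J. Proof. exact: (subsetP IJ_sub). Qed.
Let memJ g : g \in <<I>> -> g \in <<J>>. Proof. exact: (subsetP (genS IJ_sub)). Qed.
Let reflJ r : r \in TJ I -> r \in TJ J. Proof. exact: TJ_mono. Qed.
Let simple_mem b : b \in I -> b \in <<J>>. Proof. by move/simpleJ/mem_gen. Qed.
Let refl_mem r : r \in TJ I -> r \in <<J>>. Proof. by move/reflJ/TJ_sub. Qed.

Definition braid_at x : Prop :=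
  altop (iop s) (iop t) k (delta x) = altop (iop t) (iop s) k (delta x).

Lemma min_no_inversion b : b \in I -> zact z0 b != b -> N z0.1 b = false.
Proof.
move=> bI moved; rewrite -iconj_desc ?simpleJ //.
by apply/negbTE; rewrite -leqNgt x0_min.
Qed.

Section SmallOrbit.
Variable A : {set IJt}.
Hypothesis A_closed : {in I & A, forall b x, iconj b x \in A}.
Hypothesis x0A : x0 \in A.

Lemma dihedral_orbit_sub u : u \in <<I>> -> iconj u x0 \in A.
Proof.
move: u; apply: gen_indl => [|b u bI uI IH]; first by rewrite iconj1.
by rewrite iconjM ?(memJ uI) ?simple_mem // A_closed.
Qed.

Lemma iop_supported b f : b \in I -> supported A f -> supported A (iop b f).
Proof. by move=> bI; apply: hecke_op_supported => x; apply: A_closed. Qed.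

Lemma braid_at_commuting u : ~~ odd k -> u \in <<I>> ->
  {in A, forall x, iop s (iop t (delta x)) = iop t (iop s (delta x))} ->
  braid_at (iconj u x0).
Proof.
move=> k_even uI comm; apply: (altop_commute (P := supported A)) => //.
- by move=> m; apply: iop_supported.
- by move=> m; apply: iop_supported.
- move=> m mA; pose f : {linear M -> M} := iop s \o iop t.
  pose g : {linear M -> M} := iop t \o iop s.
  exact: (linear_supported_ext (f := f) (g := g) mA).
exact/supported_delta/dihedral_orbit_sub.
Qed.

Lemma braid_at_equal u : u \in <<I>> ->
  {in A, forall x, iop s (delta x) = iop t (delta x)} -> braid_at (iconj u x0).
Proof.
move=> uI same; apply: (altop_same (P := supported A)) => [m|m mA|].
- exact: iop_supported.
- exact: (linear_supported_ext mA).
exact/supported_delta/dihedral_orbit_sub.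
Qed.

End SmallOrbit.

Lemma braid_both_fixed u : zact z0 s = s -> zact z0 t = t -> u \in <<I>> ->
  braid_at (iconj u x0).
Proof.
move=> fix_s fix_t uI; have fixI b : b \in I -> iconj b x0 = x0.
  by move=> bI; apply/eqP; rewrite iconj_fix ?simpleJ //; case/set2P: bI => ->;
    rewrite ?fix_s ?fix_t.
have A_closed : {in I & [set x0], forall b x, iconj b x \in [set x0]}.
  by move=> b x bI; rewrite !inE => /eqP ->; rewrite fixI.
have iop_s : iop s (delta x0) = a s *: delta x0 by apply: iop_fixed.
have iop_t : iop t (delta x0) = a t *: delta x0 by apply: iop_fixed.
have [k_odd|k_even] := boolP (odd k); last first.
  apply: (braid_at_commuting A_closed) => // [|x]; rewrite !inE // => /eqP ->.
  by rewrite iop_s iop_t !linearZ /= iop_s iop_t !scalerA mulrC.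
apply: (braid_at_equal A_closed) => // [|x]; rewrite !inE // => /eqP ->.
rewrite iop_s iop_t; congr (_ *: _).
rewrite -(altw_conj k_odd (simple_invg sS) (simple_invg tS)) ?braid_altw //.
by rewrite a_conj //; [apply: mem_gen | apply: mem_altw].
Qed.

Definition swapping : Prop :=
  exists2 r, r \in TJ I & (zact z0 r \in TJ I) /\ zact z0 r != r.

(* The product of [r] and its conjugate is the longest element of the dihedral
   group and fixes [z0]; comparing inversion sets, [z0] permutes [T_I]. *)
Lemma swapping_stable : swapping -> {in TJ I, forall r, zact z0 r \in TJ I}.
Proof.
case=> r rI [r'I moved] p pI; have rJ := reflJ rI; have comm := zact_commute x0I rJ.
have [|_ cent all_inv _] := commuting_reflections sS tS rI r'I _ comm.
  by rewrite eq_sym.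
set c := (r * zact z0 r)%g in cent all_inv.
have cI : c \in <<I>> by rewrite groupM // TJ_sub.
have fix_c : vconj c z0 = z0.
  by rewrite (vconjM x0I) ?TJ_sub ?zact_TJ // (vconj_zact x0I rJ) vconjK.
have pc : (p ^ c = p)%g by rewrite conjgE cent ?TJ_sub // mulKg.
have cV : (c^-1 = c)%g by rewrite invMg !(TJ_invg) ?zact_TJ // -comm.
have := inversion_vconj x0I (memJ cI) (refl_mem pI).
rewrite fix_c pc (all_inv p pI) cV => eq_n.
have : N c (zact z0 p) by move: eq_n; case: (N z0.1 p); case: (N c _).
exact: (inversion_TJ IS cI).
Qed.

Lemma swapping_center b : swapping -> b \in I -> zact z0 b != b ->
  [/\ (b * zact z0 b = altw s t k)%g,
      {in <<I>>, forall g, g * (b * zact z0 b) = b * zact z0 b * g}%g & ~~ odd k].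
Proof.
move=> sp bI moved; have bT : b \in TJ I := TJ_gen bI.
have comm := zact_commute x0I (reflJ bT).
have [|cE cent _ k_even] := commuting_reflections sS tS bT (swapping_stable sp bT) _ comm.
  by rewrite eq_sym.
by [].
Qed.

Lemma braid_swapping_fixed u : swapping -> zact z0 s = s -> zact z0 t != t ->
  u \in <<I>> -> braid_at (iconj u x0).
Proof.
move=> sp fix_s moved_t uI; have [_ cent k_even] := swapping_center sp tI moved_t.
pose x1 := iconj t x0; pose A := [set x0; x1].
have fix_s1 : zact (val x1) s = s.
  rewrite zact_iconj ?simple_mem // zactJ ?simple_mem // fix_s.
  rewrite -conjgM (simple_invg tS) conjgE -(zact_commute x0I (TJ_gen tJ)).
  by rewrite cent ?mem_gen // mulKg.
have fixA x : x \in A -> zact (val x) s = s by case/set2P=> ->.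
have A_closed : {in I & A, forall b x, iconj b x \in A}.
  move=> b x /set2P [] -> xA.
    by have /eqP -> : iconj s x == x by rewrite iconj_fix ?fixA.
  by case/set2P: xA => ->; rewrite ?iconjK // !inE eqxx ?orbT.
have x0A : x0 \in A by rewrite set21.
have iop_s f : supported A f -> iop s f = a s *: f.
  move=> fA; pose scale : {linear M -> M} := a s \*: idfun.
  by apply: (linear_supported_ext (g := scale) fA) => x xA; apply/iop_fixed/fixA.
apply: (braid_at_commuting A_closed) => // x xA.
have dA : supported A (delta x) := supported_delta R xA.
by rewrite (iop_s _ dA) linearZ /= (iop_s _ (iop_supported A_closed tI dA)).
Qed.

Lemma braid_swapping_moved u : swapping -> zact z0 s != s -> zact z0 t != t ->
  u \in <<I>> -> braid_at (iconj u x0).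
Proof.
move=> sp moved_s moved_t uI; pose x1 := iconj t x0; pose A := [set x0; x1].
have [sE _ _] := swapping_center sp sI moved_s.
have [tE _ _] := swapping_center sp tI moved_t.
have st_x0 : iconj s x0 = x1.
  apply: val_inj; rewrite !val_iconj ?simple_mem //.
  by rewrite !(vconj_TJ x0I) ?TJ_gen // sE tE.
have A_closed : {in I & A, forall b x, iconj b x \in A}.
  by move=> b x /set2P [] -> /set2P [] ->; rewrite ?st_x0 -?[in iconj s x1]st_x0 ?iconjK //
    !inE eqxx ?orbT.
have iop_s : iop s (delta x0) = delta x1.
  by rewrite (iop_up sJ moved_s (min_no_inversion sI moved_s)) st_x0.
have iop_t : iop t (delta x0) = delta x1.
  exact: iop_up tJ moved_t (min_no_inversion tI moved_t).
apply: (braid_at_equal A_closed) => // [|x /set2P [] ->]; first exact: set21.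
  by rewrite iop_s iop_t.
rewrite -[in LHS]iop_s (iop_quadratic _ sJ) -[in RHS]iop_t (iop_quadratic _ tJ).
by rewrite iop_s iop_t.
Qed.

Section GenericOrbit.
Hypothesis not_swapping : {in TJ I, forall r, zact z0 r \in TJ I -> zact z0 r = r}.
Hypothesis moved_t : zact z0 t != t.

Lemma generic_inversion r : r \in TJ I -> N z0.1 r -> r = s /\ zact z0 s = s.
Proof.
move=> rI nr; have nt := min_no_inversion tI moved_t.
have [fix_s|moved_s] := eqVneq (zact z0 s) s; last first.
  by rewrite (no_inversion_pair sS tS (min_no_inversion sI moved_s) nt rI) in nr.
have [ns|] := boolP (N z0.1 s); last first.
  by move=> /negPf ns; rewrite (no_inversion_pair sS tS ns nt rI) in nr.
have sF : s \in <<fixers z0>> by rewrite mem_gen // inE sJ fix_s eqxx.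
split=> //; apply/eqP; move: nr; rewrite -[z0.1](simple_mulKg _ sS) inversionM.
rewrite (inversion_gen _ sS) (@no_inversion_pair s t) ?addbF ?inversion_mulsl ?ns //.
  rewrite inversionM (inversion_gen _ sS) fixers_inversionJ ?simple_mem // nt addbF.
  by apply: contraNF moved_t => /eqP ->; rewrite fix_s.
by rewrite TJ_conj // mem_gen.
Qed.

Lemma generic_inversion_vconj g r : g \in <<I>> -> r \in TJ I ->
  N (vconj g z0).1 r =
  N z0.1 (r ^ g) (+) (N g r && (zact z0 (r ^ g)%g != (r ^ g)%g)).
Proof.
move=> gI rI; rewrite (inversion_vconj x0I (memJ gI) (refl_mem rI)).
have nV : N g^-1%g (r ^ g) = N g r by rewrite inversionV conjgK.
have [fix_rg|moved_rg] := eqVneq (zact z0 (r ^ g)) (r ^ g)%g.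
  by rewrite fix_rg nV andbF addbF addbCA addbb addbF.
have [n_zrg|] := boolP (N g^-1%g (zact z0 (r ^ g))); last first.
  by rewrite addbF andbT addbC.
have zrgI := inversion_TJ IS (groupVr gI) n_zrg.
by rewrite not_swapping ?TJ_conj ?eqxx in moved_rg.
Qed.

Lemma generic_fixed_inversion r p : r \in TJ I -> zact z0 r = r ->
  p \in TJ I -> N r p -> zact z0 p = p.
Proof.
move=> rI fix_r pI np; apply/eqP/negPn/negP => moved_p.
have rJ := reflJ rI; have rW := TJ_sub rI; have rV := TJ_invg rJ.
have prI : (p ^ r)%g \in TJ I by rewrite TJ_conj.
have := generic_inversion_vconj rW prI; rewrite TJ_conjgK // moved_p andbT.
have /eqP -> : vconj r z0 == z0 by rewrite vconj_fix // fix_r.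
have -> : N z0.1 p = false.
  by apply/negP => /(generic_inversion pI) [ps fix_s]; rewrite ps fix_s eqxx in moved_p.
have -> : N r (p ^ r)%g by rewrite -{1}rV inversionV rV TJ_conjgK.
move=> /(generic_inversion prI) [prs fix_s]; case/negP: moved_p; apply/eqP.
by rewrite -(TJ_conjgK p rJ) prs (zactJ x0I (simple_mem sI) (refl_mem rI)) fix_s fix_r.
Qed.

Lemma generic_fixed r : r \in TJ I -> zact z0 r = r -> r = s /\ zact z0 s = s.
Proof.
move=> rI fix_r; have fixed_inv := generic_fixed_inversion rI fix_r.
have rW := TJ_sub rI; have rT := TJ_T IS rI.
have nrt : N r t = false.
  by apply/negP => /(fixed_inv t (TJ_gen tI)) fix_t; move: moved_t; rewrite fix_t eqxx.
have r1 : r != 1%g by apply: contraTneq (inversion_refl rT) => ->; rewrite inversion1.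
have nrs : N r s.
  by have [b /set2P [] -> //] := desc_exists IS rW r1; rewrite nrt.
have fix_s : zact z0 s = s by apply: fixed_inv; rewrite ?TJ_gen.
split=> //; apply/eqP/negPn/negP => rs.
have sr1 : (s * r != 1)%g.
  by apply: contra rs => /eqP sr; rewrite -(simple_mulKg r sS) sr mulg1.
have srI : (s * r)%g \in <<I>> by rewrite groupM // mem_gen.
have nt : N (s * r)%g t.
  by have [b /set2P [] -> //] := desc_exists IS srI sr1; rewrite inversion_mulsl // nrs.
have tsI : (t ^ s)%g \in TJ I by rewrite TJ_conj ?TJ_gen // mem_gen.
have moved_ts : zact z0 (t ^ s) != (t ^ s)%g.
  by rewrite zactJ ?simple_mem // fix_s (inj_eq (conjg_inj s)).
have ts_s : ((t ^ s)%g == s) = false.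
  by apply: contraNF moved_ts => /eqP ->; rewrite fix_s.
case/negP: moved_ts; apply/eqP/fixed_inv => //; rewrite -[r](simple_mulKg _ sS).
by rewrite inversionM (inversion_gen _ sS) ts_s -conjgM simple_mulgg // conjg1 nt.
Qed.

Definition generic_coef u : R :=
  if (zact z0 s == s) && N u^-1%g s then a s else 1.

Definition generic_image u : M :=
  if u \in <<I>> then generic_coef u *: delta (iconj u x0) else 0.

(* The image of [H_u] is [H_u M_x0]: along the dihedral orbit heights follow the
   length of [u], so this intertwines the regular module with [iop]. *)
Definition generic_map : {linear {ffun gT -> R^o} -> M} := linear_lift generic_image.
#[local] Arguments generic_map : simpl never.

Lemma generic_mapE u : generic_map (delta u) = generic_image u.
Proof. exact: linear_lift_delta. Qed.

Section OneStep.
Variables b u : gT.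
Hypotheses (bI : b \in I) (uI : u \in <<I>>).

Let bJ : b \in <<J>> := simple_mem bI.
Let uJ : u \in <<J>> := memJ uI.
Let buI : (b * u)%g \in <<I>>. Proof. by rewrite groupM // mem_gen. Qed.
Let buT : (b ^ u)%g \in TJ I. Proof. by rewrite TJ_conj ?TJ_gen. Qed.
Let iconj_bu : iconj (b * u) x0 = iconj b (iconj u x0).
Proof. exact: iconjM. Qed.
Let fixed_bu : (zact (val (iconj u x0)) b == b) = (zact z0 (b ^ u) == (b ^ u)%g).
Proof.
by rewrite zact_iconj // -[X in _ == X](conjgK u b) (inj_eq (conjg_inj _)).
Qed.
Let inversion_bu :
  N (b * u)^-1%g s = N u^-1%g s (+) ((s ^ u^-1)%g == b).
Proof.
have bS := subsetP IS b bI.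
by rewrite invMg inversionM (simple_invg bS) (inversion_gen _ bS).
Qed.

Lemma generic_step_fixed : zact z0 (b ^ u) = (b ^ u)%g ->
  iop b (generic_image u) =
  generic_image (b * u)%g + (if N u b then q else 0) *: generic_image u.
Proof.
move=> fix_bu; have [bu_s fix_s] := generic_fixed buT fix_bu.
have su_b : (s ^ u^-1)%g = b by rewrite -bu_s conjgK.
have fix_b : zact (val (iconj u x0)) b = b by apply/eqP; rewrite fixed_bu fix_bu.
have b_fix : iconj b (iconj u x0) = iconj u x0.
  by apply/eqP; rewrite iconj_fix ?simpleJ // fix_b.
have ab : a b = a s by rewrite -su_b a_conj ?groupV //; apply: simple_mem.
have nub : N u b = N u^-1%g s by rewrite inversionV su_b.
rewrite /generic_image uI buI iconj_bu b_fix linearZ /= iop_fixed ?simpleJ //.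
rewrite ab nub /generic_coef inversion_bu fix_s su_b !eqxx /=.
case: (N u^-1%g s); rewrite /= ?scale1r ?scale0r ?addr0 //.
by rewrite !scalerA a_quadratic scalerDl scale1r.
Qed.

Lemma generic_step_moved : zact z0 (b ^ u) != (b ^ u)%g ->
  iop b (generic_image u) =
  generic_image (b * u)%g + (if N u b then q else 0) *: generic_image u.
Proof.
move=> moved_bu; have moved_b : zact (val (iconj u x0)) b != b by rewrite fixed_bu.
have nx : N (val (iconj u x0)).1 b = N u b.
  rewrite val_iconj // generic_inversion_vconj ?TJ_gen // moved_bu andbT.
  case E: (N _ (b ^ u)%g) => //; have [bu_s fix_s] := generic_inversion buT E.
  by rewrite bu_s fix_s eqxx in moved_bu.
have coef_bu : generic_coef (b * u)%g = generic_coef u.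
  rewrite /generic_coef inversion_bu; case: eqP => //= fix_s.
  rewrite (_ : ((s ^ u^-1)%g == b) = false) ?addbF //.
  by apply: contraNF moved_bu => /eqP <-; rewrite conjgKV fix_s.
rewrite /generic_image uI buI coef_bu linearZ /= iop_moved ?simpleJ // nx -iconj_bu.
by rewrite scalerDr !scalerA mulrC.
Qed.

End OneStep.

Lemma generic_intertwine b h : b \in I -> generic_map (lreg q b h) = iop b (generic_map h).
Proof.
move=> bI; pose f : {linear {ffun gT -> R^o} -> M} := generic_map \o lreg q b.
pose g : {linear {ffun gT -> R^o} -> M} := iop b \o generic_map.
apply: (linear_delta_ext (f := f) (g := g)) => u.
rewrite -[f _]/(generic_map (lreg q b (delta u))) -[g _]/(iop b (generic_map (delta u))).
rewrite lregE ?(subsetP IS) // linearD linearZ !generic_mapE.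
have [uI|uI] := boolP (u \in <<I>>); last first.
  rewrite /generic_image (groupMl _ (mem_gen bI)) (negPf uI).
  by rewrite linear0 [X in 0 + X]scaler0 addr0.
have [fix_bu|moved_bu] := eqVneq (zact z0 (b ^ u)) (b ^ u)%g.
  by rewrite generic_step_fixed.
by rewrite generic_step_moved.
Qed.

Lemma braid_generic u : u \in <<I>> -> braid_at (iconj u x0).
Proof.
move=> uI; rewrite /braid_at.
have [v ->] : exists v, delta (iconj u x0) = generic_map (delta v).
  case E: ((zact z0 s == s) && N u^-1%g s); last first.
    by exists u; rewrite generic_mapE /generic_image uI /generic_coef E scale1r.
  have /andP [fix_s nu] := E; exists (u * s)%g.
  rewrite generic_mapE /generic_image /generic_coef (groupM uI (mem_gen sI)).
  rewrite inversion_mulsr // nu andbF scale1r (iconjM _ (memJ uI) (simple_mem sI)).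
  by congr (delta (iconj u _)); apply/esym/eqP; rewrite iconj_fix.
by apply: (altop_regular_image (q := q) (pi := generic_map)) => // h;
  apply: generic_intertwine.
Qed.

End GenericOrbit.

Lemma braid_moved u : zact z0 t != t -> u \in <<I>> -> braid_at (iconj u x0).
Proof.
move=> moved_t uI.
have [/exists_inP [r rI /andP [zrI moved_r]]|/exists_inPn not_swapping] :=
  boolP [exists r in TJ I, (zact z0 r \in TJ I) && (zact z0 r != r)].
  have sp : swapping by exists r.
  have [fix_s|moved_s] := eqVneq (zact z0 s) s; first exact: braid_swapping_fixed.
  exact: braid_swapping_moved.
apply: braid_generic => // r rI zrI; apply/eqP.
by have := not_swapping r rI; rewrite zrI /= negbK.
Qed.

End DihedralOrbit.

Lemma iop_braid s t : s \in J -> t \in J ->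
  altop (iop s) (iop t) #[s * t]%g =1 altop (iop t) (iop s) #[s * t]%g.
Proof.
move=> sJ tJ; apply: linear_delta_ext => x /=.
have IJ_mem g : g \in <<[set s; t]>> -> g \in <<J>>.
  exact: subsetP (genS (pair_sub sJ tJ)) g.
case: (@arg_minnP _ 1%g (mem <<[set s; t]>>) (fun u => ilen (iconj u x))) => /=.
  exact: group1.
move=> v vI v_min; pose x0 := iconj v x.
have -> : x = iconj v^-1 x0 by rewrite /x0 -iconjM ?groupV ?IJ_mem // mulVg iconj1.
have vVI : v^-1%g \in <<[set s; t]>> by rewrite groupV.
have x0_min : {in [set s; t], forall b, (ilen x0 <= ilen (iconj b x0))%N}.
  move=> b bI; have bW : b \in <<[set s; t]>> := mem_gen bI.
  by rewrite /x0 -iconjM ?IJ_mem // v_min // groupM.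
have [fix_t|moved_t] := eqVneq (zact (val x0) t) t; last exact: braid_moved.
have [fix_s|moved_s] := eqVneq (zact (val x0) s) s; first exact: braid_both_fixed.
rewrite setUC in vVI x0_min; rewrite -order_mulgC ?(subsetP JS) //.
exact/esym/(braid_moved tJ sJ x0_min).
Qed.

(** * The induced module *)

Local Notation K := (KJt S J).
Local Notation V := {ffun K -> R^o}.
Local Notation H := {ffun gT -> R^o}.
Implicit Types (tau : gT * ext gT) (i j : K) (m : V).

Section OrbitAction.
Local Open Scope group_scope.

Lemma KJE tau : (tau \in KJ S J) = (tau.1 \in WJup S J) && (tau.2 \in IJ J).
Proof. by rewrite inE. Qed.

Lemma KJP i : (val i).1 \in WJup S J /\ (val i).2 \in IJ J.
Proof. by apply/andP; rewrite -KJE; apply: valP. Qed.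

Lemma KJ_pair w z : w \in WJup S J -> z \in IJ J -> (w, z) \in KJ S J.
Proof. by move=> wK zI; rewrite KJE wK zI. Qed.

Lemma sact_up s tau : s * tau.1 \in WJup S J -> sact S J s tau = (s * tau.1, tau.2).
Proof. by rewrite /sact => ->. Qed.

Lemma sact_stay s tau : tau \in KJ S J -> s \in S -> s * tau.1 \notin WJup S J ->
  [/\ tau.1^-1 * s * tau.1 \in J, N tau.1 s = false
    & sact S J s tau = (tau.1, vconj (tau.1^-1 * s * tau.1) tau.2)].
Proof.
rewrite KJE => /andP [wK zI] sS swK; have [tJ nw] := deodhar JS wK sS swK.
by split=> //; rewrite /sact (negPf swK) vconj_emul // TJ_gen.
Qed.

Lemma sact_KJ s tau : tau \in KJ S J -> s \in S -> sact S J s tau \in KJ S J.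
Proof.
move=> tauK sS; have := tauK; rewrite KJE => /andP [wK zI].
have [swK|swK] := boolP (s * tau.1 \in WJup S J); first by rewrite sact_up // KJ_pair.
have [tJ _ ->] := sact_stay tauK sS swK.
by apply: KJ_pair => //; apply: vconj_IJ; rewrite ?mem_gen.
Qed.

Lemma sactK s tau : tau \in KJ S J -> s \in S -> sact S J s (sact S J s tau) = tau.
Proof.
move=> tauK sS; have := tauK; rewrite KJE => /andP [wK zI].
have [swK|swK] := boolP (s * tau.1 \in WJup S J).
  by rewrite (sact_up swK) /sact /= simple_mulKg // wK [RHS]surjective_pairing.
have [tJ _ e] := sact_stay tauK sS swK; have := sact_KJ tauK sS; rewrite e => tauK'.
have [_ _ ->] := sact_stay tauK' sS swK.
by rewrite /= vconjK ?TJ_gen // -surjective_pairing.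
Qed.

Definition kact s i : K := insubd i (sact S J s (val i)).

(* Twice the height, up to a constant on each orbit. *)
Definition kheight i : nat := ((ell (val i).1).*2 + ell (val i).2.1)%N.

Definition keigen s i : R := a ((val i).1^-1 * s * (val i).1).

Lemma val_kact s i : s \in S -> val (kact s i) = sact S J s (val i).
Proof. by move=> sS; rewrite val_insubd sact_KJ //; apply: valP. Qed.

Lemma kactK s : s \in S -> involutive (kact s).
Proof.
by move=> sS i; apply: val_inj; rewrite !val_kact // sactK //; apply: valP.
Qed.

Lemma len_zmin_sact s tau : tau \in KJ S J -> s \in S ->
  len_zmin J (sact S J s tau).2 = len_zmin J tau.2.
Proof.
move=> tauK sS; have := tauK; rewrite KJE => /andP [_ zI].
have [swK|swK] := boolP (s * tau.1 \in WJup S J); first by rewrite sact_up.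
have [tJ _ ->] := sact_stay tauK sS swK.
by rewrite /len_zmin zclass_vconj ?mem_gen.
Qed.

Lemma htE i :
  ht S J (val i) = (((kheight i)%:R - (len_zmin J (val i).2)%:R) / 2%:R :> rat)%R.
Proof.
have [_ zI] := KJP i; rewrite /ht elenE // /kheight natrD -muln2 natrM.
by field.
Qed.

Lemma ht_kact s i : s \in S ->
  ((ht S J (val i) < ht S J (val (kact s i)))%R = (kheight i < kheight (kact s i))%N) *
  ((ht S J (val (kact s i)) < ht S J (val i))%R = (kheight (kact s i) < kheight i)%N).
Proof.
move=> sS; rewrite !htE val_kact // (len_zmin_sact (valP i) sS).
by rewrite !ltr_pM2r ?invr_gt0 ?ltr0n // !ltrD2r !ltr_nat.
Qed.

End OrbitAction.

Definition kop s : {linear V -> V} := hecke_op q (kact s) kheight (keigen s).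
#[global] Arguments kop : simpl never.

Lemma kop_quadratic s m : s \in S -> kop s (kop s m) = m + q *: kop s m.
Proof.
by move=> sS; apply: hecke_op_quadratic => [|i _]; [apply: kactK | apply: a_quadratic].
Qed.

Section CosetEmbedding.

Definition kpair w (wK : w \in WJup S J) x : K := Sub (w, val x) (KJ_pair wK (mem_IJt x)).

Definition kinv i : IJt := Sub (val i).2 (KJP i).2.

Definition coset_emb w : {linear M -> V} :=
  linear_lift (fun x => oapp delta 0 (insub (w, val x) : option K)).
#[global] Arguments coset_emb : simpl never.

Lemma coset_emb_delta w (wK : w \in WJup S J) x :
  coset_emb w (delta x) = delta (kpair wK x).
Proof.
rewrite [LHS]linear_lift_delta.
by rewrite (insubT (fun tau => tau \in KJ S J) (KJ_pair wK (mem_IJt x))).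
Qed.

Lemma delta_coset_emb i : delta i = coset_emb (val i).1 (delta (kinv i)).
Proof.
rewrite (coset_emb_delta (KJP i).1); congr (delta _); apply: val_inj.
by rewrite !SubK -surjective_pairing.
Qed.

Lemma kheight_kpair w (wK : w \in WJup S J) x :
  kheight (kpair wK x) = ((ell w).*2 + ilen x)%N.
Proof. by rewrite /kheight SubK. Qed.

Lemma kop_coset_up s w f : s \in S -> w \in WJup S J -> (s * w)%g \in WJup S J ->
  kop s (coset_emb w f) =
  coset_emb (s * w)%g f + (if N w s then q else 0) *: coset_emb w f.
Proof.
move=> sS wK swK; set c := if _ then _ else _.
pose lhs : {linear M -> V} := kop s \o coset_emb w.
pose rhs : {linear M -> V} := coset_emb (s * w)%g \+ c \*: coset_emb w.
apply: (linear_delta_ext (f := lhs) (g := rhs)) => x.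
rewrite -[lhs _]/(kop s (coset_emb w (delta x))).
rewrite -[rhs _]/(coset_emb (s * w)%g (delta x) + c *: coset_emb w (delta x)).
rewrite (coset_emb_delta wK) (coset_emb_delta swK) /kop.
have kactE : kact s (kpair wK x) = kpair swK x.
  by apply: val_inj; rewrite val_kact // sact_up SubK.
have lt_height : (kheight (kpair swK x) < kheight (kpair wK x))%N = N w s.
  by rewrite !kheight_kpair ltn_add2r ltn_double inversion_desc.
rewrite /c; case: ifP => nw; first by rewrite hecke_op_down kactE // lt_height.
rewrite scale0r addr0 hecke_op_up kactE // ltn_neqAle leqNgt lt_height nw andbT.
by rewrite !kheight_kpair eqn_add2r (inj_eq double_inj) eq_sym ell_mull_neq.
Qed.

Lemma kop_coset_stay s w f : s \in S -> w \in WJup S J -> (s * w)%g \notin WJup S J ->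
  kop s (coset_emb w f) = coset_emb w (iop (w^-1 * s * w)%g f).
Proof.
move=> sS wK swK; have [tJ _] := deodhar JS wK sS swK; set t := (_ * s * _)%g in tJ *.
pose lhs : {linear M -> V} := kop s \o coset_emb w.
pose rhs : {linear M -> V} := coset_emb w \o iop t.
apply: (linear_delta_ext (f := lhs) (g := rhs)) => x.
rewrite -[lhs _]/(kop s (coset_emb w (delta x))) -[rhs _]/(coset_emb w (iop t (delta x))).
have kactE : kact s (kpair wK x) = kpair wK (iconj t x).
  apply: val_inj; rewrite val_kact // !SubK val_iconj ?mem_gen //.
  by have [_ _ ->] := sact_stay (KJ_pair wK (mem_IJt x)) sS swK.
rewrite (coset_emb_delta wK) /kop /iop !hecke_opE /hecke_step kactE.
rewrite !kheight_kpair !ltn_add2l /keigen SubK -/t.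
case: ifP => _; first by rewrite (coset_emb_delta wK).
case: ifP => _; last by rewrite linearZ (coset_emb_delta wK).
rewrite -2!(coset_emb_delta wK) [RHS]linearD; congr (_ + _).
by rewrite [RHS]linearZ_LR.
Qed.

End CosetEmbedding.

Section Induction.
Variable f : M.
Implicit Types (h : H).

(* [H_(w v) (x) f |-> w (x) H_v f], with [w] in [W^J] and [v] in [W_J]: the braid
   relations on the induced module come from those of the Hecke algebra. *)
Definition induced_image g : V :=
  coset_emb (coset_rep J g) (opW J (fun s => iop s) (coset_rem J g) f).

Definition induced_map : {linear H -> V} := linear_lift induced_image.
#[global] Arguments induced_map : simpl never.

Lemma induced_mapE w v : w \in WJup S J -> v \in <<J>> ->
  induced_map (delta (w * v)%g) = coset_emb w (opW J (fun s => iop s) v f).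
Proof.
move=> wK vJ; rewrite [LHS]linear_lift_delta /induced_image.
by rewrite coset_repE // coset_remE.
Qed.

Lemma induced_intertwine s h : s \in S ->
  induced_map (lreg q s h) = kop s (induced_map h).
Proof.
move=> sS; pose lhs : {linear H -> V} := induced_map \o lreg q s.
pose rhs : {linear H -> V} := kop s \o induced_map.
apply: (linear_delta_ext (f := lhs) (g := rhs)) => g.
rewrite -[lhs _]/(induced_map (lreg q s (delta g))).
rewrite -[rhs _]/(kop s (induced_map (delta g))).
have [w [v [wK vJ ->]]] := coset_decomp JS g.
rewrite lregE // linearD linearZ_LR (induced_mapE wK vJ).
have [swK|swK] := boolP ((s * w)%g \in WJup S J).
  by rewrite mulgA induced_mapE // (inversion_WJup_mul JS wK swK vJ) kop_coset_up.
rewrite kop_coset_stay //; have [tJ nw] := deodhar JS wK sS swK.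
set t := (w^-1 * s * w)%g in tJ *; have swt : (s * (w * v) = w * (t * v))%g.
  by rewrite /t !mulgA mulgV mul1g.
have tvJ : (t * v)%g \in <<J>> by rewrite groupM // mem_gen.
rewrite swt (induced_mapE wK tvJ) inversionM nw addFb conjgE mulgA -/t.
case: ifP => nv; last by rewrite scale0r addr0 (opW_mull JS iop_braid).
by rewrite (opW_desc JS iop_braid f tJ vJ nv) iop_quadratic // linearD linearZ_LR.
Qed.

End Induction.

Lemma kop_braid s t : s \in S -> t \in S ->
  altop (kop s) (kop t) #[s * t]%g =1 altop (kop t) (kop s) #[s * t]%g.
Proof.
move=> sS tS; apply: linear_delta_ext => i /=; have [wK _] := KJP i.
have -> : delta i = induced_map (delta (kinv i)) (delta (val i).1).
  by rewrite -[(val i).1]mulg1 induced_mapE ?group1 // opW1 -delta_coset_emb.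
by apply: (altop_regular_image (q := q) (pi := induced_map _)) => // h;
  apply: induced_intertwine.
Qed.

(** * The order on the basis *)

Section BasisOrder.
Local Open Scope group_scope.
Local Notation refl_at s i := ((val i).1^-1 * s * (val i).1).

Definition kprec j i : bool := prec S J (val j) (val i).

Lemma kprecE j i : kprec j i = [&& same_orbit S J (val j) (val i),
  (ht S J (val j) < ht S J (val i))%R & pair_lt (val j) (val i)].
Proof. by []. Qed.

Lemma kprec_ht j i : kprec j i -> (ht S J (val j) < ht S J (val i))%R.
Proof. by case/and3P. Qed.

Lemma kprec_irr : irreflexive kprec.
Proof. by move=> i; apply/negP => /kprec_ht; rewrite Order.POrderTheory.ltxx. Qed.

Lemma kprec_trans : transitive kprec.
Proof.
move=> j k i; rewrite !kprecE => /and3P [o1 h1 p1] /and3P [o2 h2 p2]; apply/and3P; split.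
- exact: connect_trans o1 o2.
- exact: Order.POrderTheory.lt_trans h1 h2.
exact: pair_lt_trans p1 p2.
Qed.

Lemma same_orbit_kact s i : s \in S -> same_orbit S J (val i) (val (kact s i)).
Proof.
by move=> sS; apply: connect1; apply/exists_inP; exists s => //; rewrite val_kact.
Qed.

Variant kact_ascent s i : gT * ext gT -> Prop :=
  | KactCoset of s * (val i).1 \in WJup S J & N (val i).1 s = false :
      kact_ascent s i (s * (val i).1, (val i).2)
  | KactFiber of s * (val i).1 \notin WJup S J & N (val i).1 s = false
      & refl_at s i \in J
      & zact (val i).2 (refl_at s i) != refl_at s i
      & N (val i).2.1 (refl_at s i) = false :
      kact_ascent s i ((val i).1, vconj (refl_at s i) (val i).2).

Lemma kact_ascentP s i : s \in S -> (kheight i < kheight (kact s i))%N ->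
  kact_ascent s i (val (kact s i)).
Proof.
move=> sS; have [wK zI] := KJP i; rewrite /kheight !val_kact //.
have [swK|swK] := boolP (s * (val i).1 \in WJup S J).
  rewrite (sact_up swK) ltn_add2r ltn_double => lt_w; apply: KactCoset => //.
  by rewrite inversion_desc // ltnNge ltnW.
have [tJ nw ->] := sact_stay (valP i) sS swK; rewrite ltn_add2l => lt_z.
have tT := TJ_gen tJ; have moved : zact (val i).2 (refl_at s i) != refl_at s i.
  by rewrite -vconj_fix //; apply: contraTneq lt_z => ->; rewrite ltnn.
apply: KactFiber => //; apply: contraTF lt_z => nt.
by rewrite -leqNgt; apply/ltnW/ltnW/vconj_down.
Qed.

Lemma kprec_up s i : s \in S -> (kheight i < kheight (kact s i))%N -> kprec i (kact s i).
Proof.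
move=> sS lt_i; have [wK zI] := KJP i; rewrite kprecE same_orbit_kact // ht_kact // lt_i.
case: (kact_ascentP sS lt_i) => [swK nw|swK nw tJ moved nt]; apply/orP.
  left; apply/andP; split; last exact/connect1/bruhat_edge_mull.
  by apply: contraNneq (ell_mull_neq (val i).1 sS) => /= <-.
right; apply/andP; split=> //; apply/andP; split.
  by rewrite eq_sym vconj_fix ?TJ_gen.
exact/connect1/qbruhat_edge_vconj/nt/moved/TJ_gen.
Qed.

Lemma kheight_up s i : s \in S -> (kheight i < kheight (kact s i))%N ->
  kheight (kact s i) = (kheight i).+2.
Proof.
move=> sS lt_i; have [wK zI] := KJP i; rewrite /kheight.
case: (kact_ascentP sS lt_i) => [swK nw|swK nw tJ moved nt].
  by rewrite ell_mull // nw doubleS !addSn.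
by have [_ ->] := ell_vconj_up zI tJ moved nt; rewrite !addnS.
Qed.

Lemma ht_up s i : s \in S -> (kheight i < kheight (kact s i))%N ->
  ht S J (val (kact s i)) = (ht S J (val i) + 1)%R.
Proof.
move=> sS lt_i; rewrite !htE kheight_up // val_kact // (len_zmin_sact (valP i) sS).
by rewrite -addn2 natrD; field.
Qed.

Lemma kprec_lift s j i : s \in S -> kprec j i ->
  (kheight i < kheight (kact s i))%N -> (kheight j < kheight (kact s j))%N ->
  kprec (kact s j) (kact s i).
Proof.
move=> sS; rewrite !kprecE => /and3P [orb lt_ht lt_ji] lt_i lt_j.
have [wiK ziI] := KJP i; have [wjK zjI] := KJP j; apply/and3P; split.
- apply: connect_trans (connect_trans orb (same_orbit_kact i sS)).
  by have := same_orbit_kact (kact s j) sS; rewrite kactK.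
- by rewrite !ht_up // ltrD2r.
move: lt_ji; rewrite {1}[val j]surjective_pairing {1}[val i]surjective_pairing.
case: (kact_ascentP sS lt_i) => [swi ni|swi ni tiJ moved_i nti];
  case: (kact_ascentP sS lt_j) => [swj nj|swj nj tjJ moved_j ntj].
- exact: pair_lt_mull.
- by apply: pair_lt_up => //; apply: contraNneq swj => ->.
- exact: pair_lt_fiber.
by apply: pair_lt_vconj => //; [apply: TJ_gen | move/eqP->].
Qed.

End BasisOrder.

(** * The bar operator *)

Section BarOperator.
Variable bar : {rmorphism R -> R}.
Hypothesis bar_q : bar q = - q.
Hypothesis bar_a : forall r, bar (a r) = a r - q.

Local Notation kop_inv := (inv_op q kop).

(* The action of [bar H_w], that is, of the inverse of [H_(w^-1)]. *)
Definition hbar w : {linear V -> V} := opW S (fun s => kop_inv s) w.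
#[global] Arguments hbar : simpl never.

Section InverseAction.

Let kop_quadratic_in s : s \in S -> forall m, kop s (kop s m) = m + q *: kop s m.
Proof. by move=> sS m; apply: kop_quadratic. Qed.

Let kop_inv_braid s t : s \in S -> t \in S ->
  altop (kop_inv s) (kop_inv t) #[s * t]%g =1 altop (kop_inv t) (kop_inv s) #[s * t]%g.
Proof. by move=> sS tS; apply: inv_op_braid => // *; apply: kop_braid. Qed.

Lemma kopK s : s \in S -> cancel (kop s) (kop_inv s).
Proof. exact: op_invK. Qed.

Lemma kop_invK s : s \in S -> cancel (kop_inv s) (kop s).
Proof. exact: inv_opK. Qed.

Lemma kop_inv_quadratic s m : s \in S ->
  kop_inv s (kop_inv s m) = m - q *: kop_inv s m.
Proof. exact: inv_op_quadratic. Qed.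

Lemma hbar1 m : hbar 1%g m = m.
Proof. exact: opW1. Qed.

Lemma hbar_mul u v m : ell (u * v)%g = (ell u + ell v)%N ->
  hbar (u * v)%g m = hbar u (hbar v m).
Proof. by move=> uv; apply: (opW_mul (subxx S)) => //; apply: mem_genS. Qed.

Lemma hbar_gen s m : s \in S -> hbar s m = kop_inv s m.
Proof. by move=> sS; apply: (opW_gen (subxx S)). Qed.

Lemma hbar_mull s w m : s \in S -> N w s = false ->
  hbar (s * w)%g m = kop_inv s (hbar w m).
Proof. by move=> sS nw; apply: (opW_mull (subxx S)) => //; apply: mem_genS. Qed.

Lemma hbar_mulr s w m : s \in S -> N w^-1%g s = false ->
  hbar (w * s)%g m = hbar w (kop_inv s m).
Proof. by move=> sS nw; apply: (opW_mulr (subxx S)) => //; apply: mem_genS. Qed.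

Lemma hbar_desc s w m : s \in S -> N w s -> hbar w m = kop_inv s (hbar (s * w)%g m).
Proof. by move=> sS nw; apply: (opW_desc (subxx S)) => //; apply: mem_genS. Qed.

Lemma hbar_mull_desc s w m : s \in S -> N w s -> hbar (s * w)%g m = kop s (hbar w m).
Proof. by move=> sS nw; rewrite (hbar_desc m sS nw) kop_invK. Qed.

End InverseAction.

Lemma kop_base s f : s \in J -> kop s (coset_emb 1%g f) = coset_emb 1%g (iop s f).
Proof.
move=> sJ; rewrite (kop_coset_stay f (subsetP JS s sJ) (WJup1 JS)).
  by rewrite invg1 mul1g mulg1.
by rewrite mulg1 simple_notin_WJup.
Qed.

Lemma kop_base_fixed s x : s \in J -> zact (val x) s = s ->
  kop s (coset_emb 1%g (delta x)) = a s *: coset_emb 1%g (delta x).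
Proof. by move=> sJ fixed; rewrite kop_base // iop_fixed // linearZ_LR. Qed.

Lemma kop_inv_base_fixed s x : s \in J -> zact (val x) s = s ->
  kop_inv s (coset_emb 1%g (delta x)) = bar (a s) *: coset_emb 1%g (delta x).
Proof. by move=> sJ fixed; rewrite inv_opE kop_base_fixed // bar_a scalerBl. Qed.

Section DualInvolution.
Local Open Scope group_scope.

Definition dual x : IJt := iconj (val x).1^-1 x.

Lemma val_dual x : val (dual x) = ((val x).1^-1, (val x).2).
Proof.
have xI := mem_IJt x; rewrite val_iconj ?groupV ?IJ_mem // /vconj mulVg mul1g.
by rewrite -IJ_autV ?groupV ?IJ_mem // invgK IJ_aut_mem.
Qed.

Lemma inversion_dual s x : s \in J -> N (val (dual x)).1 ((val x).2 s) = N (val x).1 s.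
Proof.
move=> sJ; have xI := mem_IJt x.
by rewrite val_dual -(IJ_aut_mem xI) (inversion_aut xI) ?IJ_mem ?mem_gen.
Qed.

Lemma zact_dual s x :
  (zact (val (dual x)) ((val x).2 s) == (val x).2 s) = (zact (val x) s == s).
Proof.
rewrite val_dual /zact (IJ_autK (mem_IJt x)) invgK.
rewrite -(inj_eq (mulgI (val x).1)) !mulgA mulgV mul1g.
by rewrite -[in RHS](inj_eq (mulIg (val x).1)) mulgKV eq_sym.
Qed.

Lemma dual_iconj s x : s \in J -> dual (iconj s x) = iconj ((val x).2 s) (dual x).
Proof.
move=> sJ; have xI := mem_IJt x; have sS := subsetP JS s sJ.
apply: val_inj; rewrite val_iconj ?mem_gen ?IJ_aut_J // !val_dual val_iconj ?mem_gen //.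
by rewrite /vconj /= IJ_autK // !invMg invgK (simple_invg sS) mulgA.
Qed.

End DualInvolution.

(* Up to a scalar constant on each class, the bar operator maps [M_(y, theta)] to
   [bar H_y M_(y^-1, theta)]. *)
Definition prebar x : V := hbar (val x).1 (coset_emb 1%g (delta (dual x))).

Lemma prebar_up s x : s \in J -> zact (val x) s != s -> N (val x).1 s = false ->
  prebar (iconj s x) = kop_inv s (prebar x).
Proof.
move=> sJ moved ns; have xI := mem_IJt x; have sS := subsetP JS s sJ.
have tJ := IJ_aut_J xI sJ; set t := (val x).2 s in tJ; have tS := subsetP JS t tJ.
have [len_r len_l] := ell_vconj_up xI sJ moved ns.
have yE : (val (iconj s x)).1 = (s * ((val x).1 * t))%g.
  by rewrite val_iconj ?mem_gen // /vconj -/t (simple_invg tS) mulgA.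
rewrite -(val_iconj x (mem_gen sJ)) yE in len_l; rewrite -/t in len_r.
have len_s : ell (s * ((val x).1 * t))%g = (ell s + ell ((val x).1 * t)%g)%N.
  by rewrite len_l len_r (ell_gen sS).
have len_t : ell ((val x).1 * t)%g = (ell (val x).1 + ell t)%N.
  by rewrite len_r (ell_gen tS) addn1.
rewrite /prebar (dual_iconj x sJ) yE (hbar_mul _ len_s) (hbar_mul _ len_t).
rewrite (hbar_gen _ sS) (hbar_gen _ tS) -iop_up; last first.
- by rewrite inversion_dual.
- by rewrite zact_dual.
- by [].
by rewrite -kop_base // kopK.
Qed.

Lemma hbar_intertwine s t u m : s \in S -> t \in S -> (s * u = u * t)%g ->
  N u^-1%g t = N u s -> kop_inv s (hbar u m) = hbar u (kop_inv t m).
Proof.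
move=> sS tS su nut; case: (boolP (N u s)) => [nu|/negPf nu]; last first.
  by rewrite -hbar_mull // su hbar_mulr // nut.
have us : (u * t * t = u)%g by rewrite simple_mulgK.
have nutt : N (u * t)^-1%g t = false by rewrite inversion_mulsr // nut nu.
by rewrite -{1}us hbar_mulr // -su -hbar_desc.
Qed.

Lemma prebar_fixed s x : s \in J -> zact (val x) s = s ->
  kop_inv s (prebar x) = bar (a s) *: prebar x.
Proof.
move=> sJ fixed; have xI := mem_IJt x; have sS := subsetP JS s sJ.
have tJ := IJ_aut_J xI sJ; set t := (val x).2 s in tJ; have tS := subsetP JS t tJ.
have sy : (s * (val x).1 = (val x).1 * t)%g by rewrite -zact_mul fixed.
have at_s : a t = a s.
  have -> : t = (s ^ (val x).1)%g by rewrite conjgE sy mulKg.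
  by rewrite (a_conj (mem_gen sJ) (IJ_mem xI)).
rewrite /prebar (hbar_intertwine _ sS tS sy); last first.
  by have := inversion_dual x sJ; rewrite val_dual.
rewrite kop_inv_base_fixed ?linearZ ?bar_a ?at_s //.
by apply/eqP; rewrite zact_dual fixed.
Qed.

Lemma minimal_prebar x : minimal (val x) ->
  exists c, c *: prebar x = coset_emb 1%g (delta x).
Proof.
move=> xmin; have xI := mem_IJt x; have yF := minimal_fixers xI xmin.
have dual_x : dual x = x.
  apply: val_inj; rewrite val_iconj ?groupV ?IJ_mem //.
  by apply: fixers_vconj; rewrite ?groupV.
rewrite /prebar dual_x; move: (val x).1 yF => u.
have FS := subset_trans (fixers_sub (val x)) JS.
move: u; apply: gen_indl => [|s u sF uF [c cE]]; first by exists 1; rewrite hbar1 scale1r.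
have [sJ /eqP fixed] : s \in J /\ zact (val x) s == s by apply/andP; rewrite inE in sF.
have sS := subsetP JS s sJ; have a_unit : a s * bar (a s) = 1.
  by rewrite bar_a mulrBr a_quadratic [a s * q]mulrC addrK.
have [nu|/negPf nu] := boolP (N u s).
  exists (bar (a s) * c); rewrite -scalerA hbar_mull_desc // -(linearZ_LR (kop s)) cE.
  by rewrite kop_base_fixed // scalerA [_ * a s]mulrC a_unit scale1r.
exists (a s * c); rewrite -scalerA hbar_mull // -(linearZ_LR (kop_inv s)) cE.
by rewrite kop_inv_base_fixed // scalerA a_unit scale1r.
Qed.

Definition class_scalar (A : {set ext gT}) : R :=
  epsilon (inhabits 0) (fun c => forall x, val x \in A -> minimal (val x) ->
    c *: prebar x = coset_emb 1%g (delta x)).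

Lemma class_scalar_minimal x : minimal (val x) ->
  class_scalar (zclass J (val x)) *: prebar x = coset_emb 1%g (delta x).
Proof.
move=> xmin; have xI := mem_IJt x; rewrite /class_scalar; set P := fun c => _.
have [c cE] := minimal_prebar xmin.
have Pc : P c; last first.
  exact: (epsilon_spec (inhabits 0) P (ex_intro _ c Pc)) (mem_zclass xI) xmin.
move=> y /imsetP [g gJ yE] ymin; suff -> : y = x by [].
by apply: val_inj; rewrite yE minimal_unique // -yE.
Qed.

Definition ibar_basis x : V := class_scalar (zclass J (val x)) *: prebar x.
Definition ibar : {linear M -> V | bar \; *:%R} := semilinear_lift bar ibar_basis.
#[global] Arguments ibar : simpl never.

Lemma ibar_delta x : ibar (delta x) = class_scalar (zclass J (val x)) *: prebar x.
Proof. exact: semilinear_lift_delta. Qed.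

Lemma ibar_minimal x : minimal (val x) -> ibar (delta x) = coset_emb 1%g (delta x).
Proof. by move=> xmin; rewrite ibar_delta class_scalar_minimal. Qed.

Lemma ibar_up s x : s \in J -> zact (val x) s != s -> N (val x).1 s = false ->
  ibar (delta (iconj s x)) = kop_inv s (ibar (delta x)).
Proof.
move=> sJ moved ns; rewrite !ibar_delta (linearZ_LR (kop_inv s)) (prebar_up sJ moved ns).
by rewrite (val_iconj x (mem_gen sJ)) (zclass_vconj (mem_IJt x) (mem_gen sJ)).
Qed.

Lemma ibar_fixed s x : s \in J -> zact (val x) s = s ->
  kop_inv s (ibar (delta x)) = bar (a s) *: ibar (delta x).
Proof.
move=> sJ fixed; rewrite ibar_delta (linearZ_LR (kop_inv s)) prebar_fixed //.
by rewrite !scalerA mulrC.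
Qed.

Lemma ibar_iop s f : s \in J -> ibar (iop s f) = kop_inv s (ibar f).
Proof.
move=> sJ; apply: semilinear_intertwine => x.
have [fixed|moved] := eqVneq (zact (val x) s) s.
  by rewrite iop_fixed // semilinearZ ibar_fixed.
have [ns|/negPf ns] := boolP (N (val x).1 s); last first.
  by rewrite (iop_up sJ moved ns) (ibar_up sJ moved ns).
pose y := iconj s x; have xE : x = iconj s y by rewrite iconjK.
have moved_y : zact (val y) s != s by rewrite zact_iconj_simple.
have ny : N (val y).1 s = false.
  by rewrite -(iconj_desc sJ moved_y) -xE ltnNge ltnW ?ilen_down.
rewrite iop_moved // ns linearD semilinearZ bar_q scaleNr -/y xE (ibar_up sJ moved_y ny).
by rewrite kop_inv_quadratic ?(subsetP JS).
Qed.

Definition kbar_basis i : V := hbar (val i).1 (ibar (delta (kinv i))).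
Definition kbar : {linear V -> V | bar \; *:%R} := semilinear_lift bar kbar_basis.
#[global] Arguments kbar : simpl never.

Lemma kbar_delta i : kbar (delta i) = hbar (val i).1 (ibar (delta (kinv i))).
Proof. exact: semilinear_lift_delta. Qed.

Lemma kbar_coset w f : w \in WJup S J -> kbar (coset_emb w f) = hbar w (ibar f).
Proof.
move=> wK; apply: semilinear_intertwine => x.
rewrite (coset_emb_delta wK) kbar_delta SubK; congr (hbar _ (ibar (delta _))).
by apply: val_inj; rewrite !SubK.
Qed.

Lemma kbar_kop s m : s \in S -> kbar (kop s m) = kop_inv s (kbar m).
Proof.
move=> sS; apply: semilinear_intertwine => i; have [wK _] := KJP i.
rewrite delta_coset_emb (kbar_coset _ wK); set w := (val i).1 in wK *.
move: (delta _) => f.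
have [swK|swK] := boolP ((s * w)%g \in WJup S J).
  rewrite kop_coset_up // linearD semilinearZ !kbar_coset //.
  have [nw|/negPf nw] := boolP (N w s); last first.
    by rewrite rmorph0 scale0r addr0 hbar_mull.
  by rewrite bar_q scaleNr (hbar_desc _ sS nw) kop_inv_quadratic.
have [tJ nw] := deodhar JS wK sS swK.
rewrite kop_coset_stay // kbar_coset // ibar_iop //.
rewrite (hbar_intertwine _ sS (subsetP JS _ tJ)) //.
  by rewrite !mulgA mulgV mul1g.
by rewrite nw (WJup_no_inversion JS wK) ?TJ_gen.
Qed.

Lemma kbar_hact h m :
  kbar (hact kop h m) = semilinear_lift bar (fun w => hbar w (kbar m)) h.
Proof.
rewrite /hact linear_sum; apply: eq_bigr => w _; rewrite semilinearZ; congr (_ *: _).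
by apply: (opW_intertwine (pi := kbar)) => s m' sS; apply: kbar_kop.
Qed.

Definition locally_minimal i : Prop := {in S, forall s, (kheight i <= kheight (kact s i))%N}.

Lemma locally_minimal_base i : locally_minimal i ->
  (val i).1 = 1%g /\ minimal (val i).2.
Proof.
move=> imin; have [wK zI] := KJP i.
have w1 : (val i).1 = 1%g.
  apply/eqP; apply: contraT => w1.
  have [s sS nw] := desc_exists (subxx S) (mem_genS _) w1.
  have swK := WJup_desc JS wK sS nw; have := imin s sS.
  rewrite /kheight val_kact // sact_up // leq_add2r leq_double.
  by rewrite leqNgt -inversion_desc ?nw.
split=> //; apply/forall_inP => s sJ; apply/implyP => ns.
have sS := subsetP JS s sJ; have := imin s sS; rewrite /kheight val_kact //.
have swK : (s * (val i).1)%g \notin WJup S J by rewrite w1 mulg1 simple_notin_WJup.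
have [_ _ ->] := sact_stay (valP i) sS swK; rewrite w1 invg1 mul1g mulg1 leq_add2l.
apply: contraLR => moved; rewrite -ltnNge.
exact: ltnW (vconj_down zI (TJ_gen sJ) moved ns).
Qed.

Lemma kbar_minimal i : locally_minimal i -> kbar (delta i) = delta i.
Proof.
case/locally_minimal_base=> w1 zmin; rewrite kbar_delta w1 hbar1 ibar_minimal ?SubK //.
by rewrite [RHS]delta_coset_emb w1.
Qed.

(** * Unitriangularity of the bar operator *)

Lemma kop_up s i : (kheight i < kheight (kact s i))%N ->
  kop s (delta i) = delta (kact s i).
Proof. exact: hecke_op_up. Qed.

Lemma kascent_ind (P : K -> Prop) :
  (forall i, locally_minimal i -> P i) ->
  (forall s i, s \in S -> (kheight i < kheight (kact s i))%N -> P i -> P (kact s i)) ->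
  forall i, P i.
Proof.
move=> P0 PS i; have [k] := ubnP (kheight i); elim: k i => // k IH i ik.
have [|] := boolP [forall s in S, kheight i <= kheight (kact s i)]%N.
  by move/forall_inP; apply: P0.
case/forall_inPn=> s sS; rewrite -ltnNge => lt_i.
rewrite -(kactK sS i); apply: PS; rewrite ?kactK //.
by apply: IH; apply: leq_trans lt_i _; rewrite -ltnS.
Qed.

Lemma kop_inv_coef s j k : s \in S -> k != j ->
  kop_inv s (delta j) k =
  if (k == kact s j) && (kheight j != kheight (kact s j)) then 1 else 0.
Proof.
move=> sS kj; rewrite inv_opE ffun_subE ffun_scaleE deltaE (negPf kj) mulr0 subr0.
rewrite /kop hecke_opE /hecke_step; case: ltngtP => _; rewrite /= ?andbT ?andbF.
- by rewrite deltaE; case: eqP.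
- by rewrite ffunE ffun_scaleE !deltaE (negPf kj) mulr0 addr0; case: eqP.
by rewrite ffun_scaleE deltaE (negPf kj) mulr0.
Qed.

Lemma kprec_kact s i j : s \in S -> (kheight i < kheight (kact s i))%N ->
  kprec j i -> kheight j != kheight (kact s j) -> kprec (kact s j) (kact s i).
Proof.
move=> sS lt_i ji; rewrite neq_ltn => /orP [lt_j|lt_j]; first exact: kprec_lift.
apply: (kprec_trans _ (kprec_trans ji (kprec_up sS lt_i))).
by have := @kprec_up s (kact s j) sS; rewrite kactK //; apply.
Qed.

Definition leading i m : Prop := m i = 1 /\ forall j, j != i -> ~~ kprec j i -> m j = 0.

Lemma leading_delta i : leading i (delta i).
Proof.
by split=> [|j ji _]; rewrite deltaE ?eqxx // (negPf ji).
Qed.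

Lemma leading_kop_inv s i m : s \in S -> (kheight i < kheight (kact s i))%N ->
  leading i m -> leading (kact s i) (kop_inv s m).
Proof.
move=> sS lt_i [mi m0]; have i_si := kprec_up sS lt_i.
have coefE k : kop_inv s m k = \sum_j m j * kop_inv s (delta j) k.
  rewrite {1}(delta_expand m) linear_sum sum_ffunE; apply: eq_bigr => j _.
  by rewrite (linearZ_LR (kop_inv s)) ffun_scaleE.
have si_i : kact s i != i by apply: contraTneq lt_i => ->; rewrite ltnn.
have lower_vanish k j : k != i -> ~~ kprec k (kact s i) -> j != i ->
    m j * kop_inv s (delta j) k = 0.
  move=> ki k_si ji; have [jlt|jlt] := boolP (kprec j i); last by rewrite m0 ?mul0r.
  have kj : k != j by apply: contraNneq k_si => ->; apply: kprec_trans jlt i_si.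
  rewrite kop_inv_coef //; case: andP => [[/eqP kE hj]|_]; last by rewrite mulr0.
  by rewrite kE kprec_kact in k_si.
split=> [|k k_si nlt].
  rewrite coefE (bigD1 i) //= mi mul1r big1 ?addr0.
    by rewrite kop_inv_coef // eqxx neq_ltn lt_i.
  by move=> j ji; apply: lower_vanish; rewrite ?kprec_irr.
have ki : k != i by apply: contraNneq nlt => ->.
rewrite coefE big1 // => j _; have [->|ji] := eqVneq j i; last exact: lower_vanish.
by rewrite kop_inv_coef // (negPf k_si) mulr0.
Qed.

Lemma kbar_leading i : leading i (kbar (delta i)).
Proof.
move: i; apply: kascent_ind => [i imin|s i sS lt_i IH].
  by rewrite kbar_minimal //; apply: leading_delta.
by rewrite -(kop_up lt_i) (kbar_kop _ sS); apply: leading_kop_inv.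
Qed.

Lemma kbar_unitriangular : unitriangular kprec (fun i => kbar (delta i)).
Proof.
move=> i; have [m_i m0] := kbar_leading i; exists (kbar (delta i)).
apply/ffunP => k; rewrite ffunE sum_deltaE deltaE.
have [->|ki] := eqVneq k i; first by rewrite kprec_irr addr0 m_i.
by case: ifPn => nlt; rewrite add0r // m0.
Qed.

Lemma kbar_kop_inv s m : s \in S -> kbar (kop_inv s m) = kop s (kbar m).
Proof.
move=> sS; rewrite inv_opE linearB semilinearZ bar_q scaleNr opprK kbar_kop // inv_opE.
by rewrite subrK.
Qed.

Lemma kbarK : involutive bar -> involutive kbar.
Proof.
move=> barK; apply: semilinear_involutive => //.
apply: kascent_ind => [i imin|s i sS lt_i IH].
  by rewrite !kbar_minimal.
by rewrite -(kop_up lt_i) (kbar_kop _ sS) (kbar_kop_inv _ sS) IH.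
Qed.

Lemma kbar_unique (psi : {linear V -> V | bar \; *:%R}) :
  (forall s m, s \in S -> psi (kop s m) = kop_inv s (psi m)) ->
  (forall i, locally_minimal i -> psi (delta i) = delta i) -> psi =1 kbar.
Proof.
move=> psi_kop psi_min m; rewrite (semilinear_expand psi) (semilinear_expand kbar).
apply: eq_bigr => i _.
congr (_ *: _); move: i; apply: kascent_ind => [i imin|s i sS lt_i IH].
  by rewrite psi_min ?kbar_minimal.
by rewrite -(kop_up lt_i) (psi_kop _ _ sS) (kbar_kop _ sS) IH.
Qed.

End BarOperator.
End InvolutionModules.

(** * Laurent coefficients *)

Section LaurentModules.
Local Open Scope ring_scope.
Local Notation K := (KJt S J).
Local Notation V := {ffun K -> laurent^o}.
Local Notation H := {ffun gT -> laurent^o}.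
Local Notation delta := (@delta laurent _).
Local Notation q := (xL - xLinv).
Implicit Types (i j : K) (h : H) (m : V).

Lemma lbar_q : lbar q = - q.
Proof. by rewrite rmorphB /= lbar_x lbar_xinv opprB. Qed.

Lemma mscE c m : msc S J c m = c *: m.
Proof. by apply/ffunP => i; rewrite !ffunE. Qed.

Lemma hscE c h : hsc c h = c *: h.
Proof. by apply/ffunP => w; rewrite !ffunE. Qed.

Lemma Mb_delta i : Mb S J (val i) = delta i.
Proof. by apply/ffunP => j; rewrite ffunE deltaE val_eqE; case: eqP. Qed.

Lemma Hb_delta w : Hb w = delta w.
Proof. by apply/ffunP => u; rewrite ffunE deltaE; case: eqP. Qed.

Lemma Lgen_lreg s h : s \in S -> Lgen S s h = lreg q s h.
Proof.
move=> sS; have LgenL : linear (Lgen S s : H -> H).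
  move=> c h1 h2; apply/ffunP => u; rewrite !ffunE /GRing.scale /=.
  by case: ifP => _; ring.
have [f fE] := linear_packed LgenL.
rewrite -[LHS]/((Lgen S s : H -> H) h) fE.
apply: linear_delta_ext => w; rewrite -fE lregE //; apply/ffunP => u.
rewrite [LHS]ffunE [RHS]ffunE ffun_scaleE !deltaE -inversion_desc //.
have -> : (u == s * w)%g = (s * u == w)%g.
  by rewrite -(inj_eq (mulgI s)) simple_mulKg.
by congr (_ + _); have [->|_] := eqVneq u w; case: ifP; rewrite ?mulr0 ?mul0r ?mulr1.
Qed.

Lemma Happ_opw k w h : Happ S k w h = opw S (fun s => lreg q s) k w h.
Proof.
elim: k w => // k IH w /=; case: pickP => // s /andP [sS _].
by rewrite Lgen_lreg ?IH.
Qed.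

Lemma Hmul_hmul h h' : Hmul S h h' = hmul q h h'.
Proof. by apply: eq_bigr => w _; rewrite hscE Happ_opw. Qed.

Lemma Hmul_Hinv w : Hmul S (Hb w) (Hinv S w) = Hone.
Proof.
have [|_ //] := epsilon_spec (inhabits Hone)
  (fun h => Hmul S h (Hb w) = Hone /\ Hmul S (Hb w) h = Hone).
by exists (hinv q w); rewrite !Hmul_hmul /Hone !Hb_delta hmul_hinv hmul_hinvl.
Qed.

Lemma hact_barH (M : lmodType laurent) (rho : gT -> {linear M -> M}) h (x : M) :
  (forall s, s \in S -> forall y, rho s (rho s y) = y + q *: rho s y) ->
  (forall s t, s \in S -> t \in S ->
    altop (rho s) (rho t) #[s * t]%g =1 altop (rho t) (rho s) #[s * t]%g) ->
  hact rho (barH S h) x =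
  semilinear_lift lbar (fun w => opW S (fun s => inv_op q rho s) w x) h.
Proof.
move=> rho_quadratic rho_braid; rewrite /hact linear_sum; apply: eq_bigr => w _.
rewrite hscE linearZ; congr (_ *: _); apply: hact_right_inverse => //.
by rewrite -Hmul_hmul -!Hb_delta Hmul_Hinv.
Qed.

Section SignCharacter.
Variable sigma : gT -> int.
Hypothesis sigmaM : {in WJ J &, forall u v, sigma (u * v)%g = sigma u * sigma v}.
Hypothesis sigma_sign : {in WJ J, forall u, sigma u = 1 \/ sigma u = -1}.

Definition sign_eigen r : laurent := if sigma r == -1 then - xLinv else xL.

Lemma sign_eigen_quadratic r : sign_eigen r * sign_eigen r = 1 + q * sign_eigen r.
Proof.
rewrite /sign_eigen; case: ifP => _; rewrite mulrBl ?mulrNN ?mulrN.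
  by rewrite xL_mulV; ring.
by rewrite [xLinv * _]mulrC xL_mulV; ring.
Qed.

Lemma sign_eigen_bar r : lbar (sign_eigen r) = sign_eigen r - q.
Proof.
rewrite /sign_eigen; case: ifP => _; rewrite ?rmorphN /= ?lbar_x ?lbar_xinv; ring.
Qed.

Lemma sign_eigen_conj : {in <<J>>%g &, forall r g, sign_eigen (r ^ g)%g = sign_eigen r}.
Proof.
move=> r g rJ gJ; have rgJ : (r ^ g)%g \in WJ J by apply: groupJ.
have : sigma (g * r ^ g)%g = sigma (r * g)%g by rewrite conjgE mulKVg.
rewrite /sign_eigen (sigmaM gJ rgJ) (sigmaM rJ gJ) mulrC; case: (sigma_sign gJ) => ->.
  by rewrite !mulr1 => ->.
by rewrite !mulrN1 => /oppr_inj ->.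
Qed.

Local Notation kopS := (kop q sign_eigen).
Local Notation kbarS := (kbar q sign_eigen lbar).

Let kopS_quadratic s : s \in S -> forall m, kopS s (kopS s m) = m + q *: kopS s m.
Proof. by move=> sS m; apply/kop_quadratic/sS/sign_eigen_quadratic. Qed.

Let kopS_braid s t : s \in S -> t \in S ->
  altop (kopS s) (kopS t) #[s * t]%g =1 altop (kopS t) (kopS s) #[s * t]%g.
Proof. exact: kop_braid sign_eigen_quadratic sign_eigen_conj s t. Qed.

Lemma Hs_Mb_kop s i : s \in S -> Hs_Mb S J sigma s (val i) = kopS s (delta i).
Proof.
move=> sS; rewrite /Hs_Mb -(val_kact i sS) !ht_kact // !Mb_delta !mscE.
by rewrite /kop hecke_opE /hecke_step /keigen /sign_eigen; case: (sigma _ == _).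
Qed.

Lemma hecke_module_kop : hecke_module_structure S J sigma (hact kopS).
Proof.
split=> [c h h' m|c h m m'|m|h h' m|s i sS].
- by rewrite hscE mscE; apply: (linearP (hecke_orbit kopS m)).
- by rewrite !mscE; apply: (linearP (hact kopS h)).
- by rewrite /Hone Hb_delta hact1.
- by rewrite Hmul_hmul; apply: (hact_hmul kopS_quadratic kopS_braid).
by rewrite Hb_delta Mb_delta hact_gen // Hs_Mb_kop.
Qed.

Lemma hecke_module_unique act : hecke_module_structure S J sigma act -> act = hact kopS.
Proof.
case=> act_linl act_linr act1 actM act_gen.
have actS s m : s \in S -> act (delta s) m = kopS s m.
  move=> sS; have [f fE] : exists f : {linear V -> V}, act (delta s) = f.
    by apply: linear_packed => c m1 m2; rewrite -!mscE; apply: act_linr.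
  rewrite fE; apply: (linear_delta_ext (f := f) (g := kopS s)) => i.
  by rewrite -fE -Hs_Mb_kop // -act_gen // Hb_delta Mb_delta.
apply: functional_extensionality => h; apply: functional_extensionality => m.
have [f fE] : exists f : {linear H -> V}, act^~ m = f.
  by apply: linear_packed => c h1 h2; rewrite /= -hscE -mscE; apply: act_linl.
rewrite -[LHS]/(act^~ m h) fE.
apply: (linear_delta_ext (f := f) (g := hecke_orbit kopS m)) => w.
rewrite -[RHS]/(hact kopS (delta w) m) hact_delta -fE.
move: w; apply: ascent_ind => [|s w sS nw IH]; first by rewrite -Hb_delta act1 opW1.
have -> : delta (s * w)%g = Hmul S (delta s) (delta w) by rewrite Hmul_hmul hmul_gen.
by rewrite actM actS // IH (opW_mull (subxx S)) ?mem_genS.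
Qed.

Lemma no_strict_descentP i :
  reflect (locally_minimal i) (no_strict_descent S J (val i)).
Proof.
apply: (iffP forall_inP) => imin s sS.
  by have := imin s sS; rewrite -(val_kact i sS) ht_kact // -leqNgt.
by rewrite -(val_kact i sS) ht_kact // -leqNgt imin.
Qed.

Lemma bar_operator_kbar : bar_operator S J (hact kopS) kbarS.
Proof.
split=> [c m m'|h m|i /no_strict_descentP imin].
- by rewrite !mscE; apply: (linearP kbarS).
- rewrite hact_barH //; apply: kbar_hact sign_eigen_bar h m => //.
  + exact: sign_eigen_quadratic.
  + exact: sign_eigen_conj.
  exact: lbar_q.
rewrite Mb_delta; apply: kbar_minimal imin => //.
- exact: sign_eigen_quadratic.
- exact: sign_eigen_conj.
exact: sign_eigen_bar.
Qed.

Lemma bar_operator_unique psi : bar_operator S J (hact kopS) psi -> psi = kbarS.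
Proof.
case=> psi_lin psi_act psi_fix; apply: functional_extensionality => m.
have [f fE] : exists f : {linear V -> V | lbar \; *:%R}, psi = f.
  by apply: linear_packed => c m1 m2; rewrite /= -!mscE; apply: psi_lin.
rewrite fE; apply: (kbar_unique sign_eigen_quadratic sign_eigen_conj lbar_q sign_eigen_bar).
  move=> s m' sS; rewrite -fE -(hact_gen kopS_braid m' sS) psi_act hact_barH //.
  rewrite semilinear_lift_delta.
  exact: (hbar_gen sign_eigen_quadratic sign_eigen_conj _ sS).
by move=> i imin; rewrite -fE -Mb_delta psi_fix //; apply/no_strict_descentP.
Qed.

Lemma sum_Mb (P : pred K) (c : K -> laurent) :
  \sum_(j | P j) msc S J (c j) (Mb S J (val j)) = \sum_(j | P j) c j *: delta j.
Proof. by apply: eq_bigr => j _; rewrite mscE Mb_delta. Qed.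

Lemma canonical_kprecP (B : K -> Mod S J) :
  (forall i, kbarS (B i) = B i /\ exists c : K -> laurent,
     (forall j, in_negpart (c j)) /\ B i = Mb S J (val i) +
       \sum_(j : K | prec S J (val j) (val i)) msc S J (c j) (Mb S J (val j))) <->
  canonical in_negpart kprec kbarS B.
Proof.
by split=> canB i; have [barB [c [neg_c BE]]] := canB i; split=> //; exists c;
  rewrite BE sum_Mb Mb_delta.
Qed.

Lemma hecke_module_exists_unique : exists! act, hecke_module_structure S J sigma act.
Proof.
exists (hact kopS); split=> [|act /hecke_module_unique -> //].
exact: hecke_module_kop.
Qed.

Lemma bar_operator_exists_unique : exists! psi, bar_operator S J (hact kopS) psi.
Proof.
exists kbarS; split=> [|psi /bar_operator_unique -> //].
exact: bar_operator_kbar.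
Qed.

Lemma sign_kbarK : involutive kbarS.
Proof.
by apply: (kbarK sign_eigen_quadratic sign_eigen_conj lbar_q sign_eigen_bar); apply: lbarK.
Qed.

Lemma sign_kbar_unitriangular i : exists c : K -> laurent, kbarS (Mb S J (val i)) =
  Mb S J (val i) + \sum_(j : K | prec S J (val j) (val i)) msc S J (c j) (Mb S J (val j)).
Proof.
have triS := kbar_unitriangular sign_eigen_quadratic sign_eigen_conj lbar_q sign_eigen_bar.
have [c cE] := triS i.
by exists c; rewrite sum_Mb !Mb_delta.
Qed.

Lemma canonical_basis_exists_unique : exists! B : K -> Mod S J,
  is_basis S J B /\ forall i, kbarS (B i) = B i /\ exists c : K -> laurent,
    (forall j, in_negpart (c j)) /\ B i = Mb S J (val i) +
      \sum_(j : K | prec S J (val j) (val i)) msc S J (c j) (Mb S J (val j)).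
Proof.
have triS := kbar_unitriangular sign_eigen_quadratic sign_eigen_conj lbar_q sign_eigen_bar.
have [B canB] := canonical_exists in_negpart0 in_negpartD in_negpart_bar_split
  (@kprec_irr) (@kprec_trans) sign_kbarK triS.
exists B; split; first (split; last exact/canonical_kprecP).
  move=> m; have [c [cE c_uniq]] := unitriangular_basis (@kprec_irr) (@kprec_trans)
    (canonical_unitriangular canB) m.
  have mscB (d : {ffun K -> laurent}) :
      \sum_i msc S J (d i) (B i) = \sum_i d i *: B i.
    by apply: eq_bigr => i _; rewrite mscE.
  by exists c; split=> [|d]; rewrite mscB //; apply: c_uniq.
move=> B' [_ /canonical_kprecP canB']; apply: functional_extensionality.
exact: (canonical_unique in_negpart0 in_negpartD in_negpartN in_negpart_bar_fixed
  (@kprec_irr) (@kprec_trans) triS canB canB').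
Qed.

End SignCharacter.
End LaurentModules.
End ParabolicInvolutions.
End CoxeterSystem.

Local Open Scope ring_scope.

Theorem mainTheorem11 (gT : finGroupType) (S J : {set gT}) (sigma : gT -> int) :
  coxeter_system S -> J \subset S ->
  {in WJ J &, forall u v, sigma (u * v)%g = sigma u * sigma v} ->
  {in WJ J, forall u, sigma u = 1 \/ sigma u = -1} ->
  (* (a) *)
  (exists! act, hecke_module_structure S J sigma act) /\
  forall act, hecke_module_structure S J sigma act ->
  (* (b) *)
  (exists! psi, bar_operator S J act psi) /\
  forall psi, bar_operator S J act psi ->
    (forall m, psi (psi m) = m) /\
    (forall i : KJt S J, exists c : KJt S J -> laurent,
        psi (Mb S J (val i)) =
        Mb S J (val i) + \sum_(j : KJt S J | prec S J (val j) (val i)) msc S J (c j) (Mb S J (val j))) /\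
  (* (c) *)
    (exists! B : KJt S J -> Mod S J,
       is_basis S J B /\
       forall i : KJt S J,
         psi (B i) = B i /\
         exists c : KJt S J -> laurent,
           (forall j, in_negpart (c j)) /\
           B i = Mb S J (val i) + \sum_(j : KJt S J | prec S J (val j) (val i)) msc S J (c j) (Mb S J (val j))).
Proof.
move=> cox JS sigmaM sigma_sign.
split=> [|act /(hecke_module_unique cox JS sigmaM sigma_sign) ->].
  exact: hecke_module_exists_unique.
split=> [|psi /(bar_operator_unique cox JS sigmaM sigma_sign) ->].
  exact: bar_operator_exists_unique.
split; first exact: sign_kbarK.
split; first exact: sign_kbar_unitriangular.
exact: canonical_basis_exists_unique.
Qed.
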